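(* If Radius in an undirected weighted $N$-node, $M$-edge graph can be computed in $f(N,M)$ time, then the minimum weight directed $k$-cycle problem in $n$-node, $m$-edge graphs with edge weights in $[-R,R]$ can be solved in $\tilde{O}(f(O(n),O(m))\log R+m)$ time.
   Context: Radius of a weighted graph: $\min_u\max_v d(u,v)$, where $d(u,v)$ is the shortest path distance. Minimum weight directed $k$-cycle ($k$ a constant): given a directed graph with integer edge weights, find a simple directed cycle on exactly $k$ vertices of minimum total weight. $\tilde{O}$ hides polylogarithmic factors. *)

(* Defs.v *)
From Stdlib Require Import ZArith.
From HB Require Import structures.
From mathcomp Require Import all_boot all_order all_algebra.
From mathcomp Require Import ssrZ constructive_ereal.

Set Implicit Arguments.
Unset Strict Implicit.
Unset Printing Implicit Defensive.

Import Order.TTheory GRing.Theory Num.Theory.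
Local Open Scope ring_scope.

(** * The machine model: a word RAM

    A program uses finitely many registers and finitely many arrays (memory
    segments), all holding integers. Every atomic command and every test of a
    conditional or loop costs one unit of time. The word length is enforced by the
    bound [B] of [exec]: a computation has no execution as soon as an operation
    produces a value of absolute value greater than [B]. *)

Inductive binop : Type :=
  | OAdd | OSub | OMul | ODiv | OMod | OEq | OLt | OAnd | OOr | OXor | OShl | OShr.

Definition bitwise (op : Z -> Z -> Z) (x y : int) : int :=
  int_of_Z (op (Z_of_int x) (Z_of_int y)).

Definition eval_binop (o : binop) (x y : int) : int :=
  match o with
  | OAdd => x + y
  | OSub => x - y
  | OMul => x * y
  | ODiv => divz x y
  | OMod => modz x y
  | OEq => ((x == y)%R : nat)%:Z
  | OLt => ((x < y)%R : nat)%:Z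
  | OAnd => bitwise Z.land x y
  | OOr => bitwise Z.lor x y
  | OXor => bitwise Z.lxor x y
  | OShl => bitwise Z.shiftl x y
  | OShr => bitwise Z.shiftr x y
  end.

Inductive com : Type :=
  | Skip
  | Const (x : nat) (v : int)            (* x := v *)
  | Op (o : binop) (x y z : nat)         (* x := y o z *)
  | Read (x a y : nat)                   (* x := a[y] *)
  | Write (a x y : nat)                  (* a[x] := y *)
  | Seq (p q : com)
  | If (x : nat) (p q : com)             (* if x != 0 then p else q *)
  | While (x : nat) (p : com).           (* while x != 0 do p *)

Record state : Type := State {
  reg : nat -> int;
  arr : nat -> int -> int
}.

Definition set_reg (s : state) (x : nat) (v : int) : state :=
  State (fun y => if y == x then v else reg s y) (arr s).

Definition set_arr (s : state) (a : nat) (i v : int) : state :=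
  State (reg s)
    (fun b j => if (b == a) && (j == i) then v else arr s b j).

(** [exec B p s t s']: started in [s], the program [p] halts in [s'] after
    exactly [t] time units, all values it computes lying in [-B, B]. *)
Inductive exec (B : nat) : com -> state -> nat -> state -> Prop :=
  | ExecSkip s : exec B Skip s 1 s
  | ExecConst x (v : int) s :
      `|v| <= B%:Z -> exec B (Const x v) s 1 (set_reg s x v)
  | ExecOp o x y z s :
      `|eval_binop o (reg s y) (reg s z)| <= B%:Z ->
      exec B (Op o x y z) s 1
        (set_reg s x (eval_binop o (reg s y) (reg s z)))
  | ExecRead x a y s :
      exec B (Read x a y) s 1 (set_reg s x (arr s a (reg s y)))
  | ExecWrite a x y s :
      exec B (Write a x y) s 1 (set_arr s a (reg s x) (reg s y))
  | ExecSeq p q s1 s2 s3 t1 t2 :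
      exec B p s1 t1 s2 -> exec B q s2 t2 s3 ->
      exec B (Seq p q) s1 (t1 + t2)%N s3
  | ExecIfTrue x p q s t s' :
      reg s x != 0 -> exec B p s t s' -> exec B (If x p q) s t.+1 s'
  | ExecIfFalse x p q s t s' :
      reg s x = 0 -> exec B q s t s' -> exec B (If x p q) s t.+1 s'
  | ExecWhileTrue x p s1 s2 s3 t1 t2 :
      reg s1 x != 0 -> exec B p s1 t1 s2 -> exec B (While x p) s2 t2 s3 ->
      exec B (While x p) s1 (t1 + t2).+1 s3
  | ExecWhileFalse x p s :
      reg s x = 0 -> exec B (While x p) s 1 s.

(** * Weighted graphs, given by the list of their edges in any order *)

Definition edges (n : nat) : Type := seq ('I_n * 'I_n * int).

Definition adj (n : nat) (E : edges n) : rel 'I_n :=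
  fun u v => (u, v) \in [seq e.1 | e <- E].

Definition simple_digraph (n : nat) (E : edges n) : bool :=
  uniq [seq e.1 | e <- E] && all (fun e => e.1.1 != e.1.2) E.

(** In a simple digraph the sum has at most one term. *)
Definition arc_weight (n : nat) (E : edges n) (u v : 'I_n) : int :=
  \sum_(e <- E | e.1 == (u, v)) e.2.

(** An undirected graph is given by listing each of its edges once, in either
    orientation; [undir] adds the reverse arcs. *)
Definition undir (n : nat) (E : edges n) : edges n :=
  E ++ [seq ((e.1.2, e.1.1), e.2) | e <- E].

Definition simple_graph (n : nat) (E : edges n) : bool :=
  simple_digraph (undir E).

Definition weights_in (n : nat) (E : edges n) (a b : int) : bool :=
  all (fun e => a <= e.2 <= b) E.

(** ** Radius *)

Fixpoint path_weight (n : nat) (E : edges n) (u : 'I_n) (p : seq 'I_n) : int :=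
  if p is v :: p' then arc_weight E u v + path_weight E v p' else 0.

Definition simple_path (n : nat) (E : edges n) (u v : 'I_n) (p : seq 'I_n) :
    bool :=
  [&& path (adj E) u p, last u p == v & uniq (u :: p)].

(** [p] lists the vertices of the path after [u]; a simple path has fewer than
    [n] edges. The distance is [+oo] if there is no path. *)
Definition dist (n : nat) (E : edges n) (u v : 'I_n) : \bar int :=
  \big[Order.min/+oo%E]_(j < n)
    \big[Order.min/+oo%E]_(p : j.-tuple 'I_n | simple_path (undir E) u v p)
      (path_weight (undir E) u p)%:E.

Definition radius (n : nat) (E : edges n) : \bar int :=
  \big[Order.min/+oo%E]_(u < n) \big[Order.max/-oo%E]_(v < n) dist E u v.

(** ** Directed k-cycles *)

Definition is_kcycle (n k : nat) (E : edges n) (c : k.-tuple 'I_n) : bool :=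
  cycle (adj E) c && uniq c.

Definition cycle_weight (n : nat) (E : edges n) (c : seq 'I_n) : int :=
  \sum_(u <- c) arc_weight E u (next c u).

Definition min_kcycle (n k : nat) (E : edges n) (c : k.-tuple 'I_n) : Prop :=
  is_kcycle E c /\
  forall c' : k.-tuple 'I_n, is_kcycle E c' ->
    cycle_weight E c <= cycle_weight E c'.

(** * Solving the two problems in a given time *)

(** The input: registers 0 and 1 hold the numbers of nodes and of edges,
    arrays 0, 1 and 2 the tails, heads and weights of the listed edges; all
    other registers and cells are 0. *)
Definition input (n : nat) (E : edges n) : state :=
  State
    (fun x => match x with
              | 0%N => n%:Z
              | 1%N => (size E)%:Z
              | _ => 0
              end)
    (fun a i => match a, i with
                | 0%N, Posz j => nth 0 [seq (nat_of_ord e.1.1)%:Z | e <- E] j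
                | 1%N, Posz j => nth 0 [seq (nat_of_ord e.1.2)%:Z | e <- E] j
                | 2%N, Posz j => nth 0 [seq e.2 | e <- E] j
                | _, _ => 0
                end).

(** Largest absolute value of a word of [O(log (n + m + W))] bits, where [b] is
    the constant of the [O]. *)
Definition word_bound (b n m W : nat) : nat := ((n + m + W + 2) ^ b)%N.

Definition radius_output (n : nat) (E : edges n) (s : state) : Prop :=
  reg s 0 = if radius E is r%:E%E then r else -1.

Definition kcycle_output (k n : nat) (E : edges n) (s : state) : Prop :=
  (reg s 0 = 0 /\ forall c : k.-tuple 'I_n, ~~ is_kcycle E c)
  \/ (reg s 0 = 1 /\
      exists2 c : k.-tuple 'I_n, min_kcycle E c &
        forall i : 'I_k, arr s 0 (nat_of_ord i)%:Z
                         = (nat_of_ord (tnth c i))%:Z).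

Definition radius_in_time (f : nat -> nat -> nat) : Prop :=
  exists (P : com) (b : nat),
    forall (n : nat) (E : edges n) (W : nat),
      (0 < n)%N -> simple_graph E -> weights_in E 0 W%:Z ->
      exists (t : nat) (s : state),
        [/\ exec (word_bound b n (size E) W) P (input E) t s,
            (t <= f n (size E))%N & radius_output E s].

Definition kcycle_in_time (k : nat) (g : nat -> nat -> nat -> nat) : Prop :=
  exists (P : com) (b : nat),
    forall (n : nat) (E : edges n) (R : nat),
      simple_digraph E -> weights_in E (- R%:Z) R%:Z ->
      exists (t : nat) (s : state),
        [/\ exec (word_bound b n (size E) R) P (input E) t s,
            (t <= g n (size E) R)%N & kcycle_output k E s].

(** [f (O(n), O(m))], with [c] the constant of both [O]s; no monotonicity of
    [f] is assumed. *)
Definition bigO_args (f : nat -> nat -> nat) (c n m : nat) : nat :=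
  (\max_(N < (c * n).+1) \max_(M < (c * m).+1) f N M)%N.

(** The binary logarithm, made positive: [1 + floor (log2 x)]. *)
Definition log_pos (x : nat) : nat := (trunc_log 2 x).+1.

(** [g] is [O (h (n, m, R) * polylog n)]; the [+ 1] only matters where [h]
    vanishes, as it may on an edgeless graph. *)
Definition soft_O (g h : nat -> nat -> nat -> nat) : Prop :=
  exists C e : nat, forall n m R : nat,
    (g n m R <= C * log_pos n ^ e * (h n m R + 1))%N.

(* Main.v *)
From Stdlib Require Import ZArith.
From mathcomp Require Import all_boot all_order all_algebra.
From mathcomp Require Import zify ssrZ constructive_ereal.
Require Import Defs.

(** Closed walks of length [k] are turned into simple cycles by colour coding:
    two distinct vertices differ in a bit, so [O(log n)] choices for each pair of
    positions suffice to place some minimum cycle in [k] disjoint layers, and the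
    number of colourings is polylogarithmic. For one colouring, take copies of
    the vertices in layers [0, ..., k] and the arcs between consecutive layers,
    with a large constant [Y] added to their weights. Only the copies in layer
    [0] can be centres. For the copy of [a], two hubs with weights [X +- v S] bring close
    all of layer [k] but the copy of [a] in layer [k], which the hubs leave at
    distance [2 X]. Hence the radius is the minimum of [2 X] and [k Y] plus the
    weight of a closed walk, and one radius computation per colouring is enough:
    no binary search is needed. Scaling the weight of an arc leaving [u] in layer
    [i] to [w n^k + u n^i] makes this minimum encode the vertices of an optimal
    cycle. Lower bounds on distances come from Lipschitz potentials. The radius
    program is run on fresh memory by moving its registers and arrays into array
    cells indexed by the number of the colouring. *)

Set Implicit Arguments.
Unset Strict Implicit.
Unset Printing Implicit Defensive.

Import Order.TTheory GRing.Theory Num.Theory.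
Local Open Scope ring_scope.

(** * Expressions and weakest preconditions *)

(** The radius is a minimum over centres of a maximum over targets, so the eccentricity of the copy
    of [a] in layer 0 has to be its distance to a single target. Arc costs are at most [gOm] in
    absolute value, hence the values of closed walks lie within [k * gOm] of [k * gY]. All other
    targets must therefore lie within [k * gY - k * gOm], while the fallback
    [2 * gX = k * gY + 2 * k * gOm] lies above every walk value and signals that there is no walk.
    The slope [gS = 3 * k * gOm] is exactly the gap between these two bounds, which is why two hubs
    with opposite slopes single out [a] with only [O(n)] edges. The graph being undirected, a path
    may turn back between layers or leave through a hub; [gY] dominates the other constants so that
    no such detour beats both the walks and [2 * gX]. On the machine side, the program is not told
    the bound on the weights, and apart from the calls of the radius program only time near-linear
    in [m] is available, which may be far below the number of nodes. *)

Inductive expr : Type :=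
  | EVar of nat
  | ECst of int
  | EBin of binop & expr & expr
  | ERead of nat & expr.

Fixpoint eval (s : state) (e : expr) : int :=
  match e with
  | EVar x => reg s x
  | ECst v => v
  | EBin o e1 e2 => eval_binop o (eval s e1) (eval s e2)
  | ERead a e => arr s a (eval s e)
  end.

(** A register is bounded although its value exists already: the machine has no move, so [cexpr]
    copies it by adding 0. A read is never checked by the machine. *)
Fixpoint safe (B : nat) (s : state) (e : expr) : Prop :=
  match e with
  | EVar x => `|reg s x| <= B%:Z
  | ECst v => `|v| <= B%:Z
  | EBin o e1 e2 =>
      [/\ safe B s e1, safe B s e2
        & `|eval_binop o (eval s e1) (eval s e2)| <= B%:Z]
  | ERead a e => safe B s e
  end.

(* Registers from [tb] on are scratch space for the evaluation of expressions. *)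
Definition tb : nat := 40.

Fixpoint lowe (e : expr) : bool :=
  match e with
  | EVar x => (x < tb)%N
  | ECst _ => true
  | EBin _ e1 e2 => lowe e1 && lowe e2
  | ERead _ e => lowe e
  end.

Fixpoint ecost (e : expr) : nat :=
  match e with
  | EVar _ => 2
  | ECst _ => 1
  | EBin _ e1 e2 => ecost e1 + (ecost e2 + 1)
  | ERead _ e => ecost e + 1
  end%N.

Fixpoint cexpr (e : expr) (r : nat) : com :=
  match e with
  | EVar x => Seq (Const r 0) (Op OAdd r x r)
  | ECst v => Const r v
  | EBin o e1 e2 => Seq (cexpr e1 r) (Seq (cexpr e2 r.+1) (Op o r r r.+1))
  | ERead a e => Seq (cexpr e r) (Read r a r)
  end.

Definition loweq (s c : state) : Prop :=
  (forall x, (x < tb)%N -> reg c x = reg s x) /\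
  (forall a i, arr c a i = arr s a i).

(** [r] acts as a stack pointer: only registers from [r] on are written, so the value of [e1] in [r]
    survives the evaluation of [e2] above it. *)
Lemma cexpr_exec B s e r c :
  lowe e -> (tb <= r)%N -> safe B s e -> loweq s c ->
  exists c', [/\ exec B (cexpr e r) c (ecost e) c', reg c' r = eval s e,
    forall x, (x < r)%N -> reg c' x = reg c x & arr c' = arr c].
Proof.
elim: e r c => [x|v|o e1 IH1 e2 IH2|a e IH] r c /=.
- move=> xb rb sx [cr ca].
  have xr : (x == r) = false by apply/eqP; lia.
  eexists; split.
  + apply: (ExecSeq (t1 := 1) (t2 := 1)); first exact: ExecConst.
    by apply: ExecOp => /=; rewrite xr eqxx addr0 cr.
  + by rewrite /= !eqxx xr addr0 cr.
  + by move=> y yr /=; rewrite (_ : (y == r) = false) //; apply/eqP; lia.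
  + by [].
- move=> _ rb sv _; eexists; split; first exact: ExecConst.
  + by rewrite /= eqxx.
  + by move=> y yr /=; rewrite (_ : (y == r) = false) //; apply/eqP; lia.
  + by [].
- move=> /andP[l1 l2] rb [s1 s2 sb] sc.
  have [c1 [x1 v1 f1 a1]] := IH1 r c l1 rb s1 sc.
  have sc1 : loweq s c1.
    case: sc => cr ca; split=> [x xb|b i]; last by rewrite a1.
    by rewrite f1 ?cr //; lia.
  have [c2 [x2 v2 f2 a2]] := IH2 r.+1 c1 l2 (leqW rb) s2 sc1.
  have v1' : reg c2 r = eval s e1 by rewrite f2.
  eexists; split.
  + apply: (ExecSeq x1); apply: (ExecSeq x2).
    by apply: ExecOp; rewrite v2 v1'.
  + by rewrite /= eqxx v2 v1'.
  + move=> y yr /=; rewrite (_ : (y == r) = false); last by apply/eqP; lia.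
    by rewrite f2 ?f1 //; lia.
  + by rewrite /= a2.
- move=> le rb se sc.
  have [c1 [x1 v1 f1 a1]] := IH r c le rb se sc.
  eexists; split.
  + exact: (ExecSeq x1 (ExecRead _ _ _ _ _)).
  + by case: sc => _ ca; rewrite /= eqxx v1 a1 ca.
  + move=> y yr /=; rewrite (_ : (y == r) = false); last by apply/eqP; lia.
    by rewrite f1.
  + by [].
Qed.

(* The states [s] are abstract: their scratch registers are irrelevant. *)
Definition wp (B : nat) (c : com) (T : nat) (Q : state -> Prop) (s : state) :
    Prop :=
  forall c0, loweq s c0 ->
    exists t c1 s1, [/\ exec B c c0 t c1, (t <= T)%N, loweq s1 c1 & Q s1].

Definition assign (x : nat) (e : expr) : com :=
  Seq (cexpr e tb) (Seq (Const tb.+1 0) (Op OAdd x tb tb.+1)).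

Definition store (a : nat) (e1 e2 : expr) : com :=
  Seq (cexpr e1 tb) (Seq (cexpr e2 tb.+1) (Write a tb tb.+1)).

Definition ifE (e : expr) (p q : com) : com := Seq (cexpr e tb) (If tb p q).

Definition whileE (e : expr) (p : com) : com :=
  Seq (cexpr e tb) (While tb (Seq p (cexpr e tb))).

Definition forE (i : nat) (e : expr) (p : com) : com :=
  Seq (assign i (ECst 0))
    (whileE (EBin OLt (EVar i) e)
       (Seq p (assign i (EBin OAdd (EVar i) (ECst 1))))).

Section Wp.
Variable B : nat.
Hypothesis B_gt0 : (0 < B)%N.

Lemma wp_weaken c T T' (Q Q' : state -> Prop) s :
  wp B c T Q s -> (T <= T')%N -> (forall s', Q s' -> Q' s') -> wp B c T' Q' s.
Proof.
move=> H TT QQ c0 /H[t [c1 [s1 [x l e q]]]].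
by exists t, c1, s1; split => //; [exact: leq_trans TT | exact: QQ].
Qed.

Lemma wp_skip Q s : Q s -> wp B Skip 1 Q s.
Proof. by move=> q c0 sc; exists 1%N, c0, s; split => //; exact: ExecSkip. Qed.

Lemma wp_seq c1 c2 T1 T2 Q s :
  wp B c1 T1 (wp B c2 T2 Q) s -> wp B (Seq c1 c2) (T1 + T2) Q s.
Proof.
move=> H c0 /H[t1 [d1 [s1 [x1 l1 e1 /(_ _ e1)[t2 [d2 [s2 [x2 l2 e2 q]]]]]]]].
exists (t1 + t2)%N, d2, s2; split => //; first exact: ExecSeq x1 x2.
exact: leq_add.
Qed.

Lemma wp_assign x e Q s :
  (x < tb)%N -> lowe e -> safe B s e -> `|eval s e| <= B%:Z ->
  Q (set_reg s x (eval s e)) -> wp B (assign x e) (ecost e + 2) Q s.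
Proof.
move=> xb le se be q c0 sc.
have [c1 [x1 v1 f1 a1]] := cexpr_exec le (leqnn tb) se sc.
exists (ecost e + 2)%N; eexists; exists (set_reg s x (eval s e)); split; [| exact: leqnn | | exact: q].
- apply: (ExecSeq x1); apply: (ExecSeq (t1 := 1) (t2 := 1)).
    by apply: ExecConst.
  by apply: ExecOp; rewrite /= v1 addr0.
- case: sc => cr ca; split => [y yb|b i] /=; last by rewrite a1 ca.
  case: eqP => // _; first by rewrite v1 addr0.
  by rewrite (_ : (y == 41%N) = false) ?f1 ?cr //; apply/eqP; rewrite /tb in yb; lia.
Qed.

Lemma wp_store a e1 e2 Q s :
  lowe e1 -> lowe e2 -> safe B s e1 -> safe B s e2 ->
  Q (set_arr s a (eval s e1) (eval s e2)) ->
  wp B (store a e1 e2) (ecost e1 + ecost e2 + 1) Q s.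
Proof.
move=> l1 l2 s1 s2 q c0 sc.
have [c1 [x1 v1 f1 a1]] := cexpr_exec l1 (leqnn tb) s1 sc.
have sc1 : loweq s c1.
  case: sc => cr ca; split=> [x xb|b i]; last by rewrite a1.
  by rewrite f1 ?cr //; lia.
have [c2 [x2 v2 f2 a2]] := cexpr_exec l2 (leqW (leqnn tb)) s2 sc1.
eexists; eexists; exists (set_arr s a (eval s e1) (eval s e2)); split; [| | | exact: q].
- apply: (ExecSeq x1); apply: (ExecSeq x2); exact: ExecWrite.
- lia.
- case: sc1 => cr ca; split => [y yb|b i] /=.
    by rewrite f2 ?cr //; lia.
  by rewrite f2 // v1 v2 a2 ca.
Qed.

Lemma loweq_cexpr s e c : lowe e -> safe B s e -> loweq s c ->
  exists c', [/\ exec B (cexpr e tb) c (ecost e) c', reg c' tb = eval s e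
    & loweq s c'].
Proof.
move=> le se sc.
have [c1 [x1 v1 f1 a1]] := cexpr_exec le (leqnn tb) se sc.
exists c1; split => //; case: sc => cr ca; split=> [x xb|b i]; last by rewrite a1.
by rewrite f1 ?cr.
Qed.

Lemma wp_if e p q T Q s :
  lowe e -> safe B s e ->
  (eval s e != 0 -> wp B p T Q s) -> (eval s e = 0 -> wp B q T Q s) ->
  wp B (ifE e p q) (ecost e + T.+1) Q s.
Proof.
move=> le se Hp Hq c0 sc.
have [c1 [x1 v1 sc1]] := loweq_cexpr le se sc.
case: (eqVneq (eval s e) 0) => [e0|e0].
- have [t [c2 [s2 [x2 l2 sc2 q2]]]] := Hq e0 _ sc1.
  exists (ecost e + t.+1)%N, c2, s2; split => //; last by lia.
  by apply: (ExecSeq x1); apply: ExecIfFalse => //; rewrite v1.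
- have [t [c2 [s2 [x2 l2 sc2 q2]]]] := Hp e0 _ sc1.
  exists (ecost e + t.+1)%N, c2, s2; split => //; last by lia.
  by apply: (ExecSeq x1); apply: ExecIfTrue => //; rewrite v1.
Qed.

(** The sum of two bounds in place of a common one lets each branch fix its own bound, so that both
    can be left to unification. *)
Lemma wp_if2 e p q T1 T2 Q s :
  lowe e -> safe B s e ->
  (eval s e != 0 -> wp B p T1 Q s) -> (eval s e = 0 -> wp B q T2 Q s) ->
  wp B (ifE e p q) (ecost e + (T1 + T2).+1) Q s.
Proof.
move=> le se Hp Hq; apply: wp_if => // H.
  by apply: wp_weaken (Hp H) _ _ => //; exact: leq_addr.
by apply: wp_weaken (Hq H) _ _ => //; exact: leq_addl.
Qed.

Lemma wp_while_false e p Q s :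
  lowe e -> safe B s e -> eval s e = 0 -> Q s ->
  wp B (whileE e p) (ecost e + 1) Q s.
Proof.
move=> le se e0 q c0 sc.
have [c1 [x1 v1 sc1]] := loweq_cexpr le se sc.
exists (ecost e + 1)%N, c1, s; split => //.
by apply: (ExecSeq x1); apply: ExecWhileFalse; rewrite v1.
Qed.

Lemma wp_while_true e p T1 T2 Q s :
  lowe e -> safe B s e -> eval s e != 0 ->
  wp B p T1 (wp B (whileE e p) T2 Q) s ->
  wp B (whileE e p) (ecost e + 1 + T1 + T2) Q s.
Proof.
move=> le se e0 H c0 sc.
have [c1 [x1 v1 sc1]] := loweq_cexpr le se sc.
have [t2 [c2 [s2 [x2 l2 sc2 /(_ _ sc2)]]]] := H _ sc1.
move=> [t3 [c3 [s3 [x3 l3 sc3 q]]]].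
(* The remaining run of [whileE] is cut into its test and the machine loop; that test is regrouped
   with the body of the round just done. *)
inversion x3 as [| | | | |p0 q0 d1 d2 d3 u1 u2 y1 y2| | | |]; subst.
exists (ecost e + ((t2 + u1) + u2).+1)%N, c3, s3; split => //; last by lia.
apply: (ExecSeq x1); apply: ExecWhileTrue y2; rewrite ?v1 //.
exact: ExecSeq x2 y1.
Qed.

(* The constant 20 leaves room for the test and the increment. *)
Lemma wp_for (I : nat -> state -> Prop) i e p N Tb Q s :
  (i < tb)%N -> lowe e -> (N < B)%N ->
  (forall j s, (j <= N)%N -> I j s ->
     [/\ reg s i = j%:Z, eval s e = N%:Z & safe B s e]) ->
  (forall j s, (j < N)%N -> I j s ->
     wp B p Tb (fun s' => reg s' i = j%:Z /\ I j.+1 (set_reg s' i j.+1%:Z)) s) ->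
  I 0%N (set_reg s i 0) -> (forall s, I N s -> Q s) ->
  wp B (forE i e p) (N.+1 * (Tb + ecost e + 20)) Q s.
Proof.
move=> ib le NB Ie Ip I0 IQ.
have W d : forall j s, (j + d = N)%N -> I j s ->
    wp B (whileE (EBin OLt (EVar i) e)
       (Seq p (assign i (EBin OAdd (EVar i) (ECst 1)))))
      (ecost e + 5 + d * (Tb + ecost e + 20)) Q s.
  elim: d => [|d IH] j s1 jd Ij.
    rewrite addn0 in jd; subst j; have [ri ee ss] := Ie _ _ (leqnn N) Ij.
    apply: wp_weaken; first apply: (wp_while_false _ (Q := Q)) => //=.
    - by rewrite ib le.
    - by split => //; [rewrite ri; lia | rewrite ri ee ltxx].
    - by rewrite ri ee ltxx.
    - exact: IQ Ij.
    - by rewrite /=; lia.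
    - by [].
  have jN : (j < N)%N by lia.
  have [ri ee ss] := Ie _ _ (ltnW jN) Ij.
  apply: wp_weaken;
    first apply: (wp_while_true (Q := Q) (T2 := ecost e + 5 + d * (Tb + ecost e + 20))) => //=.
  - by rewrite ib le.
  - by split => //; [rewrite ri; lia | rewrite ri ee ltz_nat jN /=; lia].
  - by rewrite ri ee ltz_nat jN.
  - apply: wp_seq; apply: wp_weaken (Ip _ _ jN Ij) (leqnn _) _ => s2 [r2 I2].
    apply: wp_assign => //=.
    + by rewrite ib.
    + by rewrite r2; split; lia.
    + by rewrite r2; lia.
    + by rewrite r2 -PoszD addn1; apply: IH I2; lia.
  - by rewrite /=; lia.
  - by [].
apply: wp_weaken; first apply: wp_seq.
- apply: wp_assign => //=.
  by apply: (W N 0%N).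
- by rewrite /= mulSn; lia.
- by [].
Qed.

End Wp.

(** * Time bounds of loop-free commands *)

Fixpoint loopfree (c : com) : bool :=
  match c with
  | Seq p q => loopfree p && loopfree q
  | If _ p q => loopfree p && loopfree q
  | While _ _ => false
  | _ => true
  end.

Fixpoint tcost (c : com) : nat :=
  match c with
  | Seq p q => tcost p + tcost q
  | If _ p q => (tcost p + tcost q).+1
  | _ => 1
  end%N.

Lemma exec_tcost B c s t s' : loopfree c -> exec B c s t s' -> (t <= tcost c)%N.
Proof.
move=> lc X; elim: X lc => //=.
- by move=> p q s1 s2 s3 t1 t2 _ IH1 _ IH2 /andP[/IH1 ? /IH2 ?]; exact: leq_add.
- by move=> x p q s1 t1 s2 _ _ IH /andP[/IH ? _]; lia.
- by move=> x p q s1 t1 s2 _ _ IH /andP[_ /IH ?]; lia.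
Qed.

(** Syntax bounds the time of a loop-free command, so its specification may be proved with whatever
    bound unification yields; the resulting bound is independent of the input. *)
Lemma wp_static B c Q s : loopfree c -> (exists T, wp B c T Q s) ->
  wp B c (tcost c) Q s.
Proof.
move=> lc [T H] c0 /H[t [c1 [s1 [x l e q]]]].
by exists t, c1, s1; split => //; exact: exec_tcost x.
Qed.

Lemma loopfree_cexpr e r : loopfree (cexpr e r).
Proof. by elim: e r => //= [o e1 IH1 e2 IH2|a e IH] r; rewrite ?IH1 ?IH2 ?IH. Qed.

(** * Running a program in fresh memory *)

Lemma exec_leq B B' c s t s' : (B <= B')%N -> exec B c s t s' -> exec B' c s t s'.
Proof.
move=> BB; elim=> *; try (by econstructor; eauto).
- by apply: ExecConst; lia.
- by apply: ExecOp; lia.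
Qed.

Definition bounded (B : nat) (s : state) : Prop :=
  (forall x, `|reg s x| <= B%:Z) /\ (forall a i, `|arr s a i| <= B%:Z).

Lemma exec_bounded B c s t s' : exec B c s t s' -> bounded B s -> bounded B s'.
Proof.
elim=> //; try by move=> *; eauto.
- by move=> x v s0 bv [br ba]; split => //= y; case: eqP.
- by move=> o x y z s0 bv [br ba]; split => //= w; case: eqP.
- by move=> x a y s0 [br ba]; split => //= w; case: eqP.
- by move=> a x y s0 [br ba]; split => //= b i; case: ifP.
Qed.

Section Simulation.
(* The register [x] of the simulated program is the cell [rv] of the array
   [off + 2x], its cell [a[i]] is the cell [i * rK + rv] of [off + 2a + 1]. *)
Variables off rv rK : nat.
Hypotheses (rv_low : (rv < tb)%N) (rK_low : (rK < tb)%N).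

Definition rdE (x : nat) : expr := ERead (off + x.*2) (EVar rv).
Definition cellE (e : expr) : expr :=
  EBin OAdd (EBin OMul e (EVar rK)) (EVar rv).

Fixpoint sim (c : com) : com :=
  match c with
  | Skip => Skip
  | Const x v => store (off + x.*2) (EVar rv) (ECst v)
  | Op o x y z => store (off + x.*2) (EVar rv) (EBin o (rdE y) (rdE z))
  | Read x a y =>
      store (off + x.*2) (EVar rv) (ERead (off + a.*2.+1) (cellE (rdE y)))
  | Write a x y => store (off + a.*2.+1) (cellE (rdE x)) (rdE y)
  | Seq p q => Seq (sim p) (sim q)
  | If x p q => ifE (rdE x) (sim p) (sim q)
  | While x p => whileE (rdE x) (sim p)
  end.

(** The last clause protects the arrays below [off] and the residue classes modulo [K] other than
    [v]. Each colouring owns one class, so later ones still find zeros in theirs and nothing has to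
    be erased. *)
Definition simrel (v K : nat) (s0 s : state) (s1 : state) : Prop :=
  [/\ forall x, reg s x = reg s0 x,
      forall x, arr s (off + x.*2) v%:Z = reg s1 x,
      forall a i, arr s (off + a.*2.+1) (i * K%:Z + v%:Z) = arr s1 a i
    & forall a z, (a < off)%N || (modz z K%:Z != v%:Z) ->
        arr s a z = arr s0 a z].

Lemma modz_cell (v K : nat) (i : int) : (v < K)%N ->
  modz (i * K%:Z + v%:Z) K%:Z = v%:Z.
Proof. by move=> vK; rewrite modzMDl modz_nat modn_small. Qed.

Lemma sim_set_reg v K s0 s s1 x w : (v < K)%N ->
  simrel v K s0 s s1 ->
  simrel v K s0 (set_arr s (off + x.*2) v%:Z w) (set_reg s1 x w).
Proof.
move=> vK [H1 H2 H3 H4]; split => //=.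
- move=> y; rewrite eqxx andbT H2.
  by congr (if _ then _ else _); apply/eqP/eqP; lia.
- by move=> a i; rewrite H3 (_ : _ == _ = false) //; apply/eqP; lia.
- move=> a z H; rewrite H4 //; case: ifP => // /andP[/eqP aE /eqP zE].
  move: H; rewrite aE zE modz_nat modn_small // eqxx orbF; lia.
Qed.

Lemma sim_set_arr v K s0 s s1 a i w : (v < K)%N ->
  simrel v K s0 s s1 ->
  simrel v K s0 (set_arr s (off + a.*2.+1) (i * K%:Z + v%:Z) w) (set_arr s1 a i w).
Proof.
move=> vK [H1 H2 H3 H4]; split => //=.
- by move=> y; rewrite H2 (_ : _ == _ = false) //; apply/eqP; lia.
- move=> b j; rewrite H3; congr (if _ then _ else _).
  have K0 : (K%:Z != 0) by lia.
  congr (_ && _); first by apply/eqP/eqP; lia.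
  by rewrite (inj_eq (addIr _)) (inj_eq (mulIf K0)).
- move=> b z H; rewrite H4 //; case: ifP => // /andP[/eqP aE /eqP zE].
  move: H; rewrite aE zE modz_cell // eqxx orbF; lia.
Qed.

(** Indices of the simulated program are at most [B0] in absolute value, so the actual ones are at
    most [B0 * K + K]. The factor 20 bounds the cost of the translation of any single command. *)
Lemma sim_exec B B0 (v K : nat) s0 c s1 t s1' :
  (0 < B0)%N -> (B0 * K + K <= B)%N -> (v < K)%N ->
  reg s0 rv = v%:Z -> reg s0 rK = K%:Z ->
  exec B0 c s1 t s1' -> bounded B0 s1 -> forall s, simrel v K s0 s s1 ->
  wp B (sim c) (20 * t) (fun s' => simrel v K s0 s' s1') s.
Proof.
move=> B0p KB vK v0 K0.
have Bp : (0 < B)%N by nia.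
have rvB s2 s : simrel v K s0 s s2 -> reg s rv = v%:Z.
  by case=> H _ _ _; rewrite H.
have rKB s2 s : simrel v K s0 s s2 -> reg s rK = K%:Z.
  by case=> H _ _ _; rewrite H.
have rd s2 s y : simrel v K s0 s s2 -> eval s (rdE y) = reg s2 y.
  by move=> R; case: (R) => _ H _ _; rewrite /= (rvB _ _ R) H.
have sv s2 s : simrel v K s0 s s2 -> `|reg s rv| <= B%:Z.
  by move=> R; rewrite (rvB _ _ R); nia.
have scell s2 s y : bounded B0 s2 -> simrel v K s0 s s2 -> safe B s (cellE (rdE y)).
  move=> [br _] R; move: (rd _ _ y R) => /= ->; split => //; last first.
  - by rewrite (rKB _ _ R) (rvB _ _ R); move: (br y); nia.
  - exact: sv R.
  - split => //; first exact: sv R.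
    + by rewrite (rKB _ _ R); nia.
    + by rewrite (rKB _ _ R); move: (br y); nia.
have cell s2 s y : simrel v K s0 s s2 ->
    eval s (cellE (rdE y)) = reg s2 y * K%:Z + v%:Z.
  by move=> R; move: (rd _ _ y R) => /= ->; rewrite (rKB _ _ R) (rvB _ _ R).
move=> X; elim: X => {c s1 t s1'}.
- move=> s1 _ s R.
  by apply: (wp_weaken (T := 1) (Q := fun s' => simrel v K s0 s' s1)) => //; apply: wp_skip.
- move=> x w s1 bw bs s R.
  apply: wp_weaken; first apply: (wp_store Bp (Q := fun s' => simrel v K s0 s' (set_reg s1 x w))) => //=.
  + exact: sv R.
  + nia.
  + by rewrite (rvB _ _ R); exact: sim_set_reg.
  + by [].
  + by [].
- move=> o x y z s1 bw bs s R.
  apply: wp_weaken; first apply: (wp_store Bp (Q := fun s' => simrel v K s0 s' (set_reg s1 x (eval_binop o (reg s1 y) (reg s1 z))))) => //.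
  + by rewrite /= !rv_low.
  + exact: sv R.
  + split; try exact: sv R.
    by rewrite !(rd _ _ _ R); nia.
  + have -> : eval s (EVar rv) = v%:Z by exact: rvB R.
    have -> : eval s (EBin o (rdE y) (rdE z)) = eval_binop o (reg s1 y) (reg s1 z).
      by rewrite -[LHS]/(eval_binop o (eval s (rdE y)) (eval s (rdE z))) !(rd _ _ _ R).
    exact: sim_set_reg.
  + by [].
  + by [].
- move=> x a y s1 bs s R.
  apply: wp_weaken; first apply: (wp_store Bp (Q := fun s' => simrel v K s0 s' (set_reg s1 x (arr s1 a (reg s1 y))))) => //.
  + by rewrite /= rv_low rK_low.
  + exact: sv R.
  + exact: scell R.
  + have -> : eval s (EVar rv) = v%:Z by exact: rvB R.
    have -> : eval s (ERead (off + a.*2.+1) (cellE (rdE y))) = arr s1 a (reg s1 y).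
      rewrite -[LHS]/(arr s _ (eval s (cellE (rdE y)))) (cell _ _ _ R).
      by case: (R).
    exact: sim_set_reg.
  + by [].
  + by [].
- move=> a x y s1 bs s R.
  apply: wp_weaken; first apply: (wp_store Bp (Q := fun s' => simrel v K s0 s' (set_arr s1 a (reg s1 x) (reg s1 y)))) => //.
  + by rewrite /= rv_low rK_low.
  + exact: scell R.
  + exact: sv R.
  + by rewrite (cell _ _ _ R) (rd _ _ _ R); exact: sim_set_arr.
  + by [].
  + by [].
- move=> p q s1 s2 s3 t1 t2 X1 IH1 X2 IH2 b1 s R.
  rewrite mulnDr; apply: wp_seq; apply: wp_weaken (IH1 b1 s R) (leqnn _) _ => s' R'.
  exact: IH2 (exec_bounded X1 b1) _ R'.
- move=> x p q s1 t s2 x0 X1 IH1 b1 s R.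
  apply: wp_weaken; first apply: (wp_if Bp (T := 20 * t) (Q := fun s' => simrel v K s0 s' s2)) => //.
  + exact: sv R.
  + by move=> _; exact: IH1.
  + by rewrite (rd _ _ _ R) => x1; rewrite x1 eqxx in x0.
  + by rewrite /=; lia.
  + by [].
- move=> x p q s1 t s2 x0 X1 IH1 b1 s R.
  apply: wp_weaken; first apply: (wp_if Bp (T := 20 * t) (Q := fun s' => simrel v K s0 s' s2)) => //.
  + exact: sv R.
  + by rewrite (rd _ _ _ R) x0.
  + by move=> _; exact: IH1.
  + by rewrite /=; lia.
  + by [].
- move=> x p s1 s2 s3 t1 t2 x0 X1 IH1 X2 IH2 b1 s R.
  apply: wp_weaken; first apply: (wp_while_true Bp (T2 := 20 * t2) (Q := fun s' => simrel v K s0 s' s3)) => //.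
  + exact: sv R.
  + by rewrite (rd _ _ _ R).
  + apply: wp_weaken (IH1 b1 s R) (leqnn _) _ => s' R'.
    exact: IH2 (exec_bounded X1 b1) _ R'.
  + by rewrite /=; lia.
  + by [].
- move=> x p s1 x0 b1 s R.
  apply: wp_weaken; first apply: (wp_while_false _ (Q := fun s' => simrel v K s0 s' s1)) => //.
  + exact: sv R.
  + by rewrite (rd _ _ _ R).
  + by [].
  + by [].
Qed.

End Simulation.

(** * Distances and radius *)

Lemma bigmin_attained (T : eqType) (r : seq T) (P : pred T) (f : T -> int) (c : int) :
  \big[Order.min/c]_(e <- r | P e) f e < c ->
  exists e, [/\ e \in r, P e & \big[Order.min/c]_(e <- r | P e) f e = f e].
Proof.
elim: r => [|e r IH]; first by rewrite big_nil ltxx.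
rewrite big_cons; case: ifP => Pe.
  case: (leP (f e) (\big[Order.min/c]_(e <- r | P e) f e)) => le1 lt1.
    by exists e; rewrite mem_head.
  have [e' [er Pe' ->]] := IH lt1.
  by exists e'; rewrite in_cons er orbT.
by move=> /IH[e' [er Pe' ->]]; exists e'; rewrite in_cons er orbT.
Qed.

Lemma bigmin_EFin_leP (I : finType) (P : pred I) (f : I -> \bar int) (r : int) :
  (\big[Order.min/+oo%E]_(i | P i) f i <= r%:E)%O ->
  exists2 i, P i & (f i <= r%:E)%O.
Proof.
move=> H; have [/existsP[i /andP[Pi fi]]|/existsPn no] :=
  boolP [exists i, P i && (f i <= r%:E)%O]; first by exists i.
move: H; rewrite leNgt => /negP[]; apply/bigmin_gtP; split; first exact: ltry.
by move=> i Pi; rewrite ltNge; move: (no i); rewrite Pi.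
Qed.

(** Trades the nested extrema for quantifiers over paths; no path is lost, since a simple one has
    fewer than [n] edges. *)
Lemma radius_leP (n : nat) (F : edges n) (r : int) :
  (radius F <= r%:E)%O <->
  exists u, forall v, exists2 p, simple_path (undir F) u v p
    & path_weight (undir F) u p <= r.
Proof.
split=> [/bigmin_EFin_leP[u _ /bigmax_leP[_ H]]|[u H]].
  exists u => v; have /bigmin_EFin_leP[j _ /bigmin_EFin_leP[p sp]] := H v isT.
  by rewrite lee_fin => wp; exists p.
apply: (bigmin_inf u) => //; apply/bigmax_leP; split; first exact: leNye.
move=> v _; have [p sp wp] := H v.
have szp : (size p < n)%N.
  case/and3P: (sp) => _ _ /card_uniqP /= sz.
  by rewrite -[X in (_ <= X)%N]card_ord -sz; exact: max_card.
apply: (bigmin_inf (Ordinal szp)) => //=.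
by apply: (bigmin_inf (in_tuple p)); rewrite //= lee_fin.
Qed.

Lemma arc_weight_simple (n : nat) (E : edges n) e :
  uniq [seq e.1 | e <- E] -> e \in E -> arc_weight E e.1.1 e.1.2 = e.2.
Proof.
rewrite /arc_weight -surjective_pairing; elim: E => //= f E IH /andP[fE uE].
rewrite in_cons big_cons => /predU1P[->|eE].
  rewrite eqxx big1_seq ?addr0 // => g /andP[/eqP gf gE].
  by case/negP: fE; rewrite -gf map_f.
case: eqP => [fe|_]; last exact: IH.
by case/negP: fE; rewrite fe map_f.
Qed.

(** Weak duality for shortest paths: the differences of a Lipschitz function telescope along the
    path. *)
Lemma path_weight_ge (n : nat) (F : edges n) (phi : 'I_n -> int) u p :
  simple_graph F ->
  (forall e, e \in F -> `|phi e.1.1 - phi e.1.2| <= e.2) ->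
  path (adj (undir F)) u p ->
  phi (last u p) - phi u <= path_weight (undir F) u p.
Proof.
move=> /andP[uF _] H; elim: p u => [|v p IH] u /=; first by rewrite subrr.
move=> /andP[uv /IH vp].
suff : phi v - phi u <= arc_weight (undir F) u v by lia.
case/mapP: uv => -[[a b] w] eF /= [-> ->].
have /= -> := arc_weight_simple uF eF.
move: eF; rewrite mem_cat => /orP[/H /= ?|/mapP[[[c d] z] /H /= ? [-> -> ->]]]; lia.
Qed.

Lemma path_weight_rcons (n : nat) (E : edges n) u p v :
  path_weight E u (rcons p v) = path_weight E u p + arc_weight E (last u p) v.
Proof. by elim: p u => [|w p IH] u /=; rewrite ?addr0 ?add0r // IH addrA. Qed.

Lemma radix_inj n i j u v : (u < n)%N -> (v < n)%N ->
  (i * n + u = j * n + v)%N -> i = j /\ u = v.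
Proof.
move=> un vn H; have n0 : (0 < n)%N by lia.
have ij : i = j.
  by move: (congr1 (fun x => x %/ n)%N H); rewrite !divnMDl // !divn_small // !addn0.
by split => //; move: H; rewrite ij => /addnI.
Qed.

(** * The radius instance *)

Section Gadget.
(* Node [i * n + v] is the copy of vertex [v] in layer [i <= k]; the last four
   nodes are the two hubs, the centre [x] and its pendant neighbour. The hub
   weights [X + v S] and [X - v S] make the copies of [a] in layer 0 and of [b]
   in layer [k] close if [a != b], and at distance exactly [2 X] through the
   hubs if [a = b]. *)
Variables (n k m R0 : nat) (tl hd : nat -> nat) (wt : nat -> int).
Variable tst : nat -> nat -> bool.
Hypotheses (n_gt0 : (0 < n)%N) (k_gt0 : (0 < k)%N).
Hypothesis tl_lt : forall e, (e < m)%N -> (tl e < n)%N.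
Hypothesis hd_lt : forall e, (e < m)%N -> (hd e < n)%N.
Hypothesis wt_le : forall e, (e < m)%N -> `|wt e| <= R0%:Z.
Hypothesis arc_inj : forall e e', (e < m)%N -> (e' < m)%N ->
  tl e = tl e' -> hd e = hd e' -> e = e'.

Definition gA : nat := (n ^ k)%N.
(** Bounds the cost of an arc: its weight contributes at most [R0 * gA], and the digit
    [tl e * n ^ i] with [i < k] less than [gA]. *)
Definition gOm : nat := (R0.+1 * gA)%N.
Definition gS : nat := (3 * k * gOm)%N.
(** The factor 2 comes from [far_from_centre]: the hubs have potential [gX + n * gS] and layer 0 has
    [gP], and the difference must not exceed the hub weight [gX - v * gS]. *)
Definition gP : nat := (2 * n * gS)%N.
Definition gY : nat := (20 * n * gS)%N.
Definition gX : nat := (10 * k * n * gS + k * gOm)%N.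
(** Makes the route from layer 0 over [x] to a middle layer or to the pendant as long as the least
    conceivable value of a closed walk. *)
Definition gQ : nat := (k * gY - k * gOm - gP)%N.

Definition gN : nat := (k.+1 * n + 3).+1.
Definition gM : nat := (m * k + n * (k + 4) + 1)%N.

(** Layer [k] repeats layer 0 and takes its colour, hence the modulus. *)
Definition arc (i e : nat) : bool := tst i (tl e) && tst (i.+1 %% k) (hd e).
Definition acost (i e : nat) : int := wt e * gA%:Z + (tl e * n ^ i)%N%:Z.

(** The numbering lets the program compute each edge from its index: [k] edges for each arc, then
    for each vertex four hub edges and [k] spokes, then the pendant edge. Arcs that violate the
    colouring stay with weight [2 * gX], so that only the weights depend on the colouring. *)
Definition gT (j : nat) : nat :=
  if (j < m * k)%N then ((j %% k) * n + tl (j %/ k))%N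
  else let l := (j - m * k)%N in
    if (l < n * (k + 4))%N then
      let v := (l %/ (k + 4))%N in let c := (l %% (k + 4))%N in
      if (c < 2)%N then v else if (c < 4)%N then (k * n + v)%N
      else ((c - 4) * n + v)%N
    else (k.+1 * n + 2)%N.

Definition gH (j : nat) : nat :=
  if (j < m * k)%N then ((j %% k).+1 * n + hd (j %/ k))%N
  else let l := (j - m * k)%N in
    if (l < n * (k + 4))%N then
      let c := (l %% (k + 4))%N in
      if (c < 4)%N then (k.+1 * n + c %% 2)%N else (k.+1 * n + 2)%N
    else (k.+1 * n + 3)%N.

Definition gW (j : nat) : int :=
  if (j < m * k)%N then
    (if arc (j %% k) (j %/ k) then gY%:Z + acost (j %% k) (j %/ k)
     else (2 * gX)%N%:Z)
  else let l := (j - m * k)%N in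
    if (l < n * (k + 4))%N then
      let v := (l %/ (k + 4))%N in let c := (l %% (k + 4))%N in
      if (c < 4)%N then
        (if (c == 0%N) || (c == 3%N) then gX%:Z + (v * gS)%N%:Z
         else gX%:Z - (v * gS)%N%:Z)
      else if c == 4%N then gP%:Z else gQ%:Z
    else gQ%:Z.

Definition gedge (j : nat) : 'I_gN * 'I_gN * int :=
  (inord (gT j), inord (gH j), gW j).

Definition gF : edges gN := mkseq gedge gM.

(** A view of the numbering free of quotients, for case analysis on the kind of an edge. *)
Variant gedge_spec : nat -> nat -> nat -> int -> Prop :=
  | GLayer e i of (e < m)%N & (i < k)%N :
      gedge_spec (e * k + i) (i * n + tl e) (i.+1 * n + hd e)
        (if arc i e then gY%:Z + acost i e else (2 * gX)%N%:Z)
  | GHub v c of (v < n)%N & (c < 4)%N :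
      gedge_spec (m * k + (v * (k + 4) + c))
        (if (c < 2)%N then v else k * n + v)%N (k.+1 * n + c %% 2)
        (if (c == 0%N) || (c == 3%N) then gX%:Z + (v * gS)%N%:Z
         else gX%:Z - (v * gS)%N%:Z)
  | GSpoke v i of (v < n)%N & (i < k)%N :
      gedge_spec (m * k + (v * (k + 4) + (i + 4))) (i * n + v) (k.+1 * n + 2)
        (if i == 0%N then gP%:Z else gQ%:Z)
  | GLast :
      gedge_spec (m * k + n * (k + 4)) (k.+1 * n + 2) (k.+1 * n + 3) gQ%:Z.

Lemma gedgeP j : (j < gM)%N -> gedge_spec j (gT j) (gH j) (gW j).
Proof.
rewrite /gM /gT /gH /gW => jM; case: ifP => jmk.
  rewrite {1}(divn_eq j k); apply: GLayer; last exact: ltn_pmod.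
  by rewrite ltn_divLR.
have jE : (j = m * k + (j - m * k))%N by lia.
case: ifP => [ln|/negbT ln]; last first.
  have -> : (j = m * k + n * (k + 4))%N by lia.
  exact: GLast.
rewrite {1}jE; move: (j - m * k)%N ln => l ln.
have k4 : (0 < k + 4)%N by lia.
have vn : (l %/ (k + 4) < n)%N by rewrite ltn_divLR.
have ck : (l %% (k + 4) < k + 4)%N by exact: ltn_pmod.
rewrite /= {1}(divn_eq l (k + 4)).
move: (l %/ (k + 4))%N (l %% (k + 4))%N vn ck => v c vn ck.
case: (ltnP c 4) => c4; first exact: GHub.
rewrite (_ : (c < 2)%N = false); last by lia.
have {1 3}-> : c = (c - 4 + 4)%N by lia.
have -> : (c - 4 + 4 == 4)%N = (c - 4 == 0)%N by lia.
by apply: GSpoke => //; lia.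
Qed.

Lemma gedge_spec_eq j T H W : gedge_spec j T H W ->
  [/\ (j < gM)%N, gT j = T, gH j = H & gW j = W].
Proof.
have k4 : (0 < k + 4)%N by lia.
case=> [e i em ik|v c vn c4|v i vn ik|]; rewrite /gM /gT /gH /gW.
- have lt : (e * k + i < m * k)%N by nia.
  by rewrite lt divnMDl // modnMDl divn_small // modn_small // addn0; split => //; lia.
- have ge : (m * k + (v * (k + 4) + c) < m * k)%N = false by lia.
  have lt : (v * (k + 4) + c < n * (k + 4))%N by nia.
  have ck : (c < k + 4)%N by lia.
  by rewrite ge addKn lt /= divnMDl // modnMDl divn_small // modn_small // addn0 c4; split => //; lia.
- have ge : (m * k + (v * (k + 4) + (i + 4)) < m * k)%N = false by lia.
  have lt : (v * (k + 4) + (i + 4) < n * (k + 4))%N by nia.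
  have ck : (i + 4 < k + 4)%N by lia.
  rewrite ge addKn lt /= divnMDl // modnMDl divn_small // modn_small // addn0.
  have -> : (i + 4 < 2)%N = false by lia.
  have -> : (i + 4 < 4)%N = false by lia.
  have -> : (i + 4 == 4)%N = (i == 0)%N by lia.
  by rewrite addnK; split => //; lia.
- have ge : (m * k + n * (k + 4) < m * k)%N = false by lia.
  by rewrite ge addKn ltnn; split => //; lia.
Qed.

(** All edges point from the smaller to the larger node, which excludes loops and keeps the list
    disjoint from its reversal. *)
Lemma gedge_lt j T H W : gedge_spec j T H W -> (T < H < gN)%N.
Proof.
rewrite /gN; case=> [e i em ik|v c vn c4|v i vn ik|]; last by lia.
- by have := tl_lt em; have := hd_lt em; nia.
- by have := ltn_pmod c (isT : (0 < 2)%N); case: ifP => _; nia.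
- by nia.
Qed.

Lemma gedge_inj j j' T H W W' :
  gedge_spec j T H W -> gedge_spec j' T H W' -> j = j'.
Proof.
case=> [e i em ik|v c vn c4|v i vn ik|] s2.
- have tn := tl_lt em; have hn := hd_lt em.
  move: s2; move E1 : (i * n + tl e)%N => T1; move E2 : (i.+1 * n + hd e)%N => H1 s2.
  have H1k : (H1 < k.+1 * n)%N by nia.
  case: s2 E1 E2 H1k => [e' i' em' ik'|v' c' vn' c4'|v' i' vn' ik'|]; try by lia.
  move=> /radix_inj[] // => [|-> tt]; first exact: tl_lt.
  move=> /radix_inj[] // => [|_ hh]; first exact: hd_lt.
  by rewrite (arc_inj em em' tt hh).
- move: s2; move E1 : (if _ then _ else _) => T1; move E2 : (_ + _)%N => H1 s2.
  have cc := ltn_pmod c (isT : (0 < 2)%N).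
  case: s2 E1 E2 => [e' i' em' ik'|v' c' vn' c4'|v' i' vn' ik'|]; try by lia.
    by have := hd_lt em'; nia.
  have nk : (n <= k * n)%N by nia.
  move=> E1 E2.
  have pc : (c %% 2 = c' %% 2)%N by lia.
  have cE := divn_eq c 2; have cE' := divn_eq c' 2.
  have : v = v' /\ c = c' by move: E1; case: ifP; case: ifP; lia.
  by case=> -> ->.
- move: s2; move E1 : (i * n + v)%N => T1; move E2 : (_ + _)%N => H1 s2.
  case: s2 E1 E2 => [e' i' em' ik'|v' c' vn' c4'|v' i' vn' ik'|]; try by lia.
  + by have := hd_lt em'; nia.
  + by move=> /radix_inj[] // -> ->.
- move: s2; move E1 : (_ + _)%N => T1; move E2 : (_ + _)%N => H1 s2.
  case: s2 E1 E2 => [e' i' em' ik'|v' c' vn' c4'|v' i' vn' ik'|]; try by lia.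
  + by have := hd_lt em'; nia.
Qed.

Lemma size_gF : size gF = gM. Proof. exact: size_mkseq. Qed.

Lemma gedge_inordK j : (j < gM)%N ->
  (gedge j).1.1 = gT j :> nat /\ (gedge j).1.2 = gH j :> nat.
Proof.
move=> /gedgeP/gedge_lt/andP[TH HN]; rewrite /gedge /=.
by rewrite !inordK //; exact: ltn_trans HN.
Qed.

Lemma gF_simple : simple_graph gF.
Proof.
have memF e : e \in gF -> exists2 j, (j < gM)%N & e = gedge j.
  by case/mapP => j; rewrite mem_iota => /= jM ->; exists j.
have lt e : e \in gF -> (e.1.1 < e.1.2)%N.
  case/memF => j jM ->; have [-> ->] := gedge_inordK jM.
  by case/andP: (gedge_lt (gedgeP jM)).
apply/andP; split; last first.
  apply/allP => e; rewrite mem_cat => /orP[/lt|/mapP[f /lt fl -> /=]].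
    by apply: contraTneq => ->; rewrite ltnn.
  by move: fl; apply: contraTneq => ->; rewrite ltnn.
have uF : uniq [seq e.1 | e <- gF].
  rewrite -map_comp map_inj_in_uniq ?iota_uniq // => j j'.
  rewrite !mem_iota !add0n => /= jM jM' E1.
  have [T1 H1] := gedge_inordK jM; have [T2 H2] := gedge_inordK jM'.
  have TT : gT j = gT j' by rewrite -T1 -T2 /gedge /=; case: E1 => -> _.
  have HH : gH j = gH j' by rewrite -H1 -H2 /gedge /=; case: E1 => _ ->.
  have := gedgeP jM'; rewrite -TT -HH; exact: gedge_inj (gedgeP jM).
rewrite map_cat cat_uniq uF /=; apply/andP; split; last first.
  rewrite -map_comp (_ : map _ _ = [seq (x.2, x.1) | x <- [seq e.1 | e <- gF]]).
    by rewrite map_inj_uniq // => -[? ?] [? ?] [-> ->].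
  by rewrite -map_comp.
apply/hasPn => x /mapP[e /mapP[f fF ->] ->] /=.
apply/negP => /mapP[g gF']; case: g gF' => -[u v] w gF' /= [E1 E2].
by move: (lt _ gF') (lt _ fF) => /=; rewrite -E1 -E2; lia.
Qed.

Lemma gX2 : (2 * gX = k * gY + 2 * (k * gOm))%N.
Proof. rewrite /gX /gY; nia. Qed.

Lemma gOm_gt0 : (0 < gOm)%N.
Proof. by rewrite /gOm /gA muln_gt0 expn_gt0 n_gt0. Qed.

(* All size comparisons below follow linearly from these, with [n * gS] and the
   multiples of [gY] and [gOm] as atoms. *)
Lemma g_facts : ((gS = 3 * (k * gOm) /\ gP = 2 * (n * gS) /\ gY = 20 * (n * gS)) /\
  (gS <= n * gS /\ gOm <= k * gOm /\ gY <= k * gY))%N.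
Proof. by split; [rewrite /gP /gY /gS !mulnA | rewrite !leq_pmull]. Qed.

(** The truncated subtractions in [gQ] are exact. *)
Lemma gPQ : (gP + gQ + k * gOm = k * gY)%N.
Proof. by have := g_facts; rewrite /gQ; lia. Qed.

Lemma acost_le i e : (i < k)%N -> (e < m)%N -> `|acost i e| <= gOm%:Z.
Proof.
move=> ik em; rewrite /acost /gOm.
have : (tl e * n ^ i < gA)%N.
  apply: (@leq_trans (n ^ i.+1)); last by rewrite leq_pexp2l.
  by rewrite expnS ltn_pmul2r ?expn_gt0 ?n_gt0 // tl_lt.
have := wt_le em; nia.
Qed.

Definition closed_walk (es : nat -> nat) : Prop :=
  forall i, (i < k)%N ->
    [/\ (es i < m)%N, arc i (es i) & hd (es i) = tl (es (i.+1 %% k)%N)].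

Definition walk_cost (es : nat -> nat) : int := \sum_(i < k) acost i (es i).

Lemma layer_le i : (i < k)%N ->
  (i * gY + gY <= k * gY /\ i * gOm + gOm <= k * gOm)%N.
Proof. by move=> ik; rewrite -!mulSnr !leq_mul2r ik !orbT. Qed.

Lemma vertex_le v : (v < n)%N -> (v * gS + gS <= n * gS)%N.
Proof. by move=> vn; rewrite -mulSnr leq_mul2r vn orbT. Qed.

(** * Lower bounds on distances from potentials *)

Section Potential.
Variables (psi : nat -> nat -> int) (h1 h2 hx hy : int).

Definition pot (z : nat) : int :=
  if (z < k.+1 * n)%N then psi (z %/ n)%N (z %% n)%N
  else if z == (k.+1 * n)%N then h1 else if z == (k.+1 * n + 1)%N then h2
  else if z == (k.+1 * n + 2)%N then hx else hy.

Lemma pot_layer i v : (i <= k)%N -> (v < n)%N -> pot (i * n + v) = psi i v.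
Proof.
move=> ik vn; rewrite /pot (_ : _ < _)%N; last by nia.
by rewrite divnMDl // modnMDl divn_small // modn_small // addn0.
Qed.

Lemma pot_h1 : pot (k.+1 * n) = h1. Proof. by rewrite /pot ltnn eqxx. Qed.
Lemma pot_h2 : pot (k.+1 * n + 1) = h2.
Proof. by rewrite /pot; repeat case: ifP => ?; lia. Qed.
Lemma pot_x : pot (k.+1 * n + 2) = hx.
Proof. by rewrite /pot; repeat case: ifP => ?; lia. Qed.
Lemma pot_y : pot (k.+1 * n + 3) = hy.
Proof. by rewrite /pot; repeat case: ifP => ?; lia. Qed.

Hypothesis lip_layer : forall e i, (e < m)%N -> (i < k)%N ->
  `|psi i (tl e) - psi i.+1 (hd e)|
    <= (if arc i e then gY%:Z + acost i e else (2 * gX)%N%:Z).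
Hypothesis lip_hub : forall v, (v < n)%N ->
  [/\ `|psi 0 v - h1| <= gX%:Z + (v * gS)%N%:Z,
      `|psi 0 v - h2| <= gX%:Z - (v * gS)%N%:Z,
      `|psi k v - h1| <= gX%:Z - (v * gS)%N%:Z
    & `|psi k v - h2| <= gX%:Z + (v * gS)%N%:Z].
Hypothesis lip_spoke : forall v i, (v < n)%N -> (i < k)%N ->
  `|psi i v - hx| <= (if i == 0%N then gP%:Z else gQ%:Z).
Hypothesis lip_last : `|hx - hy| <= gQ%:Z.

Lemma pot_lip j T H W : gedge_spec j T H W -> `|pot T - pot H| <= W.
Proof.
case=> [e i em ik|v c vn c4|v i vn ik|].
- by rewrite !pot_layer ?tl_lt ?hd_lt ?(ltnW ik) //; exact: lip_layer.
- have [a1 a2 a3 a4] := lip_hub vn.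
  have p0 : pot v = psi 0 v by rewrite -(pot_layer (i := 0)) // mul0n.
  have pk : pot (k * n + v) = psi k v by rewrite pot_layer.
  case: c c4 => [|[|[|[|//]]]] _ /=; rewrite ?addn0 ?p0 ?pk ?pot_h1 ?pot_h2 //.
- by rewrite pot_x pot_layer ?(ltnW ik) //; exact: lip_spoke.
- by rewrite pot_x pot_y.
Qed.

Lemma pot_path (u v : 'I_gN) p : simple_path (undir gF) u v p ->
  `|pot u - pot v| <= path_weight (undir gF) u p.
Proof.
case/and3P => up /eqP <- _.
(* Using the potential and its negative gives the absolute value without reversing the path. *)
have H (b : bool) := @path_weight_ge _ gF (fun z => (-1) ^+ b * pot z) u p gF_simple.
have lip (b : bool) e : e \in gF ->
    `|(-1) ^+ b * pot e.1.1 - (-1) ^+ b * pot e.1.2| <= e.2.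
  case/mapP => j; rewrite mem_iota => /= jM ->.
  have [-> ->] := gedge_inordK jM.
  by rewrite -mulrBr normrM normrX normrN1 expr1n mul1r; exact: pot_lip (gedgeP jM).
have := H true (lip true) up; have := H false (lip false) up.
by rewrite expr0 expr1 !mulN1r !mul1r; lia.
Qed.

End Potential.

(** Excludes centres in the layers above 0 and at the hubs. Only layer 0 has cheap edges to [x]; a
    node of another layer pays [gQ] twice to reach the pendant, or must first get to layer 0. *)
Lemma far_from_pendant (u v : 'I_gN) p :
  (n <= u)%N -> (u < k.+1 * n + 2)%N -> v = (k.+1 * n + 3)%N :> nat ->
  simple_path (undir gF) u v p -> (2 * gX)%N%:Z <= path_weight (undir gF) u p.
Proof.
move=> nu ux vy sp.
have F1 := g_facts; have F2 := gPQ; have F3 := gX2.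
pose psi (i v : nat) : int := if i == 0%N then (gP + gQ)%N%:Z else (2 * gX)%N%:Z.
have := @pot_path psi (2 * gX)%N%:Z (2 * gX)%N%:Z gQ%:Z 0.
move=> /(_ _ _ _ _ u v p sp); rewrite vy pot_y.
have -> : pot psi (2 * gX)%N%:Z (2 * gX)%N%:Z gQ%:Z 0 u = (2 * gX)%N%:Z.
  rewrite /pot /psi; case: ifP => uk; last by repeat case: ifP => ?; lia.
  by rewrite ifF //; apply/negbTE; rewrite -lt0n divn_gt0.
rewrite subr0 => H; apply: le_trans (H _ _ _ _); rewrite /psi; first by lia.
- move=> e i em ik; have := acost_le ik em.
  by rewrite (_ : (i.+1 == 0)%N = false) //; case: (eqVneq i 0%N) => _; case: ifP => _; lia.
- move=> w wn; have := vertex_le wn; rewrite /= (_ : (k == 0)%N = false); last by lia.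
  by move=> ?; split; lia.
- by move=> w i wn ik; case: eqP; lia.
- by lia.
Qed.

(** Excludes [x] and its pendant as centres; the copy of vertex 0 serves as the witness in layer
    [k]. The potential rises by the least possible arc weight [gY - gOm] from layer to layer, and
    [gP] pays for the larger jump into layer [k]. *)
Lemma far_from_centre (u v : 'I_gN) p :
  (k.+1 * n + 2 <= u)%N -> v = (k * n)%N :> nat ->
  simple_path (undir gF) u v p -> (2 * gX)%N%:Z <= path_weight (undir gF) u p.
Proof.
move=> ux vy sp.
have F1 := g_facts; have F2 := gPQ; have F3 := gX2.
pose psi (i v : nat) : int := if i == k then (2 * gX)%N%:Z
  else gP%:Z + (i * gY)%N%:Z - (i * gOm)%N%:Z.
pose h : int := (gX + n * gS)%N%:Z.
have := @pot_path psi h h 0 0.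
move=> /(_ _ _ _ _ u v p sp).
have -> : pot psi h h 0 0 u = 0 by rewrite /pot; repeat case: ifP => ?; lia.
have -> : pot psi h h 0 0 v = (2 * gX)%N%:Z.
  by rewrite vy -(addn0 (k * n)%N) pot_layer // /psi eqxx.
rewrite sub0r normrN => H; apply: le_trans (H _ _ _ _); rewrite /psi /h; first by lia.
- move=> e i em ik /=; have := acost_le ik em; have := layer_le ik.
  rewrite (_ : (i == k) = false); last by lia.
  case: (eqVneq i.+1 k) => ki.
    have : (k * gY = i * gY + gY /\ k * gOm = i * gOm + gOm)%N by rewrite -ki !mulSnr.
    by case: ifP => _; lia.
  have [] := @layer_le i.+1; first by lia.
  by rewrite !mulSnr; case: ifP => _; lia.
- move=> w wn; have := vertex_le wn; rewrite eqxx (_ : (0 == k)%N = false); last by lia.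
  by move=> ?; split; lia.
- move=> w i wn ik; have := layer_le ik; rewrite (_ : (i == k) = false); last by lia.
  by case: (eqVneq i 0%N) => [->|_]; lia.
- by lia.
Qed.

Section FromCopy.
Variable a : nat.
Hypothesis an : (a < n)%N.

(** Grows by [gY - gOm] per layer, which is at most the weight of any arc, and reaches [2 * gX] at
    layer [k]. In layer 0 it is [gS], below [2 * gP]. *)
Definition cap (i : nat) : int :=
  (i * gY)%N%:Z + (3 * (k * gOm))%N%:Z - (i * gOm)%N%:Z.

(** The Bellman recursion for forward walks from the copy of [a], truncated at [cap] to stay
    Lipschitz where no cheap walk arrives. The start value [2 * gP] is the length of the detour over
    [x] to another vertex of layer 0. *)
Fixpoint phi (i v : nat) : int :=
  if i is i'.+1 then
    \big[Order.min/cap i]_(e <- iota 0 m | arc i' e && (hd e == v))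
      (phi i' (tl e) + gY%:Z + acost i' e)
  else if v == a then 0 else (2 * gP)%N%:Z.

Lemma phiS i v : phi i.+1 v =
  \big[Order.min/cap i.+1]_(e <- iota 0 m | arc i e && (hd e == v))
      (phi i (tl e) + gY%:Z + acost i e).
Proof. by []. Qed.

Lemma phi_bounds i v : (i <= k)%N ->
  (i * gY)%N%:Z - (i * gOm)%N%:Z <= phi i v <= cap i + (if i == 0%N then 2 * gP else 0)%N%:Z.
Proof.
have F1 := g_facts.
elim: i v => [|i IH] v ik; first by rewrite /= /cap; case: eqP; lia.
rewrite phiS addr0; apply/andP; split; last exact: bigmin_le_id.
rewrite big_seq_cond; apply: le_bigmin => [|e /and3P[]]; first by rewrite /cap; lia.
rewrite mem_iota => /= em _ _; have := acost_le ik em.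
by have /andP[+ _] := IH (tl e) (ltnW ik); rewrite !mulSn; lia.
Qed.

Lemma phi_step i e : (e < m)%N -> arc i e ->
  phi i.+1 (hd e) <= phi i (tl e) + gY%:Z + acost i e.
Proof.
move=> em ae; rewrite phiS; apply: (@ge_bigmin_seq _ _ _ _ _ e); first by rewrite mem_iota.
by rewrite ae eqxx.
Qed.

(** A value below the cap is not the default of the minimum, so an arc attains it. By the slow
    growth of [cap], the value at the tail is below its own cap too; this continues down to layer 0,
    where only [a] qualifies. *)
Lemma phi_walk i v : (i <= k)%N -> phi i v < cap i ->
  exists es x : nat -> nat, [/\ x 0%N = a, x i = v,
    forall j, (j < i)%N ->
      [/\ (es j < m)%N, arc j (es j), tl (es j) = x j & hd (es j) = x j.+1]
  & phi i v = (i * gY)%N%:Z + \sum_(j < i) acost j (es j)].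
Proof.
have F1 := g_facts.
elim: i v => [|i IH] v ik.
  move=> lt; exists id, (fun=> a).
  have va : v = a by move: lt; rewrite /= /cap; case: eqP => // _; lia.
  by split => //; rewrite big_ord0 /= va eqxx.
rewrite phiS => lt; have [e [+ /andP[ae /eqP hev] E]] := bigmin_attained lt.
rewrite -phiS in E lt *; rewrite mem_iota add0n => /andP[_ em].
have [|es [x [x0 xi ok sE]]] := IH (tl e) (ltnW ik).
  have cS : cap i.+1 = cap i + gY%:Z - gOm%:Z by rewrite /cap !mulSnr; lia.
  have cb := acost_le ik em; rewrite E in lt.
  by move: lt; lia.
exists (fun j => if j == i then e else es j), (fun j => if j == i.+1 then v else x j).
split => //.
- by rewrite eqxx.
- move=> j; rewrite ltnS leq_eqVlt => /predU1P[->|ji].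
    by rewrite !eqxx (_ : (i == i.+1) = false); [split | lia].
  have [-> ->] : (j == i) = false /\ (j.+1 == i.+1) = false by lia.
  by rewrite (_ : (j == i.+1) = false); [exact: ok | lia].
- rewrite E sE big_ord_recr /= eqxx mulSnr.
  have -> : \sum_(j < i) acost j (if j == i :> nat then e else es j) = \sum_(j < i) acost j (es j).
    by apply: eq_bigr => j _; rewrite (_ : (j == i :> nat) = false) //; have := ltn_ord j; lia.
  by rewrite PoszD -!addrA; congr (_ + _); exact: addrCA.
Qed.

(** The second term in layer [k] is the length of the better of the two hub routes; it equals
    [2 * gX] only at [a]. *)
Definition psiA (i v : nat) : int :=
  if i == k then Order.min (phi k v) ((2 * gX)%N%:Z - `|a%:Z - v%:Z| * gS%:Z)
  else phi i v.

Lemma far_from_copy (u v : 'I_gN) p :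
  u = a :> nat -> v = (k * n + a)%N :> nat ->
  simple_path (undir gF) u v p ->
  Order.min (phi k a) (2 * gX)%N%:Z <= path_weight (undir gF) u p.
Proof.
move=> ua vy sp.
have F1 := g_facts; have F2 := gPQ; have F3 := gX2; have Fa := vertex_le an.
have OY i : (i * gOm <= i * gY)%N by rewrite leq_mul2l; apply/orP; right; lia.
pose h1 : int := gX%:Z + (a * gS)%N%:Z; pose h2 : int := gX%:Z - (a * gS)%N%:Z.
have := @pot_path psiA h1 h2 gP%:Z gP%:Z.
move=> /(_ _ _ _ _ u v p sp).
have p0 w : psiA 0 w = if w == a then 0 else (2 * gP)%N%:Z.
  by rewrite /psiA (_ : (0 == k)%N = false) //; lia.
have p0b w : 0 <= psiA 0 w <= (2 * gP)%N%:Z by rewrite p0; case: eqP; lia.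
have pm i w : (i < k)%N -> psiA i w = phi i w.
  by move=> ik; rewrite /psiA (_ : (i == k) = false) //; lia.
have pk w : psiA k w =
    Order.min (phi k w) ((2 * gX)%N%:Z - `|a%:Z - w%:Z| * gS%:Z).
  by rewrite /psiA eqxx.
have dist_le w : (w < n)%N -> 0 <= `|a%:Z - w%:Z| * gS%:Z <= (n * gS)%N%:Z by nia.
have pkb w : (w < n)%N ->
    (2 * gX)%N%:Z - (n * gS)%N%:Z <= psiA k w <= (2 * gX)%N%:Z.
  move=> wn; have := dist_le _ wn; have := phi_bounds w (leqnn k).
  by rewrite pk /cap; case: leP; lia.
have -> : pot psiA h1 h2 gP%:Z gP%:Z u = 0.
  by rewrite ua -[a]add0n -(mul0n n) pot_layer // p0 eqxx.
have -> : pot psiA h1 h2 gP%:Z gP%:Z v = Order.min (phi k a) (2 * gX)%N%:Z.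
  by rewrite vy pot_layer // pk subrr normr0 mul0r subr0.
rewrite sub0r normrN => H; apply: le_trans (H _ _ _ _) => {H}; first by lia.
- move=> e i em ik; have cb := acost_le ik em; have li := layer_le ik.
  have tn := tl_lt em; have hn := hd_lt em; have b0 := OY i.
  have /andP[b1 b2] := phi_bounds (tl e) (ltnW ik).
  have b2' : phi i (tl e) <= (i * gY)%N%:Z + (3 * (k * gOm))%N%:Z + (2 * gP)%N%:Z.
    by move: b2; rewrite /cap; case: eqP; lia.
  rewrite pm //.
  case: (eqVneq i.+1 k) => ki.
    have kY : (k * gY = i * gY + gY /\ k * gOm = i * gOm + gOm)%N by rewrite -ki !mulSnr.
    rewrite ki; have := pkb _ hn; case: ifP => ae; last by lia.
    have : psiA k (hd e) <= phi k (hd e) by rewrite pk ge_min lexx.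
    by have := phi_step em ae; rewrite ki; lia.
  have ik1 : (i.+1 < k)%N by lia.
  have [] := layer_le ik1; rewrite !mulSnr pm // => li1 li2.
  have /andP[c1 c2] := phi_bounds (hd e) ik.
  rewrite addr0 /cap !mulSnr in c1 c2.
  by case: ifP => ae; [have := phi_step em ae |]; lia.
- move=> w wn; have := vertex_le wn; have := pkb _ wn => b1 b2.
  have : psiA k w <= (2 * gX)%N%:Z - `|a%:Z - w%:Z| * gS%:Z.
    by rewrite pk ge_min lexx orbT.
  rewrite p0 /h1 /h2 => b3.
  (* The two linear bounds hidden in the absolute value, one for each hub. *)
  have b4 : psiA k w <= (2 * gX)%N%:Z + (a * gS)%N%:Z - (w * gS)%N%:Z by nia.
  have b5 : psiA k w <= (2 * gX)%N%:Z - (a * gS)%N%:Z + (w * gS)%N%:Z by nia.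
  by case: (eqVneq w a) => [wa|_]; [subst w |]; split; lia.
- move=> w i wn ik; have li := layer_le ik; have b0 := OY i; rewrite pm //.
  have := phi_bounds w (ltnW ik); rewrite /cap.
  case: (eqVneq i 0%N) => [->|i0] /=; first by case: eqP; lia.
  by lia.
- by lia.
Qed.

End FromCopy.

(** Since [cap k] is [2 * gX], a shorter path puts [phi] at the last copy of [a] below its cap,
    where it unfolds into a walk from [a] back to [a]. *)
Lemma short_walk a (u v : 'I_gN) (p : seq 'I_gN) : (a < n)%N ->
  u = a :> nat -> v = (k * n + a)%N :> nat ->
  simple_path (undir gF) u v p ->
  path_weight (undir gF) u p < (2 * gX)%N%:Z ->
  exists2 es, closed_walk es
    & (k * gY)%N%:Z + walk_cost es <= path_weight (undir gF) u p.
Proof.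
move=> an ua va sp lt.
have := far_from_copy an ua va sp => le.
have phi_le : phi a k a <= path_weight (undir gF) u p.
  by move: le; rewrite ge_min => /orP[//|]; lia.
have [|es [x [x0 xk ok E]]] := phi_walk an (leqnn k) (v := a).
  by have := gX2; rewrite /cap; lia.
exists es; last by rewrite /walk_cost -E.
move=> i ik; have [-> -> _ ->] := ok _ ik; split => //.
case: (eqVneq i.+1 k) => [ki|ki].
  by rewrite ki modnn xk; have [_ _ -> _] := ok _ k_gt0.
have ik1 : (i.+1 < k)%N by lia.
by rewrite modn_small //; have [_ _ -> _] := ok _ ik1.
Qed.

(** * Upper bounds on distances from explicit paths *)

Definition nd (z : nat) : 'I_gN := inord z.

Lemma nd_val (z : 'I_gN) : nd z = z. Proof. exact: inord_val. Qed.
Lemma ndK z : (z < gN)%N -> nd z = z :> nat. Proof. by move=> ?; rewrite inordK. Qed.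

Definition lnk (a b : nat) (W : int) : Prop :=
  exists j, gedge_spec j a b W \/ gedge_spec j b a W.

Lemma lnk_sym a b W : lnk a b W -> lnk b a W.
Proof. by case=> j [?|?]; exists j; [right | left]. Qed.

Lemma lnkP a b W : lnk a b W ->
  [/\ a <> b, (a < gN)%N, (b < gN)%N, adj (undir gF) (nd a) (nd b)
    & arc_weight (undir gF) (nd a) (nd b) = W].
Proof.
have /andP[uF _] := gF_simple.
case=> j sj; have jE : [/\ (j < gM)%N, gW j = W & (gT j = a /\ gH j = b) \/ (gT j = b /\ gH j = a)].
  by case: sj => /gedge_spec_eq[-> -> -> ->]; split => //; [left | right].
have [abN abne] : ((a < gN) && (b < gN))%N /\ a <> b.
  by case: sj => /gedge_lt; lia.
case/andP: abN => aN bN.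
have mem : (nd a, nd b, W) \in undir gF.
  have [jM <- ab] := jE; have eF : gedge j \in gF by apply: map_f; rewrite mem_iota.
  rewrite mem_cat; case: ab => -[<- <-]; first by rewrite eF.
  by apply/orP; right; apply/mapP; exists (gedge j).
split => //; first by apply/mapP; exists (nd a, nd b, W).
exact: (arc_weight_simple uF mem).
Qed.

Lemma path1 a b W r : lnk a b W -> W <= r ->
  exists2 p, simple_path (undir gF) (nd a) (nd b) p
    & path_weight (undir gF) (nd a) p <= r.
Proof.
move=> /lnkP[ab aN bN ad w] Wr; exists [:: nd b]; last by rewrite /= addr0 w.
rewrite /simple_path /= ad eqxx inE -val_eqE /= andbT.
by apply/eqP; rewrite !ndK.
Qed.

Lemma path2 a b c W W' r : lnk a b W -> lnk b c W' -> a <> c -> W + W' <= r ->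
  exists2 p, simple_path (undir gF) (nd a) (nd c) p
    & path_weight (undir gF) (nd a) p <= r.
Proof.
move=> /lnkP[ab aN bN ad w] /lnkP[bc _ cN ad' w'] ac Wr.
exists [:: nd b; nd c]; last by rewrite /= addr0 w w'.
rewrite /simple_path /= ad ad' eqxx !inE -!val_eqE /= andbT.
have := ndK aN; have := ndK bN; have := ndK cN; lia.
Qed.

Lemma lnk_hub1 v : (v < n)%N -> lnk v (k.+1 * n) (gX%:Z + (v * gS)%N%:Z).
Proof.
by move=> vn; have := GHub vn (isT : (0 < 4)%N); rewrite mod0n (addn0 (_ * n)%N) => s; eexists; left; exact: s.
Qed.
Lemma lnk_hub2 v : (v < n)%N -> lnk v (k.+1 * n + 1) (gX%:Z - (v * gS)%N%:Z).
Proof. by move=> vn; eexists; left; exact: GHub vn (isT : (1 < 4)%N). Qed.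
Lemma lnk_top1 v : (v < n)%N -> lnk (k.+1 * n) (k * n + v) (gX%:Z - (v * gS)%N%:Z).
Proof.
by move=> vn; have := GHub vn (isT : (2 < 4)%N); rewrite modnn (addn0 (_ * n)%N) => s; eexists; right; exact: s.
Qed.
Lemma lnk_top2 v : (v < n)%N -> lnk (k.+1 * n + 1) (k * n + v) (gX%:Z + (v * gS)%N%:Z).
Proof. by move=> vn; eexists; right; exact: GHub vn (isT : (3 < 4)%N). Qed.
Lemma lnk_centre v : (v < n)%N -> lnk v (k.+1 * n + 2) gP%:Z.
Proof. by move=> vn; eexists; left; exact: GSpoke vn k_gt0. Qed.
Lemma lnk_spoke i v : (v < n)%N -> (0 < i < k)%N ->
  lnk (k.+1 * n + 2) (i * n + v) gQ%:Z.
Proof.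
case: i => // i vn /andP[_ ik]; eexists; right; exact: GSpoke vn ik.
Qed.
Lemma lnk_pendant : lnk (k.+1 * n + 2) (k.+1 * n + 3) gQ%:Z.
Proof. by eexists; left; exact: GLast. Qed.

(** The bound is the least conceivable value of a closed walk. Two edges always suffice: [x] serves
    layer 0, the middle layers and the pendant, and for layer [k] one of the hubs gives
    [2 * gX - |a - v| * gS]. *)
Lemma copy_near a (z : 'I_gN) : (a < n)%N -> z <> (k * n + a)%N :> nat ->
  exists2 p, simple_path (undir gF) (nd a) z p
    & path_weight (undir gF) (nd a) p <= (k * gY)%N%:Z - (k * gOm)%N%:Z.
Proof.
move=> an; rewrite -{2}(nd_val z).
have F1 := g_facts; have F2 := gPQ; have F3 := gX2; have Fa := vertex_le an.
have zN : (z < gN)%N := ltn_ord z; move: (nat_of_ord z) zN => {}z zN ne.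
case: (ltnP z (k.+1 * n)) => zk; last first.
  have : (z = k.+1 * n \/ z = k.+1 * n + 1 \/ z = k.+1 * n + 2 \/ z = k.+1 * n + 3)%N.
    by move: zN zk; rewrite /gN; lia.
  case=> [->|[->|[->|->]]].
  - by apply: path1 (lnk_hub1 an) _; lia.
  - by apply: path1 (lnk_hub2 an) _; lia.
  - by apply: path1 (lnk_centre an) _; lia.
  - by apply: path2 (lnk_centre an) lnk_pendant _ _; nia.
have zE := divn_eq z n; have vn := ltn_pmod z n_gt0.
have ik : (z %/ n <= k)%N by rewrite -ltnS ltn_divLR.
move: (z %/ n)%N (z %% n)%N zE vn ik => i v zE vn ik; rewrite zE in ne *.
have Fv := vertex_le vn.
case: (posnP i) => i0.
  rewrite i0 mul0n add0n; case: (eqVneq v a) => [->|/eqP va].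
    by exists [::]; rewrite /simple_path /= ?eqxx //; lia.
  by apply: path2 (lnk_centre an) (lnk_sym (lnk_centre vn)) _ _; lia.
case: (eqVneq i k) => ki; last first.
  apply: path2 (lnk_centre an) (lnk_spoke vn _) _ _; first by lia.
    by nia.
  by lia.
rewrite {}ki in ne *; have av : v <> a by lia.
case: (ltnP a v) => lt.
  have SS : (a * gS + gS <= v * gS)%N by rewrite -mulSnr leq_mul2r lt orbT.
  by apply: path2 (lnk_hub1 an) (lnk_top1 vn) _ _; [nia | lia].
have lt' : (v < a)%N by lia.
have SS : (v * gS + gS <= a * gS)%N by rewrite -mulSnr leq_mul2r lt' orbT.
by apply: path2 (lnk_hub2 an) (lnk_top2 vn) _ _; [nia | lia].
Qed.

Lemma copy_top a : (a < n)%N ->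
  exists2 p, simple_path (undir gF) (nd a) (nd (k * n + a)) p
    & path_weight (undir gF) (nd a) p <= (2 * gX)%N%:Z.
Proof. by move=> an; apply: path2 (lnk_hub1 an) (lnk_top1 an) _ _; [nia | lia]. Qed.

Lemma walk_path es : closed_walk es ->
  exists2 p, simple_path (undir gF) (nd (tl (es 0%N))) (nd (k * n + tl (es 0%N))) p
    & path_weight (undir gF) (nd (tl (es 0%N))) p = (k * gY)%N%:Z + walk_cost es.
Proof.
move=> W; pose x i := tl (es (i %% k)%N); pose g i := nd (i * n + x i)%N.
have xn i : (x i < n)%N by apply: tl_lt; have [] := W _ (ltn_pmod i k_gt0).
have gv i : (i <= k)%N -> g i = (i * n + x i)%N :> nat.
  by move=> ik; rewrite ndK // /gN; have := xn i; nia.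
have g0 : g 0%N = nd (tl (es 0%N)) by rewrite /g /x mod0n mul0n.
have gk : g k = nd (k * n + tl (es 0%N)) by rewrite /g /x modnn.
have step i : (i < k)%N -> lnk (i * n + x i) (i.+1 * n + x i.+1) (gY%:Z + acost i (es i)).
  move=> ik; have [em ae hE] := W _ ik.
  have := GLayer em ik; rewrite ae hE => s.
  by eexists; left; rewrite /x (modn_small ik); exact: s.
have P i : (i <= k)%N -> let p := [seq g j.+1 | j <- iota 0 i] in
    [/\ path (adj (undir gF)) (g 0%N) p, last (g 0%N) p = g i
      & path_weight (undir gF) (g 0%N) p = (i * gY)%N%:Z + \sum_(j < i) acost j (es j)].
  elim: i => [|i IH] ik; first by rewrite big_ord0.
  have [p1 p2 p3] := IH (ltnW ik); have [_ _ _ ad aw] := lnkP (step _ ik).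
  rewrite -[in iota _ _]addn1 iotaD add0n cats1 map_rcons; split.
  - by rewrite rcons_path p1 p2.
  - by rewrite last_rcons.
  - rewrite path_weight_rcons p2 p3 aw big_ord_recr /= mulSnr PoszD -!addrA.
    by congr (_ + _); rewrite addrCA.
have [p1 p2 p3] := P _ (leqnn k).
exists [seq g j.+1 | j <- iota 0 k]; last by rewrite -g0 p3.
rewrite -g0 -gk; apply/and3P; split => //; first by rewrite p2.
have -> : g 0%N :: [seq g j.+1 | j <- iota 0 k] = [seq g j | j <- iota 0 k.+1].
  by rewrite /= (iotaDl 1 0 k) -map_comp.
rewrite map_inj_in_uniq ?iota_uniq // => i j; rewrite !mem_iota !add0n !ltnS => /= ik jk.
by move=> /(congr1 (@nat_of_ord _)); rewrite !gv // => /radix_inj[].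
Qed.

Lemma gW_bounds j : (j < gM)%N -> 0 <= gW j <= (2 * gX)%N%:Z.
Proof.
have F1 := g_facts; have F2 := gPQ; have F3 := gX2.
move=> jM; case: (gedgeP jM) => [e i em ik|v c vn c4|v i vn ik|]; last by lia.
- by have := acost_le ik em; case: ifP; lia.
- by have := vertex_le vn; case: ifP; lia.
- by case: ifP; lia.
Qed.

Lemma gF_weights : weights_in gF 0 (2 * gX)%N%:Z.
Proof.
apply/allP => e /mapP[j]; rewrite mem_iota => /= jM ->; exact: gW_bounds.
Qed.

Lemma walk_cost_le es : closed_walk es -> `|walk_cost es| <= (k * gOm)%N%:Z.
Proof.
move=> W; apply: le_trans (ler_norm_sum _ _ _) _.
have -> : (k * gOm)%N%:Z = \sum_(i < k) gOm%:Z.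
  by rewrite sumr_const card_ord -mulr_natr natz PoszM mulrC.
by apply: ler_sum => i _; have [em _ _] := W _ (ltn_ord i); exact: acost_le.
Qed.

(** For the upper bound by a walk, its first vertex is taken as centre. Conversely, a centre of
    eccentricity below [2 * gX] must lie in layer 0, and its path to its own copy in layer [k]
    yields the walk. *)
Lemma gadget_radius : exists r : int,
  [/\ radius gF = r%:E%E, 0 <= r <= (2 * gX)%N%:Z,
      forall es, closed_walk es -> r <= (k * gY)%N%:Z + walk_cost es
    & r < (2 * gX)%N%:Z -> exists2 es, closed_walk es
        & (k * gY)%N%:Z + walk_cost es <= r].
Proof.
have F1 := g_facts; have F3 := gX2.
have le2X : (radius gF <= ((2 * gX)%N%:Z)%:E)%O.
  apply/radius_leP; exists (nd 0) => z.
  case: (eqVneq (z : nat) (k * n + 0)%N) => [zE|/eqP ne].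
    by rewrite -(nd_val z) zE; exact: copy_top.
  have [p sp wp] := copy_near n_gt0 ne; exists p => //; lia.
have ge0 (u v : 'I_gN) p : simple_path (undir gF) u v p ->
    0 <= path_weight (undir gF) u p.
  case/and3P => up _ _; have /= := @path_weight_ge _ gF (fun=> 0) u p gF_simple.
  rewrite subrr => H; apply: H up => e /mapP[j]; rewrite mem_iota => /= jM ->.
  by rewrite ?subrr normr0; case/andP: (gW_bounds jM).
case E : (radius gF) le2X => [r| |] //; last first.
  move=> _; have /radius_leP[u /(_ u)[p /ge0]] : (radius gF <= (-1)%:E)%O by rewrite E leNye.
  by lia.
move=> r2X; exists r.
have /radius_leP[u Hu] : (radius gF <= r%:E)%O by rewrite E.
split => //.
- by have [p /ge0] := Hu u; move: r2X; rewrite lee_fin; lia.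
- move=> es W; rewrite -lee_fin -E; apply/radius_leP.
  have an : (tl (es 0%N) < n)%N by apply: tl_lt; have [] := W _ k_gt0.
  have cb : (k * gY)%N%:Z - (k * gOm)%N%:Z <= (k * gY)%N%:Z + walk_cost es.
    by have := walk_cost_le W; lia.
  exists (nd (tl (es 0%N))) => z.
  case: (eqVneq (z : nat) (k * n + tl (es 0%N))%N) => [zE|/eqP ne].
    by rewrite -(nd_val z) zE; have [p sp wE] := walk_path W; exists p; rewrite ?wE.
  have [p sp wp] := copy_near an ne; exists p => //; exact: le_trans cb.
- move=> rlt.
  have un : (u < n)%N.
    rewrite ltnNge; apply/negP => nu.
    case: (ltnP u (k.+1 * n + 2)) => ux.
      have yN : (k.+1 * n + 3 < gN)%N by rewrite /gN.
      have [p sp wp] := Hu (nd (k.+1 * n + 3)).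
      by have := far_from_pendant nu ux (ndK yN) sp; lia.
    have yN : (k * n < gN)%N by rewrite /gN; nia.
    have [p sp wp] := Hu (nd (k * n)).
    by have := far_from_centre ux (ndK yN) sp; lia.
  have yN : (k * n + u < gN)%N.
    by move: (nat_of_ord u) un => w wn; rewrite /gN mulSn; lia.
  have [p sp wp] := Hu (nd (k * n + u)).
  have [es W le] := short_walk un erefl (ndK yN) sp (le_lt_trans wp rlt).
  by exists es => //; exact: le_trans wp.
Qed.

End Gadget.

(** * Digits and colourings *)

Definition digit (b d x : nat) : nat := (iter d (divn^~ b) x %% b)%N.

Lemma digit_sum b D (c : nat -> nat) : (0 < b)%N ->
  (forall d, (d < D)%N -> (c d < b)%N) ->
  (\sum_(d < D) c d * b ^ d < b ^ D)%N /\
  forall d, (d < D)%N -> digit b d (\sum_(d < D) c d * b ^ d) = c d.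
Proof.
move=> b0; elim: D c => [|D IH] c cb; first by rewrite big_ord0.
have [lt dg] := IH (fun d => c d.+1) (fun d dD => cb d.+1 dD).
have E : (\sum_(d < D.+1) c d * b ^ d = (\sum_(d < D) c d.+1 * b ^ d) * b + c 0)%N.
  rewrite big_ord_recl expn0 muln1 addnC; congr (_ + _)%N.
  by rewrite big_distrl /=; apply: eq_bigr => d _; rewrite /bump /= add1n expnSr mulnA.
have c0 : (c 0 < b)%N by exact: cb.
rewrite E; split; first by rewrite expnSr; nia.
case=> [|d] dD; first by rewrite /digit /= modnMDl modn_small.
by rewrite /digit iterSr divnMDl // divn_small // addn0; exact: dg.
Qed.

Lemma bit_differs L u v : u <> v -> (u < 2 ^ L)%N -> (v < 2 ^ L)%N ->
  exists2 t, (t < L)%N & odd (u %/ 2 ^ t) != odd (v %/ 2 ^ t).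
Proof.
elim: L u v => [|L IH] u v uv; first by rewrite expn0; lia.
rewrite expnS => ul vl.
case: (eqVneq (odd u) (odd v)) => o; last by exists 0%N; rewrite // expn0 !divn1.
have [||| t tL tE] := IH u./2 v./2; try lia.
by exists t.+1 => //; rewrite expnS !divnMA !divn2.
Qed.

Section Colouring.
Variables k b xi : nat.

(* The digit of [xi] attached to the pair [{i, j}] is [2 t + s]: bit [t] of the
   vertices in layers [i] and [j] must differ, [s] telling which one is set. *)
Definition pair_digit (i j : nat) : nat := digit b (minn i j * k + maxn i j) xi.

Definition pair_bit (i j v : nat) : bool :=
  odd (v %/ 2 ^ (pair_digit i j %/ 2) + pair_digit i j).

(** For [i < j], layer [i] asks for [pair_bit i j] to be 1 and layer [j] for it to be 0, which makes
    the layers disjoint whatever [xi] is. *)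
Definition coloured (i v : nat) : bool :=
  all (fun j => (j == i) || (pair_bit i j v == (i < j)%N)) (iota 0 k).

Lemma coloured_neq i j u v : (i < k)%N -> (j < k)%N -> i <> j ->
  coloured i u -> coloured j v -> u <> v.
Proof.
move=> ik jk ij /allP/(_ j) + /allP/(_ i) + uv; subst v.
rewrite !mem_iota !add0n /= ik jk => /(_ isT) + /(_ isT).
rewrite /pair_bit /pair_digit minnC maxnC.
have [-> ->] : (i == j) = false /\ (j == i) = false by lia.
by move=> /eqP -> /eqP; lia.
Qed.

End Colouring.

Lemma coloured_exists k L (x : nat -> nat) : (0 < L)%N ->
  (forall i, (i < k)%N -> (x i < 2 ^ L)%N) ->
  (forall i j, (i < k)%N -> (j < k)%N -> x i = x j -> i = j) ->
  exists2 xi, (xi < (2 * L) ^ (k * k))%N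
    & forall i, (i < k)%N -> coloured k (2 * L) xi i (x i).
Proof.
move=> L0 xL xinj; set b := (2 * L)%N.
pose h i c := odd (x i %/ 2 ^ (c %/ 2) + c).
pose p i j c := h i c && ~~ h j c.
have P i j : (i < j)%N -> (j < k)%N -> has (p i j) (iota 0 b).
  move=> ij jk; have ik : (i < k)%N by lia.
  have [|t tL te] := @bit_differs L (x i) (x j) _ (xL _ ik) (xL _ jk).
    by move/xinj; lia.
  (* The second summand makes its sum with bit [t] of [x i] odd, and hence the one with bit [t] of
     [x j] even. *)
  apply/hasP; exists (2 * t + ~~ odd (x i %/ 2 ^ t))%N.
    by rewrite mem_iota add0n /b; case: (odd _) => /=; lia.
  have d2 : ((2 * t + ~~ odd (x i %/ 2 ^ t)) %/ 2 = t)%N.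
    by case: (odd _) => /=; lia.
  have oE y (s : bool) : odd (y + (2 * t + s)) = odd y (+) s.
    by rewrite mul2n 2!oddD odd_double oddb.
  rewrite /p /h d2 !oE.
  by move: te; case: (odd (x i %/ _)); case: (odd (x j %/ _)).
(* Only the positions [i * k + j] with [i < j] carry information; the other digits are 0. *)
pose c d := let i := (d %/ k)%N in let j := (d %% k)%N in
  if (i < j)%N then find (p i j) (iota 0 b) else 0%N.
have k0 d : (d < k * k)%N -> (0 < k)%N by lia.
have cb d : (d < k * k)%N -> (c d < b)%N.
  move=> dk; rewrite /c; case: ifP => ij; last by rewrite /b; lia.
  have := P _ _ ij (ltn_pmod d (k0 _ dk)); rewrite has_find size_iota; exact.
have b0 : (0 < b)%N by rewrite /b; lia.
have [lt dg] := digit_sum b0 cb.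
exists (\sum_(d < k * k) c d * b ^ d)%N => // i ik.
have cE i1 j1 : (i1 < j1)%N -> (j1 < k)%N ->
    p i1 j1 (pair_digit k b (\sum_(d < k * k) c d * b ^ d) i1 j1).
  move=> ij jk; rewrite /pair_digit (minn_idPl (ltnW ij)) (maxn_idPr (ltnW ij)).
  rewrite dg; last by nia.
  have kp : (0 < k)%N by lia.
  rewrite /c divnMDl // modnMDl (divn_small jk) (modn_small jk) addn0 ij.
  have H := P _ _ ij jk.
  have := nth_find 0%N H; rewrite nth_iota ?add0n //.
  by rewrite has_find size_iota in H.
apply/allP => j; rewrite mem_iota add0n => /= jk.
case: (ltngtP j i) => // ji.
- have /andP[_] := cE _ _ ji ik.
  by rewrite /pair_bit /h /pair_digit minnC maxnC => /negbTE ->.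
- have /andP[+ _] := cE _ _ ji jk.
  by rewrite /pair_bit /h /pair_digit => ->.
Qed.

(** * Relabelling the non-isolated vertices *)

(** In the order of first occurrence, whereas [undup] keeps the last one: a label, once given, must
    not change when further endpoints are read. *)
Definition seen (l : seq nat) : seq nat :=
  foldl (fun s u => if u \in s then s else rcons s u) [::] l.

Lemma seen_rcons l u :
  seen (rcons l u) = if u \in seen l then seen l else rcons (seen l) u.
Proof. by rewrite /seen foldl_rcons. Qed.

Lemma mem_seen l : seen l =i l.
Proof.
elim/last_ind: l => [|l u IH] x //; rewrite seen_rcons mem_rcons in_cons -IH.
case: ifP => us; last by rewrite mem_rcons in_cons.
by case: eqP => // ->.
Qed.

Lemma seen_uniq l : uniq (seen l).
Proof.
elim/last_ind: l => [|l u IH] //; rewrite seen_rcons; case: ifP => // us.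
by rewrite rcons_uniq us.
Qed.

Lemma index_seen_rcons l u v : v \in l ->
  index v (seen (rcons l u)) = index v (seen l).
Proof.
by move=> vl; rewrite seen_rcons; case: ifP => // _; rewrite -cats1 index_cat mem_seen vl.
Qed.

Lemma size_seen l : (size (seen l) <= size l)%N.
Proof.
elim/last_ind: l => [|l u IH] //; rewrite seen_rcons size_rcons.
by case: ifP => _; rewrite ?size_rcons //; exact: leqW.
Qed.

Lemma cycleP (T : Type) (e : rel T) (c : seq T) (x0 : T) :
  cycle e c <->
  forall i, (i < size c)%N -> e (nth x0 c i) (nth x0 c (i.+1 %% size c)).
Proof.
case: c => [|x p] //=.
have nx i : (i <= size p)%N ->
    nth x0 (x :: p) (i.+1 %% (size p).+1) = nth x0 (rcons p x) i.
  rewrite leq_eqVlt => /predU1P[->|ip]; first by rewrite modnn nth_rcons ltnn eqxx.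
  by rewrite modn_small // nth_rcons ip.
have nl i : (i <= size p)%N -> nth x0 (x :: rcons p x) i = nth x0 (x :: p) i.
  by move=> ip; rewrite -rcons_cons nth_rcons /= ltnS ip.
split=> [/(pathP x0) H i | H].
  by rewrite ltnS => ip; rewrite nx // -nl //; apply: H; rewrite size_rcons ltnS.
apply/(pathP x0) => i; rewrite size_rcons ltnS => ip.
by rewrite nl // -nx //; exact: H.
Qed.

Lemma next_nth_uniq (T : eqType) (c : seq T) (x0 : T) i :
  uniq c -> (i < size c)%N -> next c (nth x0 c i) = nth x0 c (i.+1 %% size c).
Proof.
move=> uc ic; rewrite next_nth mem_nth // index_uniq //.
case: c uc ic => [|y p] //= uc; rewrite ltnS leq_eqVlt => /predU1P[->|ip].
  by rewrite modnn nth_default.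
by rewrite modn_small //=; exact: set_nth_default.
Qed.

Lemma cycle_weight_nth (n : nat) (E : edges n) (c : seq 'I_n) x0 : uniq c ->
  cycle_weight E c =
  \sum_(i < size c) arc_weight E (nth x0 c i) (nth x0 c (i.+1 %% size c)%N).
Proof.
move=> uc; rewrite /cycle_weight (big_nth x0) big_mkord.
by apply: eq_bigr => i _; rewrite next_nth_uniq.
Qed.

Section Relabel.
Variables (n0 : nat) (E : edges n0).

Definition tails : seq nat := [seq nat_of_ord e.1.1 | e <- E].
Definition heads : seq nat := [seq nat_of_ord e.1.2 | e <- E].
Definition ends : seq nat := tails ++ heads.
Definition verts : seq nat := seen ends.
Definition rtl (e : nat) : nat := index (nth 0%N ends e) verts.
Definition rhd (e : nat) : nat := index (nth 0%N ends (size E + e)) verts.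
Definition rwt (e : nat) : int := nth 0 [seq e.2 | e <- E] e.

Lemma size_ends : size ends = (2 * size E)%N.
Proof. by rewrite size_cat !size_map mul2n addnn. Qed.

Lemma nth_tails e : (e < size E)%N -> nth 0%N ends e = nth 0%N tails e.
Proof. by move=> em; rewrite nth_cat size_map em. Qed.

Lemma nth_heads e : nth 0%N ends (size E + e) = nth 0%N heads e.
Proof. by rewrite nth_cat size_map ltnNge leq_addr /= addKn. Qed.

Lemma index_verts j : (j < 2 * size E)%N -> (index (nth 0%N ends j) verts < size verts)%N.
Proof. by move=> jm; rewrite index_mem mem_seen mem_nth // size_ends. Qed.

Lemma rtl_lt e : (e < size E)%N -> (rtl e < size verts)%N.
Proof. by move=> em; apply: index_verts; lia. Qed.

Lemma rhd_lt e : (e < size E)%N -> (rhd e < size verts)%N.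
Proof. by move=> em; apply: index_verts; lia. Qed.

Lemma nth_verts_rtl e : (e < size E)%N -> nth 0%N verts (rtl e) = nth 0%N tails e.
Proof.
move=> em; have mem : nth 0%N ends e \in verts by rewrite mem_seen mem_nth // size_ends; lia.
by rewrite /rtl nth_index // nth_tails.
Qed.

Lemma nth_verts_rhd e : (e < size E)%N -> nth 0%N verts (rhd e) = nth 0%N heads e.
Proof.
move=> em; have mem : nth 0%N ends (size E + e) \in verts.
  by rewrite mem_seen mem_nth // size_ends; lia.
by rewrite /rhd nth_index // nth_heads.
Qed.

Lemma nth_edge (d : 'I_n0 * 'I_n0 * int) e : (e < size E)%N ->
  [/\ nth 0%N tails e = (nth d E e).1.1, nth 0%N heads e = (nth d E e).1.2
    & rwt e = (nth d E e).2].
Proof. by move=> em; split; rewrite /tails /heads /rwt (nth_map d). Qed.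

Hypothesis E_simple : simple_digraph E.

Lemma r_inj e e' : (e < size E)%N -> (e' < size E)%N ->
  rtl e = rtl e' -> rhd e = rhd e' -> e = e'.
Proof.
move=> em em' tt hh.
have [d _] : exists d, d \in E by case: (E) em => // d *; exists d; rewrite mem_head.
have [t1 h1 _] := nth_edge d em; have [t2 h2 _] := nth_edge d em'.
have T : (nth d E e).1.1 = (nth d E e').1.1.
  by apply: val_inj; rewrite /= -t1 -t2 -!nth_verts_rtl // tt.
have H : (nth d E e).1.2 = (nth d E e').1.2.
  by apply: val_inj; rewrite /= -h1 -h2 -!nth_verts_rhd // hh.
case/andP: E_simple => uE _; apply/eqP; rewrite -(nth_uniq d.1 _ _ uE) ?size_map //.
by rewrite !(nth_map d) // [X in X == _]surjective_pairing T H -surjective_pairing.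
Qed.

Lemma verts_lt v : v \in verts -> (v < n0)%N.
Proof. by rewrite mem_seen mem_cat => /orP[] /mapP[e _ ->]. Qed.

Lemma size_verts_le : (size verts <= n0)%N.
Proof.
rewrite -(size_iota 0 n0); apply: uniq_leq_size; first exact: seen_uniq.
by move=> v /verts_lt vn; rewrite mem_iota.
Qed.

Lemma size_verts_le2 : (size verts <= 2 * size E)%N.
Proof. by rewrite -size_ends size_seen. Qed.

Lemma size_verts_gt0 : (0 < size E)%N -> (0 < size verts)%N.
Proof. by move=> em; apply: leq_ltn_trans (leq0n _) (rtl_lt em). Qed.

Lemma arc_weightE e (u v : 'I_n0) : (e < size E)%N ->
  nth 0%N tails e = u :> nat -> nth 0%N heads e = v :> nat ->
  adj E u v /\ arc_weight E u v = rwt e.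
Proof.
move=> em tu hv; case/andP: E_simple => uE _.
have [d _] : exists d, d \in E by case: (E) em => // d *; exists d; rewrite mem_head.
have [t1 h1 ->] := nth_edge d em.
have mE : nth d E e \in E by exact: mem_nth.
have uE1 : (nth d E e).1.1 = u by apply: val_inj; rewrite /= -t1.
have vE1 : (nth d E e).1.2 = v by apply: val_inj; rewrite /= -h1.
split; last by rewrite -(arc_weight_simple uE mE) uE1 vE1.
by apply/mapP; exists (nth d E e); rewrite // -uE1 -vE1 -surjective_pairing.
Qed.

(** * Closed walks in coloured layers and simple cycles *)

Variable k : nat.
Hypothesis k_gt0 : (0 < k)%N.

Definition wsum (es : nat -> nat) : int := \sum_(i < k) rwt (es i).

(** Soundness, for every colouring: the vertices of the walk lie in disjoint layers and are thus
    distinct. *)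
Lemma walk_kcycle b xi es :
  closed_walk k (size E) rtl rhd (coloured k b xi) es ->
  exists c : k.-tuple 'I_n0, [/\ is_kcycle E c, cycle_weight E c = wsum es
    & forall i : 'I_k, tnth c i = nth 0%N verts (rtl (es i)) :> nat].
Proof.
move=> W.
have lt i : (nth 0%N verts (rtl (es (i %% k)%N)) < n0)%N.
  have [em _ _] := W _ (ltn_pmod i k_gt0).
  by apply/verts_lt/mem_nth/rtl_lt.
pose f i : 'I_n0 := Ordinal (lt i).
have fE i : (i < k)%N -> f i = nth 0%N verts (rtl (es i)) :> nat.
  by move=> ik; rewrite /= modn_small.
pose c := [tuple f i | i < k].
have nc i : (i < k)%N -> nth (f 0%N) c i = f i.
  by move=> ik; rewrite -[i]/(nat_of_ord (Ordinal ik)) -tnth_nth tnth_mktuple.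
have step i : (i < k)%N -> adj E (f i) (f (i.+1 %% k)%N) /\
    arc_weight E (f i) (f (i.+1 %% k)%N) = rwt (es i).
  move=> ik; have [em _ hE] := W _ ik; apply: arc_weightE => //.
    by rewrite fE // nth_verts_rtl.
  by rewrite fE ?ltn_pmod // -hE nth_verts_rhd.
have uc : uniq c.
  rewrite map_inj_uniq ?enum_uniq // => i j /(congr1 (@nat_of_ord _)).
  rewrite !fE // => /eqP.
  have [ei ai _] := W _ (ltn_ord i); have [ej aj _] := W _ (ltn_ord j).
  rewrite nth_uniq ?rtl_lt ?seen_uniq // => /eqP tij.
  apply/eqP; apply/negP => /negP ij.
  case/andP: ai => ai _; case/andP: aj => aj _.
  have := coloured_neq (ltn_ord i) (ltn_ord j) _ ai aj; apply => //.
  by move=> /ord_inj/eqP; exact: negP.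
exists c; split.
- apply/andP; split => //; apply/(cycleP _ _ (f 0%N)) => i; rewrite size_tuple => ik.
  by rewrite !nc ?ltn_pmod //; have [] := step _ ik.
- rewrite (cycle_weight_nth E (f 0%N) uc) size_tuple; apply: eq_bigr => i _.
  by rewrite !nc ?ltn_pmod //; have [] := step _ (ltn_ord i).
- by move=> i; rewrite tnth_mktuple fE.
Qed.

(** Completeness: [L] bits tell all labels apart, so some colouring puts the vertices of the given
    cycle into their layers. *)
Lemma kcycle_walk L (c : k.-tuple 'I_n0) : (0 < L)%N -> (size verts < 2 ^ L)%N ->
  is_kcycle E c ->
  exists xi es, [/\ (xi < (2 * L) ^ (k * k))%N,
    closed_walk k (size E) rtl rhd (coloured k (2 * L) xi) es
    & wsum es = cycle_weight E c].
Proof.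
move=> L0 nL /andP[cy uc].
have [x0 _] : exists x0, x0 \in tval c.
  by exists (tnth c (Ordinal k_gt0)); exact: mem_tnth.
have [d _] : exists d, d \in E.
  move/(cycleP _ _ x0): cy => /(_ 0%N); rewrite size_tuple => /(_ k_gt0) /mapP[d dE _].
  by exists d.
pose f i := nth x0 c (i %% k)%N.
pose es i := index (f i, f i.+1) [seq e.1 | e <- E].
have step i : (i < k)%N -> [/\ (es i < size E)%N, nth 0%N tails (es i) = f i,
    nth 0%N heads (es i) = f i.+1 & rwt (es i) = arc_weight E (f i) (f i.+1)].
  move=> ik; move/(cycleP _ _ x0): cy => /(_ i); rewrite size_tuple => /(_ ik) ad.
  have fi : f i = nth x0 c i by rewrite /f modn_small.
  have mem : (f i, f i.+1) \in [seq e.1 | e <- E] by rewrite fi.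
  have em : (es i < size E)%N by rewrite -(size_map fst) index_mem.
  have [t1 h1 w1] := nth_edge d em.
  have eE : (nth d E (es i)).1 = (f i, f i.+1).
    by rewrite -(nth_map d d.1 fst) // nth_index.
  have t2 : nth 0%N tails (es i) = f i by rewrite t1 eE.
  have h2 : nth 0%N heads (es i) = f i.+1 by rewrite h1 eE.
  by have [_ ->] := arc_weightE em t2 h2.
have ff i j : (i < k)%N -> (j < k)%N -> f i = f j -> i = j.
  move=> ik jk; rewrite /f !modn_small // => /eqP.
  by rewrite nth_uniq ?size_tuple // => /eqP.
have [||xi xik colx] := @coloured_exists k L (fun i => rtl (es i)) L0.
- move=> i ik; have [em _ _ _] := step _ ik.
  exact: ltn_trans (rtl_lt em) nL.
- move=> i j ik jk; have [em ti _ _] := step _ ik; have [em' tj _ _] := step _ jk.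
  move/(congr1 (nth 0%N verts)); rewrite !nth_verts_rtl // ti tj.
  by move/ord_inj; exact: ff.
have hdE i : (i < k)%N -> rhd (es i) = rtl (es (i.+1 %% k)%N).
  move=> ik; have [em _ hi _] := step _ ik.
  have [em' ti _ _] := step _ (ltn_pmod i.+1 k_gt0).
  by rewrite /rhd /rtl nth_heads nth_tails // hi ti /f modn_mod.
exists xi, es; split => //.
- move=> i ik; have [em _ _ _] := step _ ik; split => //; last exact: hdE.
  by rewrite /arc colx // hdE // colx // ltn_pmod.
- rewrite (cycle_weight_nth E x0 uc) size_tuple; apply: eq_bigr => i _.
  by have [_ _ _ ->] := step _ (ltn_ord i); rewrite /f modn_small.
Qed.

Let n := size verts.

(* The cost of a walk encodes both its weight and its vertices. *)
Definition wcode (es : nat -> nat) : nat := \sum_(i < k) rtl (es i) * n ^ i.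

Lemma walk_costE es : walk_cost n k rtl rwt es = wsum es * (n ^ k)%N%:Z + (wcode es)%:Z.
Proof.
rewrite /walk_cost /acost big_split /= /wsum /gA mulr_suml; congr (_ + _).
by rewrite /wcode (big_morph Posz PoszD (erefl _)).
Qed.

Lemma wcode_digits es : (0 < n)%N -> (forall i, (i < k)%N -> (es i < size E)%N) ->
  (wcode es < n ^ k)%N /\
  forall i, (i < k)%N -> digit n i (wcode es) = rtl (es i).
Proof. by move=> np H; apply: digit_sum => // d dk; exact/rtl_lt/H. Qed.

End Relabel.

(** * The program *)

Definition same (rs ars : seq nat) (s0 s : state) : Prop :=
  (forall x, x \notin rs -> reg s x = reg s0 x) /\
  (forall a i, a \notin ars -> arr s a i = arr s0 a i).

Lemma same_set_reg rs ars s0 s x v : x \in rs -> same rs ars s0 s ->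
  same rs ars s0 (set_reg s x v).
Proof. by move=> xr [H1 H2]; split=> //= y yr; case: eqP => [yx|_]; [rewrite yx xr in yr | exact: H1]. Qed.

Lemma same_set_arr rs ars s0 s a i v : a \in ars -> same rs ars s0 s ->
  same rs ars s0 (set_arr s a i v).
Proof.
move=> ar [H1 H2]; split=> //= b j br.
by case: eqP => [ba|_]; [rewrite ba ar in br | exact: H2].
Qed.

Lemma shiftr_nat (v c : nat) :
  bitwise Z.shiftr v%:Z c%:Z = (v %/ 2 ^ c)%N%:Z.
Proof.
rewrite /bitwise /=; apply: (can_inj Z_of_intK); rewrite int_of_ZK /=.
rewrite Z.shiftr_div_pow2; last lia.
have -> : Z.pow (Zpos (xO xH)) (Z.of_nat c) = Z.of_nat (2 ^ c)%N.
  by elim: c => [//|c IH]; rewrite expnS Nat2Z.inj_succ Z.pow_succ_r ?IH; lia.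
have d0 : (0 < 2 ^ c)%N by rewrite expn_gt0.
move: (2 ^ c)%N d0 => d d0; symmetry.
apply: (Z.div_unique _ _ _ (Z.of_nat (v %% d)%N)).
  by left; have := ltn_pmod v d0; lia.
by have := divn_eq v d; nia.
Qed.

Local Notation "e1 '+e' e2" := (EBin OAdd e1 e2) (at level 50, left associativity).
Local Notation "e1 '-e' e2" := (EBin OSub e1 e2) (at level 50, left associativity).
Local Notation "e1 '*e' e2" := (EBin OMul e1 e2) (at level 40, left associativity).
Local Notation "e1 '/e' e2" := (EBin ODiv e1 e2) (at level 40, left associativity).
Local Notation "e1 '%e' e2" := (EBin OMod e1 e2) (at level 40, left associativity).
Local Notation "e1 '<e' e2" := (EBin OLt e1 e2) (at level 70).
Local Notation "e1 '=e' e2" := (EBin OEq e1 e2) (at level 70).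
Local Notation "$ x" := (EVar x) (at level 2, format "$ x").
Local Notation "# v" := (ECst v) (at level 2, format "# v").
Local Notation "p ;; q" := (Seq p q) (at level 85, right associativity).

Local Notation rm := 1%N.
Local Notation rj := 2%N.
Local Notation rc := 3%N.
Local Notation rL := 4%N.
Local Notation rb := 5%N.
Local Notation rK := 6%N.
Local Notation rxi := 7%N.
Local Notation rA := 8%N.
Local Notation rOm := 9%N.
Local Notation rS := 10%N.
Local Notation rP := 11%N.
Local Notation rY := 12%N.
Local Notation rX := 13%N.
Local Notation rQ := 14%N.
Local Notation rXX := 15%N.
Local Notation rM := 16%N.
Local Notation rbest := 17%N.
Local Notation rR := 18%N.
Local Notation rT := 19%N.
Local Notation rH := 20%N.
Local Notation rW := 21%N.
Local Notation rl := 22%N.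
Local Notation rv := 23%N.
Local Notation ru := 24%N.
Local Notation rkY := 25%N.

(* Array 3 maps a vertex to its new label plus one, array 4 maps a label back,
   array 5 lists the relabelled tails and then the heads; the arrays from 6 on
   belong to the simulated program. *)
Definition relabel_body : com :=
  ifE ($rj <e $rm) (assign ru (ERead 0 $rj)) (assign ru (ERead 1 ($rj -e $rm)));;
  ifE (ERead 3 $ru =e #0)
    (store 4 $rc $ru;; assign rc ($rc +e #1);; store 3 $ru $rc) Skip;;
  store 5 $rj (ERead 3 $ru -e #1).

Definition relabel : com := forE rj (#2 *e $rm) relabel_body.

(** A bound on the weights has to be computed from the input. The sum of squares dominates every
    absolute value without a test of signs, and it is at most [m] times the square of [R], hence
    fits into a word. *)
Definition sqsum_body : com := assign rR ($rR +e ERead 2 $rj *e ERead 2 $rj).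
Definition sqsum : com := forE rj $rm sqsum_body.

Definition bits_body : com :=
  ifE (EBin OShr $rc $rL) (assign rL ($rL +e #1)) Skip.
(** Running [n] rounds is affordable, as [n] is at most [2 * m] after the relabelling; once [rL] is
    large enough the remaining rounds change nothing. *)
Definition bits : com := forE rj $rc bits_body.

Lemma nth_Posz (l : seq nat) j : nth 0 (map Posz l) j = (nth 0%N l j)%:Z.
Proof. by elim: l j => [|x l IH] [|j] //=. Qed.

(** * Correctness of the preprocessing *)

Section Preprocessing.
Variables (n0 : nat) (E : edges n0) (B : nat).
Hypothesis B_gt0 : (0 < B)%N.
Hypothesis HB : (n0 + 2 * size E + 2 < B)%N.

Lemma relabel_ok s0 :
  (forall x, reg s0 x = reg (input E) x) ->
  (forall a i, arr s0 a i = arr (input E) a i) ->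
  wp B relabel ((2 * size E).+1 * (tcost relabel_body + ecost (#2 *e $rm) + 20))
    (fun s => [/\ same [:: rj; rc; ru] [:: 3; 4; 5] s0 s,
      reg s rc = (size (verts E))%:Z,
      forall i : nat, (i < size (verts E))%N -> arr s 4 i%:Z = (nth 0%N (verts E) i)%:Z
    & forall j : nat, (j < 2 * size E)%N ->
        arr s 5 j%:Z = (index (nth 0%N (ends E) j) (verts E))%:Z]) s0.
Proof.
move=> r0 a0; pose m := size E.
pose I j s := let l := take j (ends E) in
  [/\ same [:: rj; rc; ru] [:: 3; 4; 5] s0 s,
     reg s rj = j%:Z /\ reg s rc = (size (seen l))%:Z,
     forall v : nat, arr s 3 v%:Z = (if v \in l then (index v (seen l)).+1 else 0%N)%:Z,
     forall i : nat, (i < size (seen l))%N -> arr s 4 i%:Z = (nth 0%N (seen l) i)%:Z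
   & forall j' : nat, (j' < j)%N -> arr s 5 j'%:Z = (index (nth 0%N (ends E) j') (seen l))%:Z].
have rmE s : same [:: rj; rc; ru] [:: 3; 4; 5] s0 s -> reg s rm = m%:Z.
  by case=> H _; rewrite H // r0.
have A0 (j : nat) : arr s0 0 j%:Z = (nth 0%N (tails E) j)%:Z.
  by rewrite a0 /= -nth_Posz /tails -map_comp.
have A1 (j : nat) : arr s0 1 j%:Z = (nth 0%N (heads E) j)%:Z.
  by rewrite a0 /= -nth_Posz /heads -map_comp.
apply: (wp_for B_gt0 (I := I)) => //.
- by lia.
- move=> j s jm [S [rjE _] _ _ _]; split => //=; first by rewrite (rmE _ S).
  by rewrite (rmE _ S) /m; split => //; lia.
- move=> j s jm [S [rjE rcE] A3 A4 A5]; have rmE' := rmE _ S.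
  have jsz : (j < size (ends E))%N by rewrite size_ends.
  set l := take j (ends E) in rcE A3 A4 A5.
  pose u := nth 0%N (ends E) j.
  have un : (u < n0)%N by apply: (@verts_lt _ E); rewrite mem_seen mem_nth.
  have lS : take j.+1 (ends E) = rcons l u by rewrite (take_nth 0%N).
  have cl : (size (seen l) <= j)%N.
    by apply: leq_trans (size_seen l) _; rewrite size_takel // ltnW.
  apply: wp_static; first by [].
  pose s1 := set_reg s ru u%:Z.
  (* Both branches of the first conditional lead to [s1], so the rest of the body is treated
     once. *)
  suff [TB HB'] : exists T, wp B
      (ifE (ERead 3 $ru =e #0)
         (store 4 $rc $ru;; assign rc ($rc +e #1);; store 3 $ru $rc) Skip;;
       store 5 $rj (ERead 3 $ru -e #1)) T
      (fun s' => reg s' rj = j%:Z /\ I j.+1 (set_reg s' rj j.+1%:Z)) s1.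
    eexists; apply: (wp_seq (T2 := TB)); apply: (wp_if2 B_gt0) => //=.
    + by rewrite rjE rmE' /m; split; [lia | lia | case: ltP; lia].
    + rewrite rjE rmE' ltz_nat => jm1.
      have {}jm1 : (j < m)%N by move: jm1; case: ltnP.
      have uE : arr s 0 (reg s rj) = u%:Z.
        by case: S => _ ->; rewrite // rjE A0 /u nth_tails.
      by apply: (wp_assign B_gt0) => //=; rewrite -?rjE ?uE ?rjE //; lia.
    + rewrite rjE rmE' ltz_nat => jm1.
      have {}jm1 : (m <= j)%N by move: jm1; case: ltnP.
      have uE : arr s 1 (reg s rj - reg s rm) = u%:Z.
        case: S => _ ->; rewrite // rjE rmE' (_ : j%:Z - m%:Z = (j - m)%N%:Z); last lia.
        by rewrite A1 /u -nth_heads subnKC.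
      apply: (wp_assign B_gt0) => //=; rewrite -?rjE -?rmE' ?uE ?rjE ?rmE' /m //; try lia.
      by split; lia.
  have [S1 S2] := S.
  case ul : (u \in l).
    have sE : seen (rcons l u) = seen l by rewrite seen_rcons mem_seen ul.
    eexists; apply: wp_seq; apply: (wp_if2 B_gt0) => //=.
    + by rewrite A3 ul; split; lia.
    + by rewrite A3 ul.
    + move=> _; apply: wp_skip; apply: (wp_store B_gt0) => //=.
      * by rewrite rjE; lia.
      * have ilt : (index u (seen l) < size (seen l))%N by rewrite index_mem mem_seen.
        by rewrite A3 ul; split; lia.
      * split => //; split => /=; rewrite ?lS ?sE.
        - by apply/same_set_reg => //; apply/same_set_arr => //; apply/same_set_reg.
        - by split.
        - move=> v; rewrite A3 mem_rcons in_cons.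
          by case: eqP => // ->; rewrite ul.
        - by move=> i il; rewrite A4.
        - move=> j'; rewrite rjE eqz_nat ltnS leq_eqVlt A3 ul => /predU1P[->|jj].
            by rewrite eqxx -/u; lia.
          by rewrite (_ : (j' == j) = false) ?A5 //; lia.
  have sE : seen (rcons l u) = rcons (seen l) u by rewrite seen_rcons mem_seen ul.
  have iu : index u (rcons (seen l) u) = size (seen l).
    by rewrite -cats1 index_cat mem_seen ul /= eqxx addn0.
  eexists; apply: wp_seq; apply: (wp_if2 B_gt0) => //=.
  + by rewrite A3 ul; split; lia.
  + move=> _; apply: wp_seq; apply: (wp_store B_gt0) => //=; rewrite ?rcE; try lia.
    apply: wp_seq; apply: (wp_assign B_gt0) => //=; rewrite ?rcE; try (by split; lia); try lia.
    apply: (wp_store B_gt0) => //=; rewrite ?rcE; try lia.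
    apply: (wp_store B_gt0) => //=; rewrite ?rjE ?eqxx ?rcE; try lia.
    * by split; lia.
    * split => //; split => /=; rewrite ?lS ?sE.
      - by do ![apply/same_set_reg => //|apply/same_set_arr => //].
      - by rewrite size_rcons; split => //; lia.
      - move=> v; rewrite A3 mem_rcons in_cons eqz_nat; case: (eqVneq v u) => [->|vu] /=.
          by rewrite iu; lia.
        case: ifP => // vl; congr (Posz _.+1).
        by rewrite -sE index_seen_rcons.
      - move=> i; rewrite size_rcons ltnS nth_rcons eqz_nat leq_eqVlt => /predU1P[->|il].
          by rewrite eqxx ltnn.
        by rewrite (_ : (i == _) = false) ?A4 ?il //; lia.
      - move=> j'; rewrite ltnS leq_eqVlt eqz_nat => /predU1P[->|jj].
          by rewrite eqxx -/u iu; lia.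
        rewrite (_ : (j' == j) = false) ?A5 //; last lia.
        rewrite -sE index_seen_rcons // -(nth_take 0%N jj) mem_nth //.
        by rewrite size_takel // ltnW.
  + by rewrite A3 ul.
- by split; rewrite /= ?take0 //; exact/same_set_reg.
- move=> s [S [_ rcE] A3 A4 A5]; rewrite take_oversize ?size_ends // in rcE A4 A5.
(* What is left are the time bounds of unreachable branches. *)
Unshelve. all: exact: 0%N.
Qed.

Definition sq_total : nat := \sum_(e < size E) `|rwt E e| ^ 2.

Lemma sqsum_ok s0 : (sq_total < B)%N ->
  reg s0 rm = (size E)%:Z -> reg s0 rR = 0 ->
  (forall i : int, arr s0 2 i = arr (input E) 2 i) ->
  wp B sqsum ((size E).+1 * (tcost sqsum_body + ecost $rm + 20))
    (fun s => same [:: rj; rR] [::] s0 s /\ reg s rR = sq_total%:Z) s0.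
Proof.
move=> RB rmE rRE A2.
pose pR j := (\sum_(e < j) `|rwt E e| ^ 2)%N.
pose I j s := [/\ same [:: rj; rR] [::] s0 s, reg s rj = j%:Z & reg s rR = (pR j)%:Z].
have pRS j : pR j.+1 = (pR j + `|rwt E j| ^ 2)%N by rewrite /pR big_ord_recr.
have pRle j : (j <= size E)%N -> (pR j <= sq_total)%N.
  move=> jm; rewrite /pR /sq_total -(big_mkord xpredT (fun e => `|rwt E e| ^ 2)%N).
  rewrite -(big_mkord xpredT (fun e => `|rwt E e| ^ 2)%N) [X in (_ <= X)%N](big_cat_nat _ jm) //=.
  exact: leq_addr.
apply: (wp_for B_gt0 (I := I)) => //.
- by lia.
- move=> j s jm [S rjE _]; have r1 : reg s rm = (size E)%:Z by case: S => ->.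
  by split => //=; rewrite r1; lia.
- move=> j s jm [S rjE rRs]; apply: wp_static; first by [].
  have w2 : arr s 2 (reg s rj) = rwt E j by case: S => _ ->; rewrite // rjE A2.
  have := pRle _ jm; rewrite pRS => le1.
  have sq : rwt E j * rwt E j = (`|rwt E j| ^ 2)%N%:Z.
    by rewrite -mulnn PoszM; case: (rwt E j) => x //=; lia.
  eexists; apply: (wp_assign B_gt0) => //=.
  + by rewrite w2 sq rRs rjE; split; [lia | split; lia | lia].
  + by rewrite w2 sq rRs; lia.
  + split => //; split => //=; first by do ![apply/same_set_reg => //].
    by rewrite w2 sq rRs pRS.
- by split; rewrite /= ?rRE //; [exact/same_set_reg | rewrite /pR big_ord0].
- by move=> s [S _ ->].
Qed.

Lemma bits_ok s0 : let n := size (verts E) in (0 < n)%N ->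
  reg s0 rc = n%:Z -> reg s0 rL = 0 ->
  wp B bits (n.+1 * (tcost bits_body + ecost $rc + 20))
    (fun s => same [:: rj; rL] [::] s0 s /\
      exists L, [/\ reg s rL = L%:Z, (0 < L <= log_pos n)%N & (n < 2 ^ L)%N]) s0.
Proof.
move=> n np rcE rLE.
have nB : (n <= n0)%N by exact: size_verts_le.
(* Either [L] is large enough already or it has grown in every round; after [n] rounds the second
   case gives [n < 2 ^ L] as well. *)
pose I j s := [/\ same [:: rj; rL] [::] s0 s, reg s rj = j%:Z
  & exists L, [/\ reg s rL = L%:Z, (L <= log_pos n)%N, (L <= j)%N & (n < 2 ^ L)%N \/ L = j]].
apply: (wp_for B_gt0 (I := I)) => //.
- by lia.
- move=> j s jm [S rjE _]; have r1 : reg s rc = n%:Z by case: S => ->.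
  by split => //=; rewrite r1; lia.
- move=> j s jm [S rjE [L [LE L1 L2 L3]]]; apply: wp_static; first by [].
  have r1 : reg s rc = n%:Z by case: S => ->.
  eexists; apply: (wp_if2 B_gt0) => //=; rewrite ?r1 ?LE ?shiftr_nat.
  + have dB : (n %/ 2 ^ L <= B)%N by apply: leq_trans (leq_div _ _) _; lia.
    by split; [lia | lia | rewrite ger0_norm ?lez_nat].
  + move=> d0; have le : (2 ^ L <= n)%N by move: d0; rewrite eqz_nat -lt0n divn_gt0 ?expn_gt0.
    apply: (wp_assign B_gt0) => //=; rewrite ?LE; try (by split; lia); try lia.
    split => //; split => //=; first by do ![apply/same_set_reg => //].
    exists L.+1; split => //; try lia.
    by rewrite /log_pos ltnS; apply: trunc_log_max.
  + move=> /eqP; rewrite eqz_nat -leqn0 leqNgt divn_gt0 ?expn_gt0 // -ltnNge => lt.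
    apply: wp_skip; split => //; split => //=; first by do ![apply/same_set_reg => //].
    by exists L; split => //; [lia | left].
- split => //=; first exact/same_set_reg.
  by exists 0%N; split => //; right.
- move=> s [S _ [L [LE L1 L2 L3]]]; split => //; exists L; split => //.
  + by rewrite L1 andbT; case: L3 => [|->//]; case: L {LE L1 L2} => //; rewrite expn0; lia.
  + by case: L3 => [//|->]; exact: ltn_expl.
Qed.

End Preprocessing.

(** * Expressions for powers, digits and colour tests *)

Definition powE (e : expr) (d : nat) : expr := iter d (fun a => a *e e) #1.
Definition digE (d : nat) : expr := iter d (fun e => e /e $rb) $rxi %e $rb.

Definition pairE (k i j : nat) (e : expr) : expr :=
  let c := digE (minn i j * k + maxn i j) in
  ((EBin OShr e (c /e #2) +e c) %e #2) =e #((i < j)%N : nat)%:Z.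

Definition testE (k i : nat) (e : expr) : expr :=
  foldr (fun j a => if j == i then a else pairE k i j e *e a) #1 (iota 0 k).

Lemma lowe_powE e d : lowe e -> lowe (powE e d).
Proof. by move=> le; elim: d => //= d ->. Qed.

Lemma lowe_digE d : lowe (digE d).
Proof. by rewrite /= andbT; elim: d => //= d ->. Qed.

Lemma lowe_pairE k i j e : lowe e -> lowe (pairE k i j e).
Proof.
move=> le; rewrite /pairE; set c := digE _.
have lc : lowe c by exact: lowe_digE.
by clearbody c; rewrite /= le lc.
Qed.

Lemma lowe_testE k i e : lowe e -> lowe (testE k i e).
Proof.
move=> le; rewrite /testE; elim: (iota 0 k) => [//|j l IH].
rewrite [foldr _ _ _]/=; case: ifP => // _.
by apply/andP; split => //; exact: lowe_pairE.
Qed.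

Section Expr.
Variables (B : nat) (s : state).
Hypothesis B_gt0 : (0 < B)%N.

Lemma eval_powE e (x d : nat) : eval s e = x%:Z -> eval s (powE e d) = (x ^ d)%N%:Z.
Proof. by move=> ee; elim: d => //= d ->; rewrite ee expnSr. Qed.

Lemma safe_powE e (x d : nat) : (0 < x)%N -> eval s e = x%:Z -> safe B s e ->
  (x ^ d <= B)%N -> safe B s (powE e d).
Proof.
move=> x0 ee se; elim: d => [|d IH] /= dB; first by lia.
have le : (x ^ d <= x ^ d.+1)%N by rewrite leq_pexp2l.
rewrite -/(powE e d) (eval_powE _ ee) ee; split => //; first by apply: IH; lia.
by rewrite -PoszM -expnSr; lia.
Qed.

Variables (k b xi : nat).
Hypotheses (rbE : reg s rb = b%:Z) (rxiE : reg s rxi = xi%:Z).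
Hypotheses (xiB : (xi <= B)%N) (bB : (b <= B)%N) (b_gt0 : (0 < b)%N).

Lemma eval_digE d : eval s (digE d) = (digit b d xi)%:Z.
Proof.
rewrite /digE /digit -modz_nat -[LHS]/(modz (eval s (iter d (fun e => e /e $rb) $rxi)) (reg s rb)) rbE.
by congr (modz _ _); elim: d => //= d ->; rewrite rbE divz_nat.
Qed.

Lemma digit_le d : (digit b d xi <= xi)%N /\ (digit b d xi < b)%N.
Proof.
split; last exact: ltn_pmod; apply: leq_trans (leq_mod _ _) _.
by elim: d => //= d IH; apply: leq_trans (leq_div _ _) IH.
Qed.

Lemma safe_digE d : safe B s (digE d).
Proof.
have it : safe B s (iter d (fun e => e /e $rb) $rxi) /\
    exists2 y : nat, eval s (iter d (fun e => e /e $rb) $rxi) = y%:Z & (y <= xi)%N.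
  elim: d => [|d [IH [y yE yx]]] /=; first by rewrite rxiE; split; [lia | exists xi].
  have yy := leq_div y b.
  rewrite yE rbE divz_nat; split; last by exists (y %/ b)%N => //; exact: leq_trans yx.
  by split; [exact: IH | lia | move: (y %/ b)%N yy => z; lia].
split; [by case: it | by rewrite /= rbE; lia |].
rewrite -[X in `|X|]/(eval s (digE d)) eval_digE.
by have [] := digit_le d; lia.
Qed.

Lemma eval_testE i e (v : nat) : eval s e = v%:Z ->
  eval s (testE k i e) = (coloured k b xi i v : nat)%:Z.
Proof.
move=> ee; rewrite /testE /coloured; elim: (iota 0 k) => [//|j l IH].
rewrite [foldr _ _ _]/= [all _ _]/=; case: (eqVneq j i) => //= _; set t := foldr _ _ _ in IH *.
rewrite -[LHS]/(eval s (pairE k i j e) * eval s t) IH.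
suff -> : eval s (pairE k i j e) = ((pair_bit k b xi i j v == (i < j)%N) : nat)%:Z.
  by rewrite -PoszM mulnb.
rewrite /pairE; set c := digE _.
rewrite -[LHS]/(((modz (bitwise Z.shiftr (eval s e) (divz (eval s c) 2) + eval s c) 2 == ((i < j)%N : nat)%:Z) : nat)%:Z).
rewrite ee /c eval_digE divz_nat shiftr_nat -PoszD modz_nat modn2 eqz_nat.
by rewrite /pair_bit /pair_digit; case: (odd _); case: (i < j)%N.
Qed.

Lemma safe_testE i e (v : nat) : eval s e = v%:Z -> safe B s e ->
  (v + b + 2 <= B)%N -> safe B s (testE k i e).
Proof.
move=> ee se vB.
suff [] : safe B s (testE k i e) /\ exists y : bool, eval s (testE k i e) = (y : nat)%:Z by [].
rewrite /testE; elim: (iota 0 k) => [|j l [IH [y yE]]].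
  by split; [rewrite /=; lia | exists true].
rewrite [foldr _ _ _]/=; case: eqP => _; first by split => //; exists y.
set t := foldr _ _ _ in IH yE *.
have [z zE] : exists z : bool, eval s (pairE k i j e) = (z : nat)%:Z.
  by rewrite /pairE; eexists; reflexivity.
split; last first.
  by exists (z && y); rewrite -[LHS]/(eval s (pairE k i j e) * eval s t) zE yE -PoszM mulnb.
split => //; last first.
  by rewrite zE yE; case: (z); case: (y) => /=; lia.
rewrite /pairE; set d := (_ + _)%N; set c := digE d.
have cE : eval s c = (digit b d xi)%:Z by exact: eval_digE.
have [c1 c2] := digit_le d; have sc : safe B s c by exact: safe_digE.
have sh : eval s (EBin OShr e (c /e #2)) = (v %/ 2 ^ (digit b d xi %/ 2))%N%:Z.
  by rewrite -[LHS]/(bitwise Z.shiftr (eval s e) (divz (eval s c) 2)) ee cE divz_nat shiftr_nat.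
have vle : (v %/ 2 ^ (digit b d xi %/ 2) <= v)%N by exact: leq_div.
have ad : eval s (EBin OShr e (c /e #2) +e c) = (v %/ 2 ^ (digit b d xi %/ 2) + digit b d xi)%N%:Z.
  by rewrite -[LHS]/(eval s (EBin OShr e (c /e #2)) + eval s c) sh cE.
have half : (digit b d xi %/ 2 <= digit b d xi)%N by exact: leq_div.
have mB (y1 : nat) : (y1 <= B)%N -> `|y1%:Z| <= B%:Z by lia.
split; [split; [split; [split | |] | |] | |].
- by [].
- split => //; first by rewrite /=; lia.
  rewrite cE -[X in `|X|]/(divz (digit b d xi)%:Z 2) divz_nat; apply: mB.
  by apply: leq_trans half _; lia.
- rewrite -[X in `|X|]/(eval s (EBin OShr e (c /e #2))) sh; apply: mB.
  by apply: leq_trans vle _; lia.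
- by [].
- rewrite -[X in `|X|]/(eval s (EBin OShr e (c /e #2) +e c)) ad; apply: mB.
  by apply: leq_trans (leq_add vle (ltnW c2)) _; lia.
- by rewrite /=; lia.
- rewrite ad -[X in `|X|]/(modz _ 2) modz_nat; apply: mB.
  apply: leq_trans (ltnW (ltn_pmod _ (isT : (0 < 2)%N))) _; lia.
- by case: (i < j)%N => /=; lia.
- by rewrite -[X in `|X|]/(eval s (pairE k i j e)) zE; case: (z) => /=; lia.
Qed.

End Expr.

(** Colour tests and powers are unrolled for a fixed layer. As [k] is a constant, a chain of
    comparisons can select the code of the current layer in constant time. *)
Definition dispatch (body : nat -> com) (l : seq nat) : com :=
  foldr (fun i c => ifE ($rl =e #(i%:Z)) (body i) c) Skip l.

Definition edge_layer (k i : nat) : com :=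
  assign rT (#(i%:Z) *e $rc +e ERead 5 $rv);;
  assign rH (#(i.+1%:Z) *e $rc +e ERead 5 ($rm +e $rv));;
  ifE (testE k i (ERead 5 $rv) *e testE k (i.+1 %% k) (ERead 5 ($rm +e $rv)))
    (assign rW ($rY +e (ERead 2 $rv *e $rA +e ERead 5 $rv *e powE $rc i)))
    (assign rW $rXX).

Definition edge_hub (k : nat) : com :=
  assign rv ($rl /e #((k + 4)%N%:Z));; assign rl ($rl %e #((k + 4)%N%:Z));;
  ifE ($rl <e #4)
    (ifE ($rl <e #2) (assign rT $rv) (assign rT (#(k%:Z) *e $rc +e $rv));;
     assign rH (#(k.+1%:Z) *e $rc +e $rl %e #2);;
     ifE (($rl =e #0) +e ($rl =e #3))
       (assign rW ($rX +e $rv *e $rS)) (assign rW ($rX -e $rv *e $rS)))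
    (assign rT (($rl -e #4) *e $rc +e $rv);;
     assign rH (#(k.+1%:Z) *e $rc +e #2);;
     ifE ($rl =e #4) (assign rW $rP) (assign rW $rQ)).

Definition edge_calc (k : nat) : com :=
  ifE ($rj <e $rm *e #(k%:Z))
    (assign rl ($rj %e #(k%:Z));; assign rv ($rj /e #(k%:Z));;
     dispatch (edge_layer k) (iota 0 k))
    (assign rl ($rj -e $rm *e #(k%:Z));;
     ifE ($rl <e $rc *e #((k + 4)%N%:Z)) (edge_hub k)
       (assign rT (#(k.+1%:Z) *e $rc +e #2);;
        assign rH (#(k.+1%:Z) *e $rc +e #3);; assign rW $rQ)).

(** With offset 6, the arrays 7, 9 and 11 represent the arrays 0, 1 and 2 of the simulated program:
    tails, heads and weights. *)
Definition edge_body (k : nat) : com :=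
  edge_calc k;;
  store 7 (cellE rxi rK $rj) $rT;;
  store 9 (cellE rxi rK $rj) $rH;;
  store 11 (cellE rxi rK $rj) $rW.

Lemma loopfree_dispatch body l : (forall i, loopfree (body i)) ->
  loopfree (dispatch body l).
Proof. by move=> H; elim: l => //= i l ->; rewrite H. Qed.

Lemma loopfree_edge_body k : loopfree (edge_body k).
Proof.
have H i : loopfree (edge_layer k i) by rewrite /= !loopfree_cexpr.
by rewrite /= loopfree_dispatch.
Qed.

Lemma wp_assignE B x e v Q s : (0 < B)%N ->
  (x < tb)%N -> lowe e -> eval s e = v -> safe B s e -> `|v| <= B%:Z ->
  Q (set_reg s x v) -> wp B (assign x e) (ecost e + 2) Q s.
Proof. by move=> B0 xb le <- *; exact: wp_assign. Qed.

Lemma wp_dispatch B body l i Q s : (0 < B)%N ->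
  i \in l -> reg s rl = i%:Z -> (forall j, j \in l -> (j <= B)%N) ->
  (exists T, wp B (body i) T Q s) -> exists T, wp B (dispatch body l) T Q s.
Proof.
move=> B0 + rE + [T H]; elim: l => // j l IH; rewrite in_cons => il jB.
have iB : (i <= B)%N by apply: jB; rewrite in_cons.
have jB1 : (j <= B)%N by apply: jB; rewrite mem_head.
have sf : safe B s ($rl =e #(j%:Z)).
  by rewrite /= rE; split; [lia | lia | case: eqP => /= _; lia].
case: (eqVneq i j) il => [ij _|ij /= il].
  subst j; exists (ecost ($rl =e #(i%:Z)) + (T + 0).+1)%N.
  by apply: (wp_if2 B0) => //=; rewrite rE eqxx.
have [|T' H'] := IH il; first by move=> x xl; apply: jB; rewrite in_cons xl orbT.
exists (ecost ($rl =e #(j%:Z)) + (0 + T').+1)%N.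
apply: (wp_if2 B0) => //=.
by rewrite rE eqz_nat (negbTE ij).
Qed.

Lemma rwt_le_sq_total (n0 : nat) (E : edges n0) e : (e < size E)%N ->
  `|rwt E e| <= (sq_total E)%:Z.
Proof.
move=> em; have : (`|rwt E e| ^ 2 <= sq_total E)%N.
  by rewrite /sq_total (bigD1 (Ordinal em)) //= leq_addr.
by rewrite -mulnn; nia.
Qed.

(** * Building the instances and the loop over the colourings *)

Section Main.
Variables (n0 k : nat) (E : edges n0) (B B0 L : nat).
Local Notation n := (size (verts E)).
Local Notation m := (size E).
Local Notation R0 := (sq_total E).
Local Notation b := (2 * L)%N.
Local Notation K := (b ^ (k * k))%N.
Hypotheses (k_gt0 : (0 < k)%N) (m_gt0 : (0 < m)%N) (L_gt0 : (0 < L)%N).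
Hypotheses (E_simple : simple_digraph E) (nL : (n < 2 ^ L)%N).
Hypothesis HB : (n0 + 2 * m + R0 + 8 * gX n k R0 + 2 * L
  + (gM n k m + B0 + 20) * K.+1 + 20 < B)%N.

Record consts_of (s : state) : Prop := ConstsOf {
  c_m : reg s rm = m%:Z;
  c_n : reg s rc = n%:Z;
  c_b : reg s rb = b%:Z;
  c_K : reg s rK = K%:Z;
  c_A : reg s rA = (gA n k)%:Z;
  c_S : reg s rS = (gS n k R0)%:Z;
  c_P : reg s rP = (gP n k R0)%:Z;
  c_Y : reg s rY = (gY n k R0)%:Z;
  c_X : reg s rX = (gX n k R0)%:Z;
  c_Q : reg s rQ = (gQ n k R0)%:Z;
  c_XX : reg s rXX = (2 * gX n k R0)%N%:Z;
  c_M : reg s rM = (gM n k m)%:Z;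
  c_kY : reg s rkY = (k * gY n k R0)%N%:Z }.

Lemma consts_same rs ars s0 s :
  all (fun x => x \notin rs) [:: rm; rc; rb; rK; rA; rS; rP; rY; rX; rQ; rXX; rM; rkY] ->
  same rs ars s0 s -> consts_of s0 -> consts_of s.
Proof.
move=> /= H [S _] [*]; do 13 (move: H => /andP[? H]).
by split; rewrite S.
Qed.

(** Expands the products with [K], so that linear arithmetic can treat them as atoms. *)
Lemma B_facts :
  (n0 + 2 * m + R0 + 8 * gX n k R0 + 2 * L + gM n k m + B0 + 40 <= B /\
   gM n k m * K + B0 * K + 20 * K + 20 < B)%N.
Proof.
move: HB; rewrite mulnS !mulnDl; set t := (gM n k m * K)%N.
by set t' := (B0 * K)%N; set t2 := (20 * K)%N; lia.
Qed.

Lemma B_gt0 : (0 < B)%N. Proof. by case: B_facts; lia. Qed.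
Lemma n_gt0 : (0 < n)%N. Proof. exact: size_verts_gt0. Qed.
Lemma K_gt0 : (0 < K)%N. Proof. by rewrite expn_gt0; apply/orP; left; lia. Qed.

Lemma rwt_le e : (e < m)%N -> `|rwt E e| <= R0%:Z.
Proof. exact: rwt_le_sq_total. Qed.

Lemma size_facts :
  [/\ (n <= n0)%N, (gA n k <= gOm n k R0 /\ gOm n k R0 <= k * gOm n k R0)%N,
      (k * n + n + 4 * n <= gM n k m + n /\ k <= k * n)%N,
      (gS n k R0 = 3 * (k * gOm n k R0) /\ gP n k R0 = 2 * (n * gS n k R0) /\
       gY n k R0 = 20 * (n * gS n k R0) /\ gS n k R0 <= n * gS n k R0 /\
       gY n k R0 <= k * gY n k R0)%N
    & (gP n k R0 + gQ n k R0 + k * gOm n k R0 = k * gY n k R0 /\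
       2 * gX n k R0 = k * gY n k R0 + 2 * (k * gOm n k R0))%N].
Proof.
have np := n_gt0; have [[f1 [f2 f3]] [f4 [f5 f6]]] := g_facts R0 np k_gt0.
split => //; first exact: size_verts_le.
- by split => //; rewrite /gOm; exact: leq_pmull.
- by rewrite leq_pmulr //; split => //; rewrite /gM; lia.
- split; [exact: gPQ | exact: gX2].
Qed.

Definition edge_post (s s' : state) (T H : nat) (W : int) : Prop :=
  [/\ same [:: rT; rH; rW; rl; rv] [::] s s', reg s' rT = T%:Z,
      reg s' rH = H%:Z & reg s' rW = W].

Section Config.
Variable xi : nat.
Hypothesis xiK : (xi < K)%N.

Lemma edge_layer_ok s e i : consts_of s -> reg s rxi = xi%:Z ->
  (forall j : nat, (j < 2 * m)%N -> arr s 5 j%:Z = (index (nth 0%N (ends E) j) (verts E))%:Z) ->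
  (forall j : nat, (j < m)%N -> arr s 2 j%:Z = rwt E j) ->
  reg s rv = e%:Z -> (e < m)%N -> (i < k)%N ->
  exists T, wp B (edge_layer k i) T (fun s' => edge_post s s'
    (i * n + rtl E e) (i.+1 * n + rhd E e)
    (if arc k (rtl E) (rhd E) (coloured k b xi) i e
     then (gY n k R0)%:Z + acost n k (rtl E) (rwt E) i e
     else (2 * gX n k R0)%N%:Z)) s.
Proof.
move=> C xE A5 A2 vE em ik; have Bp := B_gt0; have np := n_gt0; have Kp := K_gt0.
have [F1 F2 F3 F4 F5] := size_facts.
have tE : arr s 5 (reg s rv) = (rtl E e)%:Z by rewrite vE A5 //; lia.
have hE : arr s 5 (reg s rm + reg s rv) = (rhd E e)%:Z.
  by rewrite vE (c_m C) -PoszD A5 //; lia.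
have wE : arr s 2 (reg s rv) = rwt E e by rewrite vE A2.
have tn := rtl_lt em; have hn := rhd_lt em.
have ikn : (i * n + n <= k * n)%N by rewrite -mulSnr leq_mul2r ik orbT.
have pw : (n ^ i <= gA n k)%N by rewrite leq_pexp2l // ltnW.
have un : (rtl E e * n ^ i <= gA n k)%N.
  apply: (@leq_trans (n ^ i.+1)%N); last by rewrite leq_pexp2l.
  by rewrite expnS leq_mul2r (ltnW tn) orbT.
have wA : `|rwt E e * (gA n k)%:Z| <= (gOm n k R0)%:Z.
  have := ler_wpM2r (isT : 0 <= (gA n k)%:Z) (rwt_le em).
  by rewrite /gOm mulSn normrM; lia.
have [BK BK'] := B_facts; clear HB.
eexists; apply: wp_seq; apply: (wp_assignE (v := (i * n + rtl E e)%N%:Z)) => //=.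
- by rewrite (c_n C) tE.
- rewrite tE (c_n C) vE; split; [split; [lia|lia|lia] | lia | lia].
- by lia.
apply: wp_seq; apply: (wp_assignE (v := (i.+1 * n + rhd E e)%N%:Z)) => //=.
- by rewrite (c_n C) hE.
- rewrite hE (c_n C) (c_m C) vE; split; [split; [lia|lia|lia] | split; lia | lia].
- by lia.
set s1 := set_reg _ _ _; pose l := coloured k b xi.
have st : eval s1 (testE k i (ERead 5 $rv)) = (l i (rtl E e) : nat)%:Z.
  by apply: eval_testE => //=; rewrite ?(c_b C) ?xE ?tE.
have sh : eval s1 (testE k (i.+1 %% k) (ERead 5 ($rm +e $rv))) = (l (i.+1 %% k)%N (rhd E e) : nat)%:Z.
  by apply: eval_testE => //=; rewrite ?(c_b C) ?xE ?hE.
have s1E : eval s1 (testE k i (ERead 5 $rv) *e testE k (i.+1 %% k) (ERead 5 ($rm +e $rv)))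
    = (arc k (rtl E) (rhd E) l i e : nat)%:Z.
  by rewrite -[LHS]/(eval s1 (testE k i (ERead 5 $rv)) *
    eval s1 (testE k (i.+1 %% k) (ERead 5 ($rm +e $rv)))) st sh -PoszM mulnb.
have xB : (xi <= B)%N by lia.
apply: (wp_if2 Bp).
- by apply/andP; split; apply: lowe_testE.
- split.
  + apply: (@safe_testE B s1 Bp k b xi (c_b C) xE xB _ _ i _ (rtl E e)) => //=; lia.
  + apply: (@safe_testE B s1 Bp k b xi (c_b C) xE xB _ _ _ _ (rhd E e)) => //=; try lia.
    by rewrite (c_m C) vE; split; lia.
  + rewrite -[X in `|X|]/(eval s1 (testE k i (ERead 5 $rv) *e testE k (i.+1 %% k) (ERead 5 ($rm +e $rv)))) s1E.
    by case: (arc _ _ _ _ _ _) => /=; lia.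
- rewrite s1E => a1; have -> : arc k (rtl E) (rhd E) l i e by move: a1; case: (arc _ _ _ _ _ _).
  have pE : eval s1 (powE $rc i) = (n ^ i)%N%:Z by apply: eval_powE; exact: (c_n C).
  have sp : safe B s1 (powE $rc i).
    by apply: (safe_powE Bp (x := n)) => //=; rewrite ?(c_n C); lia.
  apply: (wp_assignE (v := (gY n k R0)%:Z + acost n k (rtl E) (rwt E) i e)) => //.
  + by rewrite /= lowe_powE.
  + rewrite -[LHS]/(reg s rY + (arr s 2 (reg s rv) * reg s rA + arr s 5 (reg s rv) * eval s1 (powE $rc i))).
    by rewrite pE wE tE (c_Y C) (c_A C) -PoszM.
  + rewrite /= pE wE tE (c_Y C) (c_A C) vE.
    split; [lia | split; [split; lia | split; [lia | exact: sp | rewrite -PoszM; lia] | rewrite -PoszM; lia] | rewrite -PoszM; lia].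
  + by rewrite /acost; lia.
  + by split => //; do ![apply/same_set_reg => //].
- rewrite s1E => a1; have -> : arc k (rtl E) (rhd E) l i e = false by move: a1; case: (arc _ _ _ _ _ _).
  apply: (wp_assignE (v := (2 * gX n k R0)%N%:Z)) => //=.
  + exact: (c_XX C).
  + by rewrite (c_XX C); lia.
  + by lia.
  + by split => //; do ![apply/same_set_reg => //].
Qed.

Lemma edge_hub_ok s v c : consts_of s -> reg s rl = (v * (k + 4) + c)%N%:Z ->
  (v < n)%N -> (c < k + 4)%N ->
  exists T, wp B (edge_hub k) T (fun s' => edge_post s s'
    (if (c < 2)%N then v else if (c < 4)%N then (k * n + v)%N else ((c - 4) * n + v)%N)
    (if (c < 4)%N then (k.+1 * n + c %% 2)%N else (k.+1 * n + 2)%N)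
    (if (c < 4)%N then
        (if (c == 0%N) || (c == 3%N) then (gX n k R0)%:Z + (v * gS n k R0)%N%:Z
         else (gX n k R0)%:Z - (v * gS n k R0)%N%:Z)
      else if c == 4%N then (gP n k R0)%:Z else (gQ n k R0)%:Z)) s.
Proof.
move=> C lE vn ck; have Bp := B_gt0; have np := n_gt0; have Kp := K_gt0.
have [F1 F2 F3 F4 F5] := size_facts; have [BK BK'] := B_facts; clear HB.
have k4 : (0 < k + 4)%N by lia.
have lM : (v * (k + 4) + c <= gM n k m)%N.
  have : (v.+1 * (k + 4) <= n * (k + 4))%N by rewrite leq_mul2r vn orbT.
  by rewrite mulSn /gM; lia.
have vS : (v * gS n k R0 + gS n k R0 <= n * gS n k R0)%N.
  by rewrite -mulSnr leq_mul2r vn orbT.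
have kn4 : (k + 4 <= gM n k m)%N by rewrite /gM; have := leq_pmull (k + 4) np; lia.
eexists; apply: wp_seq; apply: (wp_assignE (v := v%:Z)) => //=.
- by rewrite lE divz_nat divnMDl // divn_small // addn0.
- by rewrite lE divz_nat divnMDl // divn_small // addn0; split; lia.
- by lia.
apply: wp_seq; apply: (wp_assignE (v := c%:Z)) => //=.
- by rewrite lE modz_nat modnMDl modn_small.
- by rewrite lE modz_nat modnMDl modn_small //; split; lia.
- by lia.
apply: (wp_if2 Bp) => //=.
- by split; [lia | lia | case: ltP => /= _; lia].
- rewrite ltz_nat => c4; have {}c4 : (c < 4)%N by move: c4; case: ltnP.
  have cn : (c - 4 = 0)%N by lia.
  rewrite c4; apply: wp_seq; apply: (wp_if2 Bp) => //=.
  + by split; [lia | lia | case: ltP => /= _; lia].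
  + rewrite ltz_nat => c2; have {}c2 : (c < 2)%N by move: c2; case: ltnP.
    apply: (wp_assignE (v := v%:Z)) => //=; [lia | lia |].
    apply: wp_seq; apply: (wp_assignE (v := (k.+1 * n + c %% 2)%N%:Z)) => //=.
    * by rewrite (c_n C) modz_nat.
    * rewrite (c_n C) modz_nat modn_small //.
      by split; [split; lia | split; lia | lia].
    * by rewrite modn_small //; lia.
    apply: (wp_if2 Bp) => //=.
    * by split; [split; [lia | lia | case: eqP => /= _; lia] | split; [lia | lia | case: eqP => /= _; lia]|]; do 2 case: eqP => /= _; lia.
    * move=> c03; have c0 : c = 0%N by move: c2 c03; case: (c) => [|[|]].
      apply: (wp_assignE (v := (gX n k R0)%:Z + (v * gS n k R0)%N%:Z)) => //=.
      - by rewrite (c_X C) (c_S C).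
      - by rewrite (c_X C) (c_S C); split; [lia | split; lia | lia].
      - by lia.
      - by split => //=; rewrite ?c2 ?c0 //; do ![apply/same_set_reg => //].
    * move=> c03; have c1 : c = 1%N by move: c2 c03; case: (c) => [|[|]].
      apply: (wp_assignE (v := (gX n k R0)%:Z - (v * gS n k R0)%N%:Z)) => //=.
      - by rewrite (c_X C) (c_S C).
      - by rewrite (c_X C) (c_S C); split; [lia | split; lia | lia].
      - by lia.
      - by split => //=; rewrite ?c2 ?c1 //; do ![apply/same_set_reg => //].
  + rewrite ltz_nat => c2; have {}c2 : (2 <= c)%N by move: c2; case: ltnP.
    apply: (wp_assignE (v := (k * n + v)%N%:Z)) => //=.
    * by rewrite (c_n C).
    * by rewrite (c_n C); split; [split; lia | lia | lia].
    * by lia.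
    apply: wp_seq; apply: (wp_assignE (v := (k.+1 * n + c %% 2)%N%:Z)) => //=.
    * by rewrite (c_n C) modz_nat.
    * have := ltn_pmod c (isT : (0 < 2)%N); rewrite (c_n C) modz_nat => m2.
      by split; [split; lia | split; lia | lia].
    * by have := ltn_pmod c (isT : (0 < 2)%N); lia.
    apply: (wp_if2 Bp) => //=.
    * by split; [split; [lia | lia | case: eqP => /= _; lia] | split; [lia | lia | case: eqP => /= _; lia]|]; do 2 case: eqP => /= _; lia.
    * move=> c03; have c0 : c = 3%N by move: c2 c4 c03; case: (c) => [|[|[|[|]]]].
      apply: (wp_assignE (v := (gX n k R0)%:Z + (v * gS n k R0)%N%:Z)) => //=.
      - by rewrite (c_X C) (c_S C).
      - by rewrite (c_X C) (c_S C); split; [lia | split; lia | lia].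
      - by lia.
      - by split => //=; rewrite ?c0 //; do ![apply/same_set_reg => //].
    * move=> c03; have c1 : c = 2%N by move: c2 c4 c03; case: (c) => [|[|[|[|]]]].
      apply: (wp_assignE (v := (gX n k R0)%:Z - (v * gS n k R0)%N%:Z)) => //=.
      - by rewrite (c_X C) (c_S C).
      - by rewrite (c_X C) (c_S C); split; [lia | split; lia | lia].
      - by lia.
      - by split => //=; rewrite ?c1 //; do ![apply/same_set_reg => //].
- rewrite ltz_nat => c4; have {}c4 : (4 <= c)%N by move: c4; case: ltnP.
  have c2 : (c < 2)%N = false by lia.
  have c4' : (c < 4)%N = false by lia.
  have cn : ((c - 4) * n + n <= k * n)%N.
    by rewrite -mulSnr leq_mul2r; apply/orP; right; lia.
  have c4E : c%:Z - 4 = (c - 4)%N%:Z by lia.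
  rewrite c2 c4'; move: (c - 4)%N cn c4E => d cn c4E.
  apply: wp_seq; apply: (wp_assignE (v := (d * n + v)%N%:Z)) => //=.
  + by rewrite (c_n C) c4E.
  + rewrite (c_n C) c4E; split; [split; [split; lia | lia | lia] | lia | lia].
  + by lia.
  apply: wp_seq; apply: (wp_assignE (v := (k.+1 * n + 2)%N%:Z)) => //=.
  + by rewrite (c_n C).
  + by rewrite (c_n C); split; [split; lia | lia | lia].
  + by lia.
  apply: (wp_if2 Bp) => //=.
  + by split; [lia | lia | case: eqP => /= _; lia].
  + move=> c5; have {}c5 : (c == 4)%N by move: c5; case: (c%:Z =P 4) => // -[->].
    rewrite c5; apply: (wp_assignE (v := (gP n k R0)%:Z)) => //=.
    * exact: (c_P C).
    * by rewrite (c_P C); lia.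
    * by lia.
    * by split => //=; do ![apply/same_set_reg => //].
  + move=> c5; have {}c5 : (c == 4)%N = false by move: c5; case: (eqVneq c 4%N) => // ->.
    rewrite c5; apply: (wp_assignE (v := (gQ n k R0)%:Z)) => //=.
    * exact: (c_Q C).
    * by rewrite (c_Q C); lia.
    * by lia.
    * by split => //=; do ![apply/same_set_reg => //].
Qed.

Lemma edge_calc_ok s j : consts_of s -> reg s rxi = xi%:Z ->
  (forall j : nat, (j < 2 * m)%N -> arr s 5 j%:Z = (index (nth 0%N (ends E) j) (verts E))%:Z) ->
  (forall j : nat, (j < m)%N -> arr s 2 j%:Z = rwt E j) ->
  reg s rj = j%:Z -> (j < gM n k m)%N ->
  exists T, wp B (edge_calc k) T (fun s' => edge_post s s'
    (gT n k m (rtl E) j) (gH n k m (rhd E) j)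
    (gW n k m R0 (rtl E) (rhd E) (rwt E) (coloured k b xi) j)) s.
Proof.
move=> C xE A5 A2 jE jM; have Bp := B_gt0; have np := n_gt0; have Kp := K_gt0.
have [F1 F2 F3 F4 F5] := size_facts; have [BK BK'] := B_facts.
have layer_ok := edge_layer_ok; have hub_ok := edge_hub_ok; clear HB.
have kn4 : (k + 4 <= gM n k m)%N by rewrite /gM; have := leq_pmull (k + 4) np; lia.
have mk : (m * k <= gM n k m)%N by rewrite /gM; lia.
have nk4 : (n * (k + 4) <= gM n k m)%N by rewrite /gM; lia.
have post_trans s1 s2 T H W : same [:: rT; rH; rW; rl; rv] [::] s s1 ->
    edge_post s1 s2 T H W -> edge_post s s2 T H W.
  move=> [S1 S1'] [[S2 S2'] *]; split => //; split => [x xN|a i aN].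
    by rewrite S2 // S1.
  by rewrite S2' // S1'.
rewrite /gT /gH /gW; case: ifP => jmk.
  have ik : (j %% k < k)%N by exact: ltn_pmod.
  have em : (j %/ k < m)%N by rewrite ltn_divLR.
  pose s1 := set_reg (set_reg s rl (j %% k)%N%:Z) rv (j %/ k)%N%:Z.
  have S1 : same [:: rT; rH; rW; rl; rv] [::] s s1 by do ![apply/same_set_reg => //].
  have C1 : consts_of s1 by exact: consts_same S1 C.
  have [T1 H1] := layer_ok s1 (j %/ k)%N (j %% k)%N C1 xE A5 A2 erefl em ik.
  set Q := (fun s' => edge_post s s' _ _ _).
  have H1' : exists T, wp B (edge_layer k (j %% k)) T Q s1.
    by exists T1; apply: wp_weaken H1 (leqnn _) _ => s'; exact: post_trans.
  have [|//||T2 H2] := wp_dispatch Bp _ _ _ H1' (l := iota 0 k).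
  - by rewrite mem_iota.
  - by move=> i; rewrite mem_iota => /andP[_]; rewrite add0n => ? ; lia.
  exists (ecost ($rj <e $rm *e #(k%:Z)) +
     ((ecost ($rj %e #(k%:Z)) + 2 + (ecost ($rj /e #(k%:Z)) + 2 + T2)) + 0).+1)%N.
  have jm1 := leq_div j k.
  apply: (wp_if2 Bp) => //=.
  - by rewrite jE (c_m C); split; [lia | split; lia | case: ltP => /= _; lia].
  - move=> _; apply: wp_seq; apply: (wp_assignE (v := (j %% k)%N%:Z)) => //=.
    + by rewrite jE modz_nat.
    + by rewrite jE modz_nat; split; lia.
    + by lia.
    apply: wp_seq; apply: (wp_assignE (v := (j %/ k)%N%:Z)) => //=.
    + by rewrite jE divz_nat.
    + by rewrite jE divz_nat; move: (j %/ k)%N jm1 => q ?; split; lia.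
    + by move: (j %/ k)%N jm1 => q ?; lia.
  - by rewrite jE (c_m C) -PoszM ltz_nat jmk.
have jmk' : (m * k <= j)%N by lia.
have lE : j%:Z - m%:Z * k%:Z = (j - m * k)%N%:Z by lia.
case: ifP => ln.
  pose s1 := set_reg s rl (j - m * k)%N%:Z.
  have S1 : same [:: rT; rH; rW; rl; rv] [::] s s1 by do ![apply/same_set_reg => //].
  have C1 : consts_of s1 by exact: consts_same S1 C.
  have k4 : (0 < k + 4)%N by lia.
  have vn : ((j - m * k) %/ (k + 4) < n)%N by rewrite ltn_divLR.
  have ck : ((j - m * k) %% (k + 4) < k + 4)%N by exact: ltn_pmod.
  have [|T1 H1] := hub_ok s1 _ _ C1 _ vn ck.
    by rewrite -divn_eq.
  exists (ecost ($rj <e $rm *e #(k%:Z)) +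
     (0 + ((ecost ($rj -e $rm *e #(k%:Z)) + 2) +
       (ecost ($rl <e $rc *e #((k + 4)%N%:Z)) + (T1 + 0).+1))).+1)%N.
  apply: (wp_if2 Bp) => //=.
  - by rewrite jE (c_m C); split; [lia | split; lia | case: ltP => /= _; lia].
  - by rewrite jE (c_m C) -PoszM ltz_nat jmk.
  - move=> _; apply: wp_seq; apply: (wp_assignE (v := (j - m * k)%N%:Z)) => //=.
    + by rewrite jE (c_m C).
    + by rewrite jE (c_m C); split; [lia | split; lia | lia].
    + by lia.
    apply: (wp_if2 Bp) => //=.
    + by rewrite (c_n C); split; [lia | split; lia | case: ltP => /= _; lia].
    + move=> _; apply: wp_weaken H1 (leqnn _) _ => s'; exact: post_trans.
    + by rewrite (c_n C) -PoszM ltz_nat ln.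
eexists; apply: (wp_if2 Bp (T1 := 0%N)) => //=.
- by rewrite jE (c_m C); split; [lia | split; lia | case: ltP => /= _; lia].
- by rewrite jE (c_m C) -PoszM ltz_nat jmk.
- move=> _; apply: wp_seq; apply: (wp_assignE (v := (j - m * k)%N%:Z)) => //=.
  + by rewrite jE (c_m C).
  + by rewrite jE (c_m C); split; [lia | split; lia | lia].
  + by lia.
  apply: (wp_if2 Bp (T1 := 0%N)) => //=.
  + by rewrite (c_n C); split; [lia | split; lia | case: ltP => /= _; lia].
  + by rewrite (c_n C) -PoszM ltz_nat ln.
  + move=> _; apply: wp_seq; apply: (wp_assignE (v := (k.+1 * n + 2)%N%:Z)) => //=.
    * by rewrite (c_n C).
    * by rewrite (c_n C); split; [split; lia | lia | lia].
    * by lia.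
    apply: wp_seq; apply: (wp_assignE (v := (k.+1 * n + 3)%N%:Z)) => //=.
    * by rewrite (c_n C).
    * by rewrite (c_n C); split; [split; lia | lia | lia].
    * by lia.
    apply: (wp_assignE (v := (gQ n k R0)%:Z)) => //=.
    * exact: (c_Q C).
    * by rewrite (c_Q C); lia.
    * by lia.
    * by split => //=; do ![apply/same_set_reg => //].
Qed.

(** An input array read at any integer index; letting [M] vary describes a partially built
    instance. *)
Definition inp (f : nat -> int) (M : nat) (i : int) : int :=
  if i is Posz j then (if (j < M)%N then f j else 0) else 0.

Lemma inpS f M i : inp f M.+1 i = if i == M%:Z then f M else inp f M i.
Proof.
case: i => [j|j] //=; rewrite eqz_nat ltnS leq_eqVlt.
by case: eqP => //= ->.
Qed.

Lemma inp0 f i : inp f 0 i = 0. Proof. by case: i. Qed.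

Local Notation tst := (coloured k b xi).
Local Notation T_ := (fun j => (gT n k m (rtl E) j)%:Z).
Local Notation H_ := (fun j => (gH n k m (rhd E) j)%:Z).
Local Notation W_ := (gW n k m R0 (rtl E) (rhd E) (rwt E) tst).
Local Notation F_ := (gF n k m R0 (rtl E) (rhd E) (rwt E) tst).

Definition work_regs : seq nat := [:: rj; rT; rH; rW; rl; rv].

Definition built (s0 s : state) (j : nat) : Prop :=
  [/\ forall x, x \notin work_regs -> reg s x = reg s0 x,
      forall a z, (a \notin [:: 7; 9; 11]) || (modz z K%:Z != xi%:Z) ->
        arr s a z = arr s0 a z
    & forall i, [/\ arr s 7 (i * K%:Z + xi%:Z) = inp T_ j i,
        arr s 9 (i * K%:Z + xi%:Z) = inp H_ j i
      & arr s 11 (i * K%:Z + xi%:Z) = inp W_ j i]].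

Definition ready (s : state) : Prop :=
  [/\ consts_of s, reg s rxi = xi%:Z,
    forall j : nat, (j < 2 * m)%N ->
      arr s 5 j%:Z = (index (nth 0%N (ends E) j) (verts E))%:Z
  & forall j : nat, (j < m)%N -> arr s 2 j%:Z = rwt E j].

Lemma ready_built s0 s j : ready s0 -> built s0 s j -> ready s.
Proof.
move=> [C xE A5 A2] [R A _]; split.
- by case: C => *; split; rewrite R.
- by rewrite R.
- by move=> j' jm; rewrite A // A5.
- by move=> j' jm; rewrite A // A2.
Qed.

Definition fresh (s : state) (v : nat) : Prop :=
  forall a z, (6 <= a)%N -> v%:Z <= modz z K%:Z -> arr s a z = 0.

Lemma gTH_lt j : (j < gM n k m)%N ->
  (gT n k m (rtl E) j < gN n k)%N /\ (gH n k m (rhd E) j < gN n k)%N.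
Proof.
move=> jM; have jP := gedgeP R0 (rtl E) (rhd E) (rwt E) tst n_gt0 k_gt0 jM.
have /andP[] := gedge_lt n_gt0 k_gt0 (fun e em => rtl_lt em) (fun e em => rhd_lt em) jP.
by lia.
Qed.

Lemma W_bounds j : (j < gM n k m)%N -> 0 <= W_ j <= (2 * gX n k R0)%N%:Z.
Proof.
by move=> jM; apply: gW_bounds => //; [exact: n_gt0 | exact: rtl_lt | exact: rwt_le].
Qed.

Lemma build_ok s0 : ready s0 -> fresh s0 xi ->
  wp B (forE rj $rM (edge_body k))
    ((gM n k m).+1 * (tcost (edge_body k) + ecost $rM + 20))
    (fun s => built s0 s (gM n k m)) s0.
Proof.
move=> Rd fr; have Bp := B_gt0; have [BK BK'] := B_facts; have Kp := K_gt0.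
have [F1 F2 F3 F4 F5] := size_facts.
have calc_ok := edge_calc_ok.
have K0 : K%:Z != 0 by lia.
pose I j s := built s0 s j /\ reg s rj = j%:Z.
apply: (wp_for Bp (I := I)) => //; first by clear HB; lia.
- move=> j s _ [bs jE]; have [C _ _ _] := ready_built Rd bs.
  by clear HB; split => //=; rewrite (c_M C); lia.
- move=> j s jM [bs jE]; have [C xE A5 A2] := ready_built Rd bs.
  apply: wp_static; first exact: loopfree_edge_body.
  have [T HT] := calc_ok _ _ C xE A5 A2 jE jM.
  have jK : (j * K <= gM n k m * K)%N by rewrite leq_mul2r (ltnW jM) orbT.
  have [bT bH] := gTH_lt jM; have bW := W_bounds jM; clear HB.
  eexists; apply: wp_seq; apply: wp_weaken HT (leqnn _) _ => s1 [[S1 S2] tE hE wE].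
  have r1 : reg s1 rj = j%:Z by rewrite S1.
  have r2 : reg s1 rK = K%:Z by rewrite S1 // (c_K C).
  have r3 : reg s1 rxi = xi%:Z by rewrite S1.
  have gNB : (gN n k < B)%N by rewrite /gN; lia.
  have sc : [/\ [/\ `|j%:Z| <= B%:Z, `|K%:Z| <= B%:Z & `|j%:Z * K%:Z| <= B%:Z],
      `|xi%:Z| <= B%:Z & `|j%:Z * K%:Z + xi%:Z| <= B%:Z].
    by split; [split; lia | lia | lia].
  apply: wp_seq; apply: (wp_store Bp) => //=; rewrite ?r1 ?r2 ?r3 ?tE //; first by lia.
  apply: wp_seq; apply: (wp_store Bp) => //=; rewrite ?r1 ?r2 ?r3 ?hE //; first by lia.
  apply: (wp_store Bp) => //=; rewrite ?r1 ?r2 ?r3 ?wE //; first by lia.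
  have cm : modz (j%:Z * K%:Z + xi%:Z) K%:Z = xi%:Z by exact: modz_cell.
  have cE (i : int) : (i * K%:Z + xi%:Z == j%:Z * K%:Z + xi%:Z) = (i == j%:Z).
    by rewrite (inj_eq (addIr _)) (inj_eq (mulIf K0)).
  case: bs => bR bA bC; split => //; split => //; split.
  + move=> x xN; have := xN; rewrite in_cons negb_or => /andP[xj xs] /=.
    by rewrite (negbTE xj) S1 // bR.
  + move=> a z az /=.
    case: ifP => [/andP[/eqP aE /eqP zE]|_]; first by move: az; rewrite aE zE cm eqxx.
    case: ifP => [/andP[/eqP aE /eqP zE]|_]; first by move: az; rewrite aE zE cm eqxx.
    case: ifP => [/andP[/eqP aE /eqP zE]|_]; first by move: az; rewrite aE zE cm eqxx.
    by rewrite S2 // bA.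
  + move=> i; have [c1 c2 c3] := bC i.
    by split; rewrite /= cE inpS; case: eqP => // _; rewrite S2.
- split => //; split => //.
  + by move=> x; rewrite in_cons negb_or => /andP[xj _] /=; rewrite (negbTE xj).
  + move=> i; rewrite !inp0; have cm : modz (i * K%:Z + xi%:Z) K%:Z = xi%:Z by exact: modz_cell.
    by split; rewrite /= fr // cm.
- by move=> s [].
Qed.

Variables (P : com) (TF : nat).
Hypothesis HB0 : (gN n k + gM n k m + 2 * gX n k R0 <= B0)%N.

Lemma input_F : [/\ forall i, arr (input F_) 0 i = inp T_ (gM n k m) i,
  forall i, arr (input F_) 1 i = inp H_ (gM n k m) i
  & forall i, arr (input F_) 2 i = inp W_ (gM n k m) i].
Proof.
have nthE (f : nat -> int) (g : 'I_(gN n k) * 'I_(gN n k) * int -> int) j :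
    (forall j, (j < gM n k m)%N -> g (gedge n k m R0 (rtl E) (rhd E) (rwt E) tst j) = f j) ->
    nth 0 [seq g e | e <- F_] j = if (j < gM n k m)%N then f j else 0.
  move=> fg; case: ifP => jM; last by rewrite nth_default // size_map size_gF leqNgt jM.
  by rewrite /gF /mkseq -map_comp (nth_map 0%N) ?size_iota // nth_iota // add0n /= fg.
split.
- case=> [j|j] //; apply: (nthE T_ (fun e => (nat_of_ord e.1.1)%:Z)) => j' jM /=.
  by have [t1 t2] := gTH_lt jM; rewrite inordK.
- case=> [j|j] //; apply: (nthE H_ (fun e => (nat_of_ord e.1.2)%:Z)) => j' jM /=.
  by have [t1 t2] := gTH_lt jM; rewrite inordK.
- by case=> [j|j] //; apply: (nthE W_ (fun e => e.2)).
Qed.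

Lemma input_F_bounded : bounded B0 (input F_).
Proof.
have [i0 i1 i2] := input_F.
split => [[|[|x]]|[|[|[|a]]] i]; rewrite ?i0 ?i1 ?i2.
- by rewrite /=; lia.
- by rewrite /= size_gF; lia.
- by rewrite /=; lia.
- by case: i => [j|j] /=; [case: ifP => [/gTH_lt|_] | ]; lia.
- by case: i => [j|j] /=; [case: ifP => [/gTH_lt|_] | ]; lia.
- by case: i => [j|j] /=; [case: ifP => [/W_bounds|_] | ]; lia.
- by rewrite /=; lia.
Qed.

(** The arrays 6 and 8 represent the registers 0 and 1 of the simulated program, which expect the
    numbers of nodes and edges; register 0 also returns the radius. *)
Definition config : com :=
  forE rj $rM (edge_body k);;
  store 6 $rxi (#(k.+1%:Z) *e $rc +e #4);; store 8 $rxi $rM;;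
  sim 6 rxi rK P;;
  ifE (ERead 6 $rxi <e $rbest) (assign rbest (ERead 6 $rxi)) Skip.

Lemma config_ok s0 (best r : int) : ready s0 -> fresh s0 xi ->
  reg s0 rbest = best -> 0 <= best <= (2 * gX n k R0)%N%:Z ->
  radius F_ = r%:E%E -> 0 <= r <= (2 * gX n k R0)%N%:Z ->
  (exists t s', [/\ exec B0 P (input F_) t s', (t <= TF)%N & radius_output F_ s']) ->
  wp B config ((gM n k m).+1 * (tcost (edge_body k) + 22) + 20 * TF + 40)
    (fun s => [/\ forall x, x \notin rbest :: work_regs -> reg s x = reg s0 x,
      forall a z, (a < 6)%N || (modz z K%:Z != xi%:Z) -> arr s a z = arr s0 a z
      & reg s rbest = Order.min best r]) s0.
Proof.
move=> Rd fr bE bb rE rb1 [t [s' [X tT out]]].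
have Bp := B_gt0; have [BK BK'] := B_facts; have Kp := K_gt0.
have [F1 F2 F3 F4 F5] := size_facts.
have out0 : reg s' 0 = r by move: out; rewrite /radius_output rE.
have B0p : (0 < B0)%N by move: HB0; rewrite /gN; lia.
have [i0 i1 i2] := input_F; have bF := input_F_bounded.
have xm : modz xi%:Z K%:Z = xi%:Z by rewrite modz_nat modn_small.
apply: (wp_weaken _ _ (fun s' q => q)); first apply: wp_seq.
- apply: wp_weaken (build_ok Rd fr) (leqnn _) _ => s1 bs1.
  have [C xE A5 A2] := ready_built Rd bs1; have [bR bA bC] := bs1.
  apply: wp_seq; apply: (wp_store Bp) => //=; rewrite ?xE ?(c_n C); try (clear HB; lia).
    by clear HB; split; [split; lia | lia | lia].
  apply: wp_seq; apply: (wp_store Bp) => //=; rewrite ?xE ?(c_M C); try (clear HB; lia).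
  set s2 := set_arr _ 8 _ _.
  have s2f a z : (a \notin [:: 6; 7; 8; 9; 11]) || (modz z K%:Z != xi%:Z) ->
      arr s2 a z = arr s0 a z.
    move=> az /=.
    case: ifP => [/andP[/eqP aE /eqP zE]|_]; first by move: az; rewrite aE zE xm eqxx.
    case: ifP => [/andP[/eqP aE /eqP zE]|_]; first by move: az; rewrite aE zE xm eqxx.
    apply: bA; case/orP: az => [az|->]; last by rewrite orbT.
    by apply/orP; left; apply: contra az; rewrite !inE => /or3P[] ->; rewrite ?orbT.
  (* Cells that the construction did not write are 0 by freshness, as [input] demands. *)
  have rel : simrel 6 xi K s2 s2 (input F_).
    split => //.
    + case=> [|[|x]] /=.
      * by rewrite eqxx /= /gN; clear HB; lia.
      * by rewrite eqxx /= size_gF.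
      * rewrite bA; first by rewrite fr // xm.
        by rewrite xm eqxx orbF !inE; clear HB; lia.
    + move=> [|[|[|a]]] i.
      * by rewrite i0; have [<- _ _] := bC i.
      * by rewrite i1; have [_ <- _] := bC i.
      * by rewrite i2; have [_ _ <-] := bC i.
      * have cm : modz (i * K%:Z + xi%:Z) K%:Z = xi%:Z by exact: modz_cell.
        rewrite s2f; first by rewrite fr // cm.
        by rewrite cm eqxx orbF !inE; clear HB; lia.
  apply: wp_seq; apply: (wp_weaken (sim_exec (isT : (rxi < tb)%N) (isT : (rK < tb)%N)
    B0p _ xiK (_ : reg s2 rxi = xi%:Z) (_ : reg s2 rK = K%:Z) X bF rel)).
  + by clear HB; lia.
  + by [].
  + exact: (c_K C).
  + exact: leqnn.
  move=> s3 [R3 R0' _ A3].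
  have b3 : reg s3 rbest = best by rewrite R3 -bE -bR.
  have x3 : reg s3 rxi = xi%:Z by rewrite R3.
  have r3 : arr s3 6 xi%:Z = r by have := R0' 0%N; rewrite addn0 out0.
  have regs x : x \notin rbest :: work_regs -> reg s3 x = reg s0 x.
    by rewrite in_cons negb_or => /andP[_ xN]; rewrite R3 -bR.
  have arrs a z : (a < 6)%N || (modz z K%:Z != xi%:Z) -> arr s3 a z = arr s0 a z.
    move=> az; rewrite A3 // s2f //; case/orP: az => [a6|->]; last by rewrite orbT.
    by rewrite !inE; apply/orP; left; clear HB; lia.
  apply: (wp_if2 Bp) => //=; rewrite ?x3 ?r3 ?b3.
  + by clear HB; split; [lia | lia | case: ltP => /= _; lia].
  + move=> lt; have {}lt : r < best by move: lt; case: ltP.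
    apply: (wp_assign Bp) => //=; rewrite ?x3 ?r3; try (clear HB; lia).
    split => //=; last by apply/esym/min_r/ltW.
    by move=> x xN; have := xN; rewrite in_cons negb_or => /andP[xb _]; rewrite (negbTE xb) regs.
  + move=> ge; have {}ge : best <= r by move: ge; case: ltP.
    by apply: wp_skip; split => //; rewrite b3 min_l.
- by rewrite /=; clear HB; lia.
Qed.

End Config.
Variables (P : com) (TF : nat).
Hypothesis HB0 : (gN n k + gM n k m + 2 * gX n k R0 <= B0)%N.
Local Notation F_ xi := (gF n k m R0 (rtl E) (rhd E) (rwt E) (coloured k b xi)).
Local Notation walk xi := (closed_walk k m (rtl E) (rhd E) (coloured k b xi)).
Local Notation value es := ((k * gY n k R0)%N%:Z + walk_cost n k (rtl E) (rwt E) es).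
Hypothesis HP : forall xi,
  exists t s', [/\ exec B0 P (input (F_ xi)) t s', (t <= TF)%N
    & radius_output (F_ xi) s'].

(** The start value [2 * gX] exceeds all walk values, so equality with it means that no colouring
    below [v] admits a walk. *)
Definition optimal (v : nat) (best : int) : Prop :=
  [/\ 0 <= best <= (2 * gX n k R0)%N%:Z,
      forall xi es, (xi < v)%N -> walk xi es -> best <= value es
    & best < (2 * gX n k R0)%N%:Z -> exists xi es, walk xi es /\ best = value es].

Lemma main_loop_ok s0 : consts_of s0 ->
  (forall j : nat, (j < 2 * m)%N ->
    arr s0 5 j%:Z = (index (nth 0%N (ends E) j) (verts E))%:Z) ->
  (forall j : nat, (j < m)%N -> arr s0 2 j%:Z = rwt E j) ->
  (forall a z, (6 <= a)%N -> arr s0 a z = 0) ->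
  reg s0 rbest = (2 * gX n k R0)%N%:Z ->
  wp B (forE rxi $rK (config P))
    (K.+1 * ((gM n k m).+1 * (tcost (edge_body k) + 22) + 20 * TF + 40 + ecost $rK + 20))
    (fun s => [/\ consts_of s, forall a z, (a < 6)%N -> arr s a z = arr s0 a z
      & optimal K (reg s rbest)]) s0.
Proof.
move=> C A5 A2 fr bE; have Bp := B_gt0; have [BK BK'] := B_facts; have Kp := K_gt0.
pose I v s := [/\ forall x, x \notin rxi :: rbest :: work_regs -> reg s x = reg s0 x,
  forall a z, (a < 6)%N -> arr s a z = arr s0 a z, fresh s v, reg s rxi = v%:Z
  & optimal v (reg s rbest)].
have IC v s : I v s -> consts_of s.
  by case=> R _ _ _ _; case: C => *; split; rewrite R.
apply: (wp_for Bp (I := I)) => //; first by clear HB; lia.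
- by move=> v s _ Iv; have C1 := IC _ _ Iv; case: Iv => *; split => //=; rewrite (c_K C1) //; clear HB; lia.
- move=> v s vK Iv; have C1 := IC _ _ Iv; case: Iv => R A Fr xE [bb bw be].
  have Rd : ready v s by split => // j jm; rewrite A // ?A5 ?A2.
  have [r [rE rb1 rw re]] := gadget_radius (coloured k b v) n_gt0 k_gt0
    (fun e em => rtl_lt em) (fun e em => rhd_lt em) rwt_le (r_inj E_simple).
  apply: wp_weaken (config_ok vK HB0 Rd Fr erefl bb rE rb1 (HP v)) (leqnn _) _.
  move=> s1 [R1 A1 b1].
  have x1 : reg s1 rxi = v%:Z by rewrite R1.
  split => //; split => //=.
  + move=> x; rewrite in_cons negb_or => /andP[xx xN]; rewrite (negbTE xx) R1 // R //.
    by rewrite in_cons negb_or xx.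
  + by move=> a z a6; rewrite A1 ?a6 // A.
  + move=> a z a6 zv; rewrite A1; first by apply: Fr => //; clear HB; lia.
    by apply/orP; right; apply/eqP; clear HB; lia.
  + rewrite b1; split.
    * by case: leP; clear HB; lia.
    * move=> xi es; rewrite ltnS leq_eqVlt => /predU1P[->|xv] W.
        by rewrite ge_min rw // orbT.
      by rewrite ge_min (bw _ _ xv W).
    * case: (leP (reg s rbest) r) => _; first exact: be.
      move=> r2; have [es W le] := re r2; exists v, es; split => //.
      by apply/eqP; rewrite eq_le le andbT rw.
- split => //=.
  + by move=> x; rewrite in_cons negb_or => /andP[/negbTE ->].
  + by move=> a z a6 _; exact: fr.
  + by rewrite bE; split => //; clear HB; lia.
- by move=> s Iv; have C1 := IC _ _ Iv; case: Iv.
Qed.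

Definition consts : com :=
  assign rb (#2 *e $rL);; assign rK (powE $rb (k * k));; assign rA (powE $rc k);;
  assign rOm (($rR +e #1) *e $rA);; assign rS (#((3 * k)%N%:Z) *e $rOm);;
  assign rP (#2 *e $rc *e $rS);; assign rY (#20 *e $rc *e $rS);;
  assign rX (#((10 * k)%N%:Z) *e $rc *e $rS +e #(k%:Z) *e $rOm);;
  assign rkY (#(k%:Z) *e $rY);; assign rQ ($rkY -e #(k%:Z) *e $rOm -e $rP);;
  assign rXX (#2 *e $rX);;
  assign rM ($rm *e #(k%:Z) +e $rc *e #((k + 4)%N%:Z) +e #1);;
  assign rbest $rXX.

Lemma consts_ok s0 : reg s0 rm = m%:Z -> reg s0 rc = n%:Z -> reg s0 rR = R0%:Z ->
  reg s0 rL = L%:Z ->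
  wp B consts (tcost consts) (fun s => [/\ consts_of s,
    reg s rbest = (2 * gX n k R0)%N%:Z & forall a z, arr s a z = arr s0 a z]) s0.
Proof.
move=> mE nE RE LE; have Bp := B_gt0; have [BK BK'] := B_facts; have Kp := K_gt0.
have np := n_gt0; have [F1 F2 F3 F4 F5] := size_facts; clear HB.
have Op : (0 < gOm n k R0)%N by exact: gOm_gt0.
have Sp : (0 < gS n k R0)%N by lia.
have X1 : (10 * k * n <= 10 * k * n * gS n k R0)%N by exact: leq_pmulr.
have X2 : (10 * k <= 10 * k * n)%N by exact: leq_pmulr.
have X3 : (10 * k * n * gS n k R0 + k * gOm n k R0 = gX n k R0)%N by [].
have n1 : (n <= n * gS n k R0)%N by exact: leq_pmulr.
have M1 : (m * k + n * (k + 4) + 1 = gM n k m)%N by [].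
have k4 : (k + 4 <= n * (k + 4))%N by exact: leq_pmull.
have O1 : (R0.+1 <= R0.+1 * gA n k)%N by rewrite leq_pmulr // expn_gt0 np.
have O2 : (R0.+1 * gA n k = gOm n k R0)%N by [].
apply: wp_static.
  by rewrite /consts /= !loopfree_cexpr.
eexists.
apply: wp_seq; apply: (wp_assignE (v := b%:Z)) => //=; rewrite ?LE; try lia; first by split; lia.
apply: wp_seq; apply: (wp_assignE (v := K%:Z)) => //; try lia.
- exact: lowe_powE.
- exact: eval_powE.
- by apply: (safe_powE Bp (x := b)) => //=; lia.
apply: wp_seq; apply: (wp_assignE (v := (gA n k)%:Z)) => //; try lia.
- exact: lowe_powE.
- exact: eval_powE.
- by apply: (safe_powE Bp (x := n)) => //=; rewrite ?nE // -/(gA n k); lia.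
apply: wp_seq; apply: (wp_assignE (v := (gOm n k R0)%:Z)) => //=; rewrite ?RE; try lia.
  by split; [split; lia | lia | lia].
apply: wp_seq; apply: (wp_assignE (v := (gS n k R0)%:Z)) => //=; try lia; first by split; lia.
apply: wp_seq; apply: (wp_assignE (v := (gP n k R0)%:Z)) => //=; rewrite ?nE; try lia.
  by split; [split; lia | lia | lia].
apply: wp_seq; apply: (wp_assignE (v := (gY n k R0)%:Z)) => //=; rewrite ?nE; try lia.
  by split; [split; lia | lia | lia].
apply: wp_seq; apply: (wp_assignE (v := (gX n k R0)%:Z)) => //=; rewrite ?nE; try lia.
  by split; [split; [split; lia | lia | lia] | split; lia | lia].
apply: wp_seq; apply: (wp_assignE (v := (k * gY n k R0)%N%:Z)) => //=; try lia.
  by split; lia.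
apply: wp_seq; apply: (wp_assignE (v := (gQ n k R0)%:Z)) => //=; try lia.
  by split; [split; [lia | split; lia | lia] | lia | lia].
apply: wp_seq; apply: (wp_assignE (v := (2 * gX n k R0)%N%:Z)) => //=; try lia.
  by split; lia.
apply: wp_seq; apply: (wp_assignE (v := (gM n k m)%:Z)) => //=; rewrite ?nE ?mE; try lia.
  by split; [split; [split; lia | split; lia | lia] | lia | lia].
by apply: (wp_assignE (v := (2 * gX n k R0)%N%:Z)) => //=; try lia; split.
Qed.

Definition decode_body : com :=
  store 0 $rj (ERead 4 ($ru %e $rc));; assign ru ($ru /e $rc).
Definition decode : com :=
  assign ru (($rbest -e $rkY) %e $rA);; forE rj #(k%:Z) decode_body.
Definition finish : com :=
  ifE ($rbest <e $rXX) (decode;; assign 0 #1) (assign 0 #0).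

Lemma decode_ok s0 w code : consts_of s0 -> (code < gA n k)%N ->
  `|reg s0 rbest| <= (2 * gX n k R0)%N%:Z ->
  reg s0 rbest = (k * gY n k R0)%N%:Z + (w * (gA n k)%:Z + code%:Z) ->
  wp B decode (ecost (($rbest -e $rkY) %e $rA) + 2
      + k.+1 * (tcost decode_body + ecost #(k%:Z) + 20))
    (fun s => forall i : nat, (i < k)%N -> arr s 0 i%:Z = arr s0 4 (digit n i code)%:Z) s0.
Proof.
move=> C cA bb bE; have Bp := B_gt0; have [BK BK'] := B_facts; have Kp := K_gt0.
have np := n_gt0; have [F1 F2 F3 F4 F5] := size_facts; clear HB.
(* [modz] returns the nonnegative remainder, so the code is recovered even from a negative weight
   [w]. *)
have dE : modz (reg s0 rbest - reg s0 rkY) (reg s0 rA) = code%:Z.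
  rewrite bE (c_kY C) (c_A C) addrAC subrr add0r modzMDl modz_nat modn_small //.
apply: wp_seq; apply: (wp_assignE (v := code%:Z)) => //=; try lia.
  rewrite dE (c_kY C) (c_A C); split; [split; lia | lia | lia].
pose I j s := [/\ consts_of s, reg s rj = j%:Z,
  exists2 y : nat, reg s ru = y%:Z & y = iter j (divn^~ n) code /\ (y <= code)%N,
  forall z, arr s 4 z = arr s0 4 z
  & forall i : nat, (i < j)%N -> arr s 0 i%:Z = arr s0 4 (digit n i code)%:Z].
apply: (wp_for Bp (I := I)) => //; first by lia.
- by move=> j s _ [] *; split => //=; lia.
- move=> j s jk [C1 jE [y uE [yE yc]] A4 A0]; apply: wp_static; first by [].
  have ydn := leq_div y n; have ymn := leq_mod y n.
  have nB : (n < B)%N by lia.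
  eexists; apply: wp_seq; apply: (wp_store Bp) => //=; rewrite ?jE ?uE ?(c_n C1) ?modz_nat; try lia.
    by split; [lia | lia | move: (y %% n)%N ymn => y' ?; lia].
  apply: (wp_assignE (v := (y %/ n)%N%:Z)) => //=; rewrite ?uE ?(c_n C1) ?divz_nat //.
  + by split; [lia | lia | move: (y %/ n)%N ydn => y' ?; lia].
  + by move: (y %/ n)%N ydn => y' ?; lia.
  split => //; split => //=.
  + by case: C1 => *; split.
  + exists (y %/ n)%N => //; split; first by rewrite yE.
    exact: leq_trans ydn yc.
  + move=> i; rewrite ltnS leq_eqVlt eqz_nat => /predU1P[->|ij].
      by rewrite eqxx A4 /digit -yE.
    by rewrite (_ : (i == j) = false) ?A0 //; lia.
- split => //=.
  + by case: C => *; split.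
  + by exists code.
- by move=> s [].
Qed.

(** The codes are too small to outweigh a difference of 1 in the weight, so an optimal encoded cost
    has optimal weight. *)
Lemma lex_le (w w' : int) (x x' a y : nat) : (x < a)%N -> (x' < a)%N ->
  y%:Z + (w * a%:Z + x%:Z) <= y%:Z + (w' * a%:Z + x'%:Z) -> w <= w'.
Proof. clear; nia. Qed.

Lemma finish_ok s0 : consts_of s0 -> optimal K (reg s0 rbest) ->
  (forall i : nat, (i < n)%N -> arr s0 4 i%:Z = (nth 0%N (verts E) i)%:Z) ->
  wp B finish (ecost ($rbest <e $rXX) + (ecost (($rbest -e $rkY) %e $rA) + 2
      + k.+1 * (tcost decode_body + ecost #(k%:Z) + 20) + (ecost #1 + 2)
      + (ecost #0 + 2)).+1)
    (kcycle_output k E) s0.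
Proof.
move=> C [bb bw be] A4; have Bp := B_gt0; have np := n_gt0.
have [BK BK'] := B_facts.
apply: (wp_if2 Bp) => //=.
- by rewrite (c_XX C); clear HB; split; [lia | lia | case: ltP => /= _; lia].
- rewrite (c_XX C) => lt; have {}lt : reg s0 rbest < (2 * gX n k R0)%N%:Z by move: lt; case: ltP.
  have [xi [es [W bE]]] := be lt.
  have em i : (i < k)%N -> (es i < m)%N by move=> /W[].
  have [cA dig] := wcode_digits np em.
  have [c [kc cw ct]] := walk_kcycle E_simple k_gt0 W.
  rewrite walk_costE in bE.
  apply: wp_seq; apply: wp_weaken (decode_ok C cA _ bE) (leqnn _) _; first by clear HB; lia.
  move=> s1 O1; apply: (wp_assignE (v := 1)) => //=; try (clear HB; lia).
  right; split => //; exists c; last first.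
    by move=> i; rewrite /= O1 // dig // A4 ?rtl_lt ?em // ct.
  split => // c' kc'; have [xi' [es' [xK W' sE]]] := kcycle_walk E_simple k_gt0 L_gt0 nL kc'.
  have em' i : (i < k)%N -> (es' i < m)%N by move=> /W'[].
  have [cA' _] := wcode_digits np em'.
  have := bw _ _ xK W'; rewrite bE walk_costE cw -sE.
  move: cA cA'; rewrite -[(n ^ k)%N]/(gA n k).
  exact: lex_le.
- rewrite (c_XX C) => ge; have {}ge : (2 * gX n k R0)%N%:Z <= reg s0 rbest by move: ge; case: ltP.
  apply: (wp_assignE (v := 0)) => //=.
  left; split => // c; apply/negP => kc.
  have [xi' [es' [xK W' sE]]] := kcycle_walk E_simple k_gt0 L_gt0 nL kc.
  have := bw _ _ xK W'.
  (* The value of a walk is at most [k * gY + k * gOm], strictly below [2 * gX]. *)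
  have := walk_cost_le n_gt0 k_gt0 (fun e em => rtl_lt em) rwt_le W'.
  have Op : (0 < gOm n k R0)%N by exact: gOm_gt0.
  have [F1 F2 F3 F4 F5] := size_facts.
  by clear HB; lia.
Qed.

End Main.

(** The edgeless case is answered at once, because the construction needs a non-isolated vertex. *)
Definition prog (k : nat) (P : com) : com :=
  ifE ($rm =e #0) (assign 0 #0)
    (relabel;; sqsum;; bits;; consts k;; forE rxi $rK (config k P);; finish k).

Definition Ccfg (k : nat) : nat := tcost (edge_body k) + 22.
Definition Cfin (k : nat) : nat :=
  ecost ($rbest <e $rXX) + (ecost (($rbest -e $rkY) %e $rA) + 2
    + k.+1 * (tcost decode_body + ecost #(k%:Z) + 20) + (ecost #1 + 2)
    + (ecost #0 + 2)).+1.
Definition Crel : nat := tcost relabel_body + ecost (#2 *e $rm) + 20.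
Definition Csq : nat := tcost sqsum_body + ecost $rm + 20.
Definition Cbits : nat := tcost bits_body + ecost $rc + 20.

Definition total_time (k n m K M TF : nat) : nat :=
  (10 + (2 * m).+1 * Crel + m.+1 * Csq + n.+1 * Cbits + tcost (consts k)
   + K.+1 * (M.+1 * Ccfg k + 20 * TF + 62) + Cfin k)%N.

Lemma prog_empty_ok (n0 k : nat) (E : edges n0) B P : (0 < B)%N -> (0 < k)%N ->
  size E = 0%N -> wp B (prog k P) 20 (kcycle_output k E) (input E).
Proof.
move=> Bp k0 E0; apply: (wp_weaken _ _ (fun s' q => q)).
  apply: (wp_if2 Bp (T2 := 0%N)) => //.
  - by rewrite /= E0; split => //=; lia.
  - move=> _; apply: (wp_assign Bp) => //.
    left; split => // c; apply/negP => /andP[cy _].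
    have /(cycleP _ _ (tnth c (Ordinal k0))) := cy.
    move=> /(_ 0%N); rewrite size_tuple => /(_ k0) /mapP[e].
    by move/size0nil: E0 => ->.
  - by rewrite /= E0.
by [].
Qed.

Lemma prog_ok (n0 k : nat) (E : edges n0) B B0 P TF :
  let n := size (verts E) in let m := size E in let R0 := sq_total E in
  (0 < k)%N -> (0 < m)%N -> simple_digraph E ->
  (forall L, (0 < L <= log_pos n)%N ->
    (n0 + 2 * m + R0 + 8 * gX n k R0 + 2 * L
      + (gM n k m + B0 + 20) * ((2 * L) ^ (k * k)).+1 + 20 < B)%N) ->
  (gN n k + gM n k m + 2 * gX n k R0 <= B0)%N ->
  (forall tst, exists t s',
    let F := gF n k m R0 (rtl E) (rhd E) (rwt E) tst in
    [/\ exec B0 P (input F) t s', (t <= TF)%N & radius_output F s']) ->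
  wp B (prog k P)
    (total_time k n m ((2 * log_pos n) ^ (k * k)) (gM n k m) TF)
    (kcycle_output k E) (input E).
Proof.
move=> n m R0 k0 m0 sE HB HB0 HP.
have np : (0 < n)%N by exact: size_verts_gt0.
have [HB1 R0B] : (n0 + 2 * m + 2 < B)%N /\ (R0 < B)%N.
  by have := HB 1%N isT; move: (_ * _.+1)%N => ?; lia.
have Bp : (0 < B)%N by lia.
apply: (wp_weaken _ _ (fun s' q => q)).
  apply: (wp_if2 Bp (T1 := 0%N)) => //=.
  - by split; [lia | lia | case: eqP => /= _; lia].
  - by rewrite (_ : (size E)%:Z == 0 = false) //; apply/eqP; lia.
  move=> _; apply: wp_seq.
  apply: wp_weaken (relabel_ok Bp HB1 (fun=> erefl) (fun _ _ => erefl)) (leqnn _) _.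
  move=> s1 [[S1 S1'] c1 A4 A5]; apply: wp_seq.
  apply: wp_weaken (sqsum_ok Bp HB1 R0B _ _ _) (leqnn _) _; rewrite ?S1 //.
    by move=> i; rewrite S1'.
  move=> s2 [[S2 S2'] RE]; apply: wp_seq.
  apply: wp_weaken (bits_ok Bp HB1 np _ _) (leqnn _) _.
  - by rewrite S2.
  - by rewrite S2 // S1.
  move=> s3 [[S3 S3'] [L [LE /andP[L0 Ll] nL]]].
  have HBL := HB L; rewrite L0 Ll in HBL; have {}HBL := HBL isT.
  apply: wp_seq.
  apply: wp_weaken (consts_ok k0 m0 L0 sE nL HBL HB0 _ _ _ LE) (leqnn _) _.
  - by rewrite S3 // S2 // S1.
  - by rewrite S3 // S2.
  - by rewrite S3.
  move=> s4 [C4 b4 A_4].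
  have arrs a z : a \notin [:: 3; 4; 5] -> arr s4 a z = arr (input E) a z.
    by move=> aN; rewrite A_4 S3' // S2' // S1'.
  apply: wp_seq.
  have KK : ((2 * L) ^ (k * k) <= (2 * log_pos n) ^ (k * k))%N.
    by rewrite leq_exp2r ?muln_gt0 ?k0 // leq_mul2l.
  apply: (wp_weaken (T := (((2 * L) ^ (k * k)).+1 * ((gM n k m).+1 * (tcost (edge_body k) + 22) + 20 * TF + 40 + ecost $rK + 20))%N)
    (T' := (((2 * log_pos n) ^ (k * k)).+1 * ((gM n k m).+1 * (tcost (edge_body k) + 22) + 20 * TF + 40 + ecost $rK + 20))%N)
    (main_loop_ok k0 m0 L0 sE nL HBL HB0 (fun xi => HP _) C4 _ _ _ b4)).
  - by move=> j jm; rewrite A_4 S3' // S2' // A5.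
  - move=> j jm; rewrite arrs //=; by [].
  - by move=> a z a6; rewrite arrs /= ?inE; [case: a a6 => [|[|[|a]]] | lia].
  - by rewrite leq_mul2r ltnS KK orbT.
  move=> s5 [C5 A_5 opt].
  apply: (finish_ok k0 m0 L0 sE nL HBL HB0 C5 opt).
  by move=> i ilt; rewrite A_5 // A_4 S3' // S2' // A4.
by rewrite /total_time /Ccfg /Cfin /Crel /Csq /Cbits /=; lia.
Qed.

(** * Word length and running time *)

Section Polynomial.
Variable V : nat.
Hypothesis V_ge2 : (2 <= V)%N.

Lemma leV_const c : (c <= V ^ c)%N.
Proof.
apply: leq_trans (ltnW (ltn_expl c (isT : (1 < 2)%N))) _.
by case: c => // c; rewrite leq_exp2r.
Qed.

Lemma leV_mul x y a b : (x <= V ^ a -> y <= V ^ b -> x * y <= V ^ (a + b))%N.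
Proof. by move=> xa yb; rewrite expnD; exact: leq_mul. Qed.

Lemma leV_add x y a b : (x <= V ^ a -> y <= V ^ b -> x + y <= V ^ (a + b + 1))%N.
Proof.
move=> xa yb; have Vp d : (0 < V ^ d)%N by rewrite expn_gt0; lia.
have e1 : (V ^ a <= V ^ (a + b))%N by rewrite expnD leq_pmulr.
have e2 : (V ^ b <= V ^ (a + b))%N by rewrite expnD leq_pmull.
rewrite addn1 expnS; apply: (@leq_trans (2 * V ^ (a + b))); last by rewrite leq_mul2r V_ge2 orbT.
by move: (V ^ a)%N (V ^ b)%N (V ^ (a + b))%N xa yb e1 e2; lia.
Qed.

Lemma leV_exp x a d : (x <= V ^ a -> x ^ d <= V ^ (a * d))%N.
Proof. by move=> xa; rewrite expnM; case: d => // d; rewrite leq_exp2r. Qed.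

Lemma leV_S x a : (x <= V ^ a -> x.+1 <= V ^ a.+1)%N.
Proof.
move=> xa; rewrite expnS; have : (0 < V ^ a)%N by rewrite expn_gt0; lia.
have : (2 * V ^ a <= V * V ^ a)%N by rewrite leq_mul2r V_ge2 orbT.
by move: (V * V ^ a)%N (V ^ a)%N xa; lia.
Qed.

End Polynomial.

(* [n], [r] and [L] stand for the number of non-isolated vertices, the sum of
   the squared weights and the number of bits. *)
Lemma word_bound_suffices (k bw : nat) : exists b', forall n0 m R n r L,
  (n <= n0)%N -> (r <= m * (R * R))%N -> (L <= n0)%N ->
  (n0 + 2 * m + r + 8 * gX n k r + 2 * L
    + (gM n k m + word_bound bw.+1 (gN n k) (gM n k m) (2 * gX n k r) + 20)
      * ((2 * L) ^ (k * k)).+1 + 20 < word_bound b' n0 m R)%N.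
Proof.
(* The exponent stays open and is assembled from [k] and [bw] by recursion on the expression to be
   bounded. *)
eexists => n0 m R n r L nn rm Ln.
rewrite /word_bound /gN /gX /gS /gOm /gA /gM.
set V := (n0 + m + R + 2)%N.
have V2 : (2 <= V)%N by rewrite /V; lia.
have hn0 : (n0 <= V ^ 1)%N by rewrite expn1 /V; lia.
have hm : (m <= V ^ 1)%N by rewrite expn1 /V; lia.
have hR : (R <= V ^ 1)%N by rewrite expn1 /V; lia.
have hn : (n <= V ^ 1)%N by apply: leq_trans hn0.
have hL : (L <= V ^ 1)%N by apply: leq_trans hn0.
have hr : (r <= V ^ (1 + (1 + 1)))%N.
  by apply: leq_trans rm _; do ![apply: leV_mul => //].
clearbody V.
clear nn rm Ln.
repeat lazymatch goal with
  | |- is_true (leq n0 _) => exact: hn0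
  | |- is_true (leq m _) => exact: hm
  | |- is_true (leq n _) => exact: hn
  | |- is_true (leq L _) => exact: hL
  | |- is_true (leq r _) => exact: hr
  | |- is_true (leq (addn _ _) _) => apply: (leV_add V2)
  | |- is_true (leq (muln _ _) _) => apply: leV_mul
  | |- is_true (leq (expn _ _) _) => apply: leV_exp
  | |- is_true (leq _ _) => first [exact: (leV_const V2) | apply: (leV_S V2)]
  end.
Qed.

Lemma split_product a b c l G : ((a + b * c) * l * G = a * (l * G) + b * l * (c * G))%N.
Proof. by rewrite -mulnA mulnDl -!mulnA (mulnCA c). Qed.

Lemma sum_le x y z A B C t a b c G Z :
  (A <= a * G -> B <= b * G -> C <= c * G -> x + y + z <= (x + y + z) * G ->
   t <= Z -> x + A + B + C + y + t + z <= (x + a + b + c + y + z) * G + Z)%N.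
Proof.
rewrite !mulnDl; move: (a * G)%N (b * G)%N (c * G)%N (x * G)%N (y * G)%N (z * G)%N.
by lia.
Qed.

(** The relabelling pays off here: by [n <= 2 * m] all terms linear in [n] are absorbed by [m], and
    [n0] enters only through its logarithm. *)
Lemma total_time_le (k n n0 m TF G : nat) :
  (n <= n0)%N -> (n <= 2 * m)%N -> (TF <= G)%N -> (m + 1 <= G)%N ->
  (total_time k n m ((2 * log_pos n) ^ (k * k)) (gM n k m) TF <=
   (10 + 2 * Crel + Csq + 2 * Cbits + tcost (consts k) + Cfin k
     + 2 ^ (k * k).+1 * ((3 * k + 10) * Ccfg k + 82))
   * log_pos n0 ^ (k * k) * G)%N.
Proof.
move=> nn nm TG mG; set lg := log_pos n0; set D := (k * k)%N.
have lg1 : (1 <= lg ^ D)%N by rewrite expn_gt0.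
have lgn : (log_pos n <= lg)%N by rewrite ltnS leq_trunc_log.
have K1 : (((2 * log_pos n) ^ D).+1 <= 2 ^ D.+1 * lg ^ D)%N.
  have a1 : ((2 * log_pos n) ^ D <= 2 ^ D * lg ^ D)%N.
    rewrite -expnMn; case: (D) => // d; by rewrite leq_exp2r // leq_mul2l lgn.
  have a2 : (1 <= 2 ^ D * lg ^ D)%N by rewrite muln_gt0 expn_gt0.
  rewrite expnS -mulnA; move: (2 ^ D * lg ^ D)%N a1 a2; lia.
have M1 : ((gM n k m).+1 <= (3 * k + 10) * G)%N.
  have mm : (m * (3 * k + 10) + (3 * k + 10) <= (3 * k + 10) * G)%N.
    by rewrite -mulSnr mulnC leq_mul2l; apply/orP; right; lia.
  have nk : (n * (k + 4) <= 2 * m * (k + 4))%N by rewrite leq_mul2r nm orbT.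
  by rewrite /gM; lia.
have in1 : ((gM n k m).+1 * Ccfg k + 20 * TF + 62 <= ((3 * k + 10) * Ccfg k + 82) * G)%N.
  have q1 := leq_mul M1 (leqnn (Ccfg k)); rewrite mulnAC in q1.
  have G1 : (1 <= G)%N by lia.
  by rewrite mulnDl; move: ((3 * k + 10) * Ccfg k * G)%N (_.+1 * Ccfg k)%N q1; lia.
have := leq_mul K1 in1; rewrite /total_time.
set t1 := (_.+1 * (_ * _ + _ + _))%N => k1.
rewrite split_product.
have gg : (G <= lg ^ D * G)%N by rewrite leq_pmull.
move: (lg ^ D * G)%N gg => G' gg.
have c1 : ((2 * m).+1 * Crel <= 2 * Crel * G')%N by rewrite mulnAC leq_mul2r; apply/orP; right; lia.
have c2 : (m.+1 * Csq <= Csq * G')%N by rewrite mulnC leq_mul2l; apply/orP; right; lia.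
have c3 : (n.+1 * Cbits <= 2 * Cbits * G')%N by rewrite mulnAC leq_mul2r; apply/orP; right; lia.
have c4 : (10 + tcost (consts k) + Cfin k <= (10 + tcost (consts k) + Cfin k) * G')%N.
  by rewrite leq_pmulr //; lia.
exact: (sum_le c1 c2 c3 c4 k1).
Qed.

Lemma sq_total_le (n0 : nat) (E : edges n0) R :
  weights_in E (- R%:Z) R%:Z -> (sq_total E <= size E * (R * R))%N.
Proof.
move=> /allP H; rewrite /sq_total -[X in (_ <= X * _)%N]card_ord -sum_nat_const.
apply: leq_sum => e _; rewrite -mulnn.
have le : (`|rwt E e| <= R)%N.
  have : rwt E e \in [seq e.2 | e <- E] by rewrite /rwt mem_nth // size_map.
  by case/mapP => -[[u v] w] /H /= hw ->; lia.
exact: leq_mul.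
Qed.

Lemma leq_bigO_args f c n m N M : (N <= c * n)%N -> (M <= c * m)%N ->
  (f N M <= bigO_args f c n m)%N.
Proof.
rewrite -[(N <= _)%N]ltnS -[(M <= _)%N]ltnS => Nn Mm.
rewrite /bigO_args.
have le1 := @leq_bigmax _ (fun N' : 'I_(c * n).+1 => \max_(M' < (c * m).+1) f N' M')%N (Ordinal Nn).
by apply: leq_trans le1; exact: (@leq_bigmax _ (fun M' : 'I_(c * m).+1 => f N M') (Ordinal Mm)).
Qed.

Lemma loweq_refl s : loweq s s. Proof. by []. Qed.

Theorem theoremB2 (f : nat -> nat -> nat) (k : nat) :
  (0 < k)%N ->
  radius_in_time f ->
  exists (c : nat) (g : nat -> nat -> nat -> nat),
    soft_O g (fun n m R => bigO_args f c n m * log_pos R + m)%N /\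
    kcycle_in_time k g.
Proof.
move=> k0 [P [bw HP]].
(* By [n <= 2 * m] and [0 < m], the instance has at most [m * k + 2 * m * (k + 4) + m] edges, and
   its at most [(k + 5) * n0] nodes are covered too. *)
pose c := (3 * k + 9)%N.
pose C0 := (10 + 2 * Crel + Csq + 2 * Cbits + tcost (consts k) + Cfin k
     + 2 ^ (k * k).+1 * ((3 * k + 10) * Ccfg k + 82))%N.
pose C := (C0 + 20)%N.
pose h n m R := (bigO_args f c n m * log_pos R + m)%N.
exists c, (fun n m R => C * log_pos n ^ (k * k) * (h n m R + 1))%N; split.
  by exists C, (k * k)%N.
have [b' Hb] := word_bound_suffices k bw.
exists (prog k P), b' => n0 E R sE wE.
have fin B T : wp B (prog k P) T (kcycle_output k E) (input E) ->
    (B = word_bound b' n0 (size E) R) ->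
    (T <= C * log_pos n0 ^ (k * k) * (h n0 (size E) R + 1))%N ->
    exists (t : nat) (s : state), [/\ exec (word_bound b' n0 (size E) R) (prog k P) (input E) t s,
      (t <= C * log_pos n0 ^ (k * k) * (h n0 (size E) R + 1))%N & kcycle_output k E s].
  move=> H <- TT; have [t [c1 [s1 [X tT [e1 e2] out]]]] := H _ (loweq_refl _).
  exists t, c1; split => //; first exact: leq_trans TT.
  case: out => [[o1 o2]|[o1 [d o2 o3]]]; [left | right]; rewrite e1 //; split => //.
  by exists d => // i; rewrite e2.
have lg1 : (1 <= log_pos n0 ^ (k * k))%N by rewrite expn_gt0.
have Bp : (0 < word_bound b' n0 (size E) R)%N by rewrite expn_gt0; lia.
case: (posnP (size E)) => [E0|m0].
  apply: fin (prog_empty_ok P Bp k0 E0) erefl _.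
  apply: (@leq_trans C); first by rewrite /C; lia.
  by rewrite -mulnA leq_pmulr // muln_gt0 lg1 addn1.
set n := size (verts E); set m := size E in m0 *; set r := sq_total E.
have np : (0 < n)%N by exact: size_verts_gt0.
have nn : (n <= n0)%N by exact: size_verts_le.
have nm : (n <= 2 * m)%N by exact: size_verts_le2.
(* The exponent is raised by one so that the input itself fits into the words even if [bw] is 0. *)
pose B0 := word_bound bw.+1 (gN n k) (gM n k m) (2 * gX n k r).
have B0E : (gN n k + gM n k m + 2 * gX n k r <= B0)%N.
  rewrite /B0 /word_bound expnS; set x := (gN n k + _ + _)%N.
  apply: (@leq_trans (x + 2)); first by lia.
  by rewrite leq_pmulr // expn_gt0 addn2.
pose N := gN n k; pose M := gM n k m.
have NM : (N <= c * n0)%N /\ (M <= c * m)%N.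
  have k1 : ((k + 5) * n <= (k + 5) * n0)%N by rewrite leq_mul2l nn orbT.
  have k2 : (n * (k + 4) <= 2 * m * (k + 4))%N by rewrite leq_mul2r nm orbT.
  have k3 : (n0 <= k * n0)%N by rewrite leq_pmull.
  by rewrite /N /M /gN /gM /c; split; lia.
have TF : (f N M <= h n0 m R + 1)%N.
  have [a1 a2] := NM; have := leq_bigO_args f a1 a2.
  have : (bigO_args f c n0 m <= bigO_args f c n0 m * log_pos R)%N by rewrite leq_pmulr.
  by rewrite /h; lia.
apply: fin (prog_ok k0 m0 sE _ B0E _) erefl _.
- move=> L /andP[L0 Ll]; apply: Hb => //; first exact: sq_total_le.
  apply: leq_trans Ll _; apply: leq_trans nn.
  exact: leq_trans (ltn_expl _ (isT : (1 < 2)%N)) (trunc_logP (isT : (1 < 2)%N) np).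
- move=> tst.
  have sF : simple_graph (gF n k m r (rtl E) (rhd E) (rwt E) tst).
    apply: gF_simple => //; [exact: rtl_lt | exact: rhd_lt | exact: r_inj].
  have wF : weights_in (gF n k m r (rtl E) (rhd E) (rwt E) tst) 0 (2 * gX n k r)%N%:Z.
    by apply: gF_weights => //; [exact: rtl_lt | exact: rwt_le_sq_total].
  have [//|t [s [X tf out]]] := HP _ _ _ _ sF wF.
  rewrite size_gF in X tf; exists t, s; split; [|exact: tf | exact: out].
  apply: exec_leq X; rewrite /B0 /word_bound leq_pexp2l // addn2; lia.
- apply: leq_trans (total_time_le k nn nm TF _) _; first by rewrite /h; lia.
  by rewrite !leq_mul2r /C; apply/orP; right; apply/orP; right; rewrite /C0; lia.
Qed.
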